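(* Let $K$ be a field (of arbitrary characteristic) and let $A=KQ/I$ be the Xu--Snashall algebra over $K$. Let $\mathcal N$, $G$ and $\mathcal G$ be, respectively, the ideal, the weak Gerstenhaber ideal and the Gerstenhaber ideal of the Hochschild cohomology ring $\mathrm{HH}^*(A)$ generated by all homogeneous nilpotent elements. Then: (1) $G=\mathcal N$; hence $\mathrm{HH}^*(A)/G=\mathrm{HH}^*(A)/\mathcal N$ is not a finitely generated $K$-algebra. (2) $\mathrm{HH}^*(A)/\mathcal G\cong K$.
   Context: Xu--Snashall algebra: $Q$ is the quiver with two vertices $1,2$, two loops $a,b$ at vertex $1$ and one arrow $c\colon 1\to 2$. Paths are written from left to right (a product $\alpha\beta$ of arrows is a path if the target of $\alpha$ is the source of $\beta$). $I$ is the two-sided ideal of the path algebra $KQ$ generated by $a^2,\ b^2,\ ab-ba,\ ac$, and $A=KQ/I$. Hochschild cohomology and its Gerstenhaber structure: $C^n(A)=\mathrm{Hom}_K(A^{\otimes n},A)$ with $\delta^n(f)(a_1\otimes\cdots\otimes a_{n+1})=(-1)^{n+1}a_1f(a_2\otimes\cdots\otimes a_{n+1})+\sum_{i=1}^n(-1)^{n+1-i}f(a_1\otimes\cdots\otimes a_ia_{i+1}\otimes\cdots\otimes a_{n+1})+f(a_1\otimes\cdots\otimes a_n)a_{n+1}$; $\mathrm{HH}^*(A)$ is its cohomology. For $f\in C^m(A)$, $g\in C^n(A)$, the cup product is $(f\cup g)(a_1\otimes\cdots\otimes a_{m+n})=(-1)^{mn}f(a_1\otimes\cdots\otimes a_m)g(a_{m+1}\otimes\cdots\otimes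 a_{m+n})$. The bracket is $[f,g]=f\,\overline{\circ}\,g-(-1)^{(m-1)(n-1)}g\,\overline{\circ}\,f$, where $f\,\overline\circ\, g=\sum_{i=1}^m f\circ_i g$ and $(f\circ_i g)(a_1\otimes\cdots\otimes a_{m+n-1})=(-1)^{(i-1)(n-1)}f(a_1\otimes\cdots\otimes a_{i-1}\otimes g(a_i\otimes\cdots\otimes a_{i+n-1})\otimes a_{i+n}\otimes\cdots\otimes a_{m+n-1})$ (for $n=0$ the element $g\in A$ is inserted in position $i$; for $m=0$, $f\,\overline\circ\, g=0$). These induce on $\mathrm{HH}^*(A)$ a graded commutative product and a graded Lie bracket of degree $-1$ (a Gerstenhaber algebra). $\mathcal N$ is the ideal (for the cup product) of $\mathrm{HH}^*(A)$ generated by all homogeneous nilpotent elements. $G$ is the minimal ideal for the cup product containing $\mathcal N$ and closed under the bracket, i.e. $[G,G]\subseteq G$. $\mathcal G$ is the minimal ideal for the cup product containing $\mathcal N$ that is also a Lie ideal, i.e. $[\mathrm{HH}^*(A),\mathcal G]\subseteq\mathcal G$. *)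

(* Defs.v *)
From HB Require Import structures.
From mathcomp Require Import all_boot all_algebra.
From mathcomp Require Import boolp functions.

Set Implicit Arguments.
Unset Strict Implicit.
Unset Printing Implicit Defensive.

Import GRing.Theory.
Local Open Scope ring_scope.
Local Open Scope quotient_scope.

(* Two-sided ideals; as predicates they are boolean, through the classical    *)
(* reflection `[< _ >], so that the quotients of generic_quotient apply.      *)
HB.mixin Record isIdeal2 (R : pzRingType) (S : R -> bool) := {
  ideal2Ml : forall a u : R, u \in (S : {pred R}) -> a * u \in (S : {pred R});
  ideal2Mr : forall a u : R, u \in (S : {pred R}) -> u * a \in (S : {pred R})
}.

#[short(type="ideal2")]
HB.structure Definition Ideal2 (R : pzRingType) :=
  {S of GRing.ZmodClosed R S & isIdeal2 R S}.

Section Ideals.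
Variable R : pzRingType.

(* The smallest ideal satisfying P, when P is stable under intersections. *)
Definition smallest_pred (P : ideal2 R -> Prop) : {pred R} :=
  fun x => `[< forall J : ideal2 R, P J -> x \in J >].

Lemma smallestP P x :
  reflect (forall J : ideal2 R, P J -> x \in J) (x \in smallest_pred P).
Proof. exact: asboolP. Qed.

Lemma smallest_zmod P : zmod_closed (smallest_pred P).
Proof.
split; first by apply/smallestP => J _; exact: rpred0.
move=> x y /smallestP xP /smallestP yP; apply/smallestP => J PJ.
by rewrite rpredB ?xP ?yP.
Qed.

Lemma smallest_Ml P a u :
  u \in smallest_pred P -> a * u \in smallest_pred P.
Proof.
by move=> /smallestP uP; apply/smallestP => J PJ; apply/ideal2Ml/uP.
Qed.

Lemma smallest_Mr P a u :
  u \in smallest_pred P -> u * a \in smallest_pred P.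
Proof.
by move=> /smallestP uP; apply/smallestP => J PJ; apply/ideal2Mr/uP.
Qed.

HB.instance Definition _ P :=
  GRing.isZmodClosed.Build R (smallest_pred P) (smallest_zmod P).
HB.instance Definition _ P :=
  isIdeal2.Build R (smallest_pred P) (@smallest_Ml P) (@smallest_Mr P).

Definition smallest_ideal (P : ideal2 R -> Prop) : ideal2 R := smallest_pred P.

Definition ideal_gen (S : R -> Prop) : ideal2 R :=
  smallest_ideal (fun J => forall x, S x -> x \in J).

End Ideals.

Section QuotientAlgebra.
Variables (K : pzRingType) (A : algType K) (J : ideal2 A).

Definition quot_alg : Type := Quotient.quot J.

HB.instance Definition _ := GRing.Zmodule.on quot_alg.
HB.instance Definition _ := EqQuotient.on quot_alg.

Lemma pi_quotE (x y : A) : \pi_quot_alg x = \pi_quot_alg y <-> x - y \in J.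
Proof. by rewrite (Quotient.idealrBE J); split=> /eqP. Qed.

Lemma quot_repr_sub (x : A) : x - repr (\pi_quot_alg x) \in J.
Proof. by apply/pi_quotE; rewrite reprK. Qed.

Lemma quotP (x : quot_alg) : exists a : A, x = \pi_quot_alg a.
Proof. by exists (repr x); rewrite reprK. Qed.

Definition quot_one : quot_alg := \pi_quot_alg (1 : A).
Definition quot_mul (x y : quot_alg) : quot_alg := \pi_quot_alg (repr x * repr y).
Definition quot_scale (k : K) (x : quot_alg) : quot_alg := \pi_quot_alg (k *: repr x).

Lemma quot_piD (x y : A) :
  \pi_quot_alg (x + y) = \pi_quot_alg x + \pi_quot_alg y.
Proof. by rewrite !piE. Qed.

Lemma ideal2Z (k : K) (x : A) : x \in J -> k *: x \in J.
Proof. by move=> Jx; rewrite -[x]mul1r scalerAl ideal2Ml. Qed.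

Lemma quot_piM (x y : A) :
  quot_mul (\pi_quot_alg x) (\pi_quot_alg y) = \pi_quot_alg (x * y).
Proof.
symmetry; apply/pi_quotE; have := quot_repr_sub x; have := quot_repr_sub y.
move: (repr (\pi x)) (repr (\pi y)) => x' y' Jy Jx.
have -> : x * y - x' * y' = x * (y - y') + (x - x') * y'.
  by rewrite mulrBr mulrBl addrA subrK.
by apply: rpredD; [apply: ideal2Ml | apply: ideal2Mr].
Qed.

Lemma quot_piZ (k : K) (x : A) :
  quot_scale k (\pi_quot_alg x) = \pi_quot_alg (k *: x).
Proof.
by symmetry; apply/pi_quotE; rewrite -scalerBr; apply/ideal2Z/quot_repr_sub.
Qed.

Fact quot_mulA : associative quot_mul.
Proof.
move=> x y z; have [a ->] := quotP x; have [b ->] := quotP y; have [c ->] := quotP z.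
by rewrite !quot_piM mulrA.
Qed.
Fact quot_mul1 : left_id quot_one quot_mul.
Proof. by move=> x; have [a ->] := quotP x; rewrite quot_piM mul1r. Qed.
Fact quot_mulr1 : right_id quot_one quot_mul.
Proof. by move=> x; have [a ->] := quotP x; rewrite quot_piM mulr1. Qed.
Fact quot_mulDl : left_distributive quot_mul +%R.
Proof.
move=> x y z; have [a ->] := quotP x; have [b ->] := quotP y; have [c ->] := quotP z.
by rewrite -quot_piD !quot_piM mulrDl quot_piD.
Qed.
Fact quot_mulDr : right_distributive quot_mul +%R.
Proof.
move=> x y z; have [a ->] := quotP x; have [b ->] := quotP y; have [c ->] := quotP z.
by rewrite -quot_piD !quot_piM mulrDr quot_piD.
Qed.
HB.instance Definition _ := GRing.Zmodule_isPzRing.Build quot_alg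
  quot_mulA quot_mul1 quot_mulr1 quot_mulDl quot_mulDr.

Fact quot_scaleA k l x : quot_scale k (quot_scale l x) = quot_scale (k * l) x.
Proof. by have [a ->] := quotP x; rewrite !quot_piZ scalerA. Qed.
Fact quot_scale1 : left_id 1 quot_scale.
Proof. by move=> x; have [a ->] := quotP x; rewrite quot_piZ scale1r. Qed.
Fact quot_scaleDr : right_distributive quot_scale +%R.
Proof.
move=> k x y; have [a ->] := quotP x; have [b ->] := quotP y.
by rewrite -quot_piD !quot_piZ scalerDr quot_piD.
Qed.
Fact quot_scaleDl x : {morph quot_scale^~ x : k l / k + l}.
Proof.
by move=> k l; have [a ->] := quotP x; rewrite !quot_piZ scalerDl quot_piD.
Qed.
HB.instance Definition _ := GRing.Zmodule_isLmodule.Build K quot_alg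
  quot_scaleA quot_scale1 quot_scaleDr quot_scaleDl.

Fact quot_scalerAl (k : K) (x y : quot_alg) : k *: (x * y) = (k *: x) * y.
Proof.
rewrite /GRing.scale /GRing.mul /=.
have [a ->] := quotP x; have [b ->] := quotP y.
by rewrite !(quot_piZ, quot_piM) scalerAl.
Qed.
Fact quot_scalerAr (k : K) (x y : quot_alg) : k *: (x * y) = x * (k *: y).
Proof.
rewrite /GRing.scale /GRing.mul /=.
have [a ->] := quotP x; have [b ->] := quotP y.
by rewrite !(quot_piZ, quot_piM) scalerAr.
Qed.
(* The quotient may be zero, so in general it is only a pzRingType and an     *)
(* lmodType; the two lemmas above make it a K-algebra.                        *)
Definition quot_fin_gen : Prop :=
  exists s : seq quot_alg, forall S : {pred quot_alg},
    [/\ 1 \in S, GRing.linear_closed S & GRing.mulr_2closed S] ->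
    {subset s <= S} -> forall x : quot_alg, x \in S.

(* K^o is K as a K-module. *)
Definition quot_iso_scalars : Prop :=
  exists phi : {rmorphism quot_alg -> K},
    scalable (phi : quot_alg -> K^o) /\ bijective phi.

End QuotientAlgebra.

(* Sums over the decompositions s = u ++ v and s = u ++ v ++ w of a list. *)
Section SplitSums.
Variables (T : Type) (V : zmodType).
Implicit Types (s u v w : seq T).

Definition sum2 (F : seq T -> seq T -> V) s : V :=
  \sum_(i < (size s).+1) F (take i s) (drop i s).

Definition sum3 (F : seq T -> seq T -> seq T -> V) s : V :=
  sum2 (fun u => sum2 (F u)) s.

Lemma sum2_nil F : sum2 F [::] = F [::] [::].
Proof. by rewrite /sum2 big_ord1. Qed.

Lemma sum2_cons F x s :
  sum2 F (x :: s) = F [::] (x :: s) + sum2 (fun u v => F (x :: u) v) s.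
Proof. by rewrite /sum2 big_ord_recl. Qed.

Lemma eq_sum2 F G s :
  (forall u v, u ++ v = s -> F u v = G u v) -> sum2 F s = sum2 G s.
Proof. by move=> FG; apply: eq_bigr => i _; rewrite FG ?cat_take_drop. Qed.

Lemma sum2_0 s : sum2 (fun _ _ => 0) s = 0.
Proof. exact: big1. Qed.

Lemma sum2D F G s : sum2 (fun u v => F u v + G u v) s = sum2 F s + sum2 G s.
Proof. exact: big_split. Qed.

Lemma sum2N F s : sum2 (fun u v => - F u v) s = - sum2 F s.
Proof. by rewrite /sum2 sumrN. Qed.

Lemma sum2A F s :
  sum2 (fun u v => sum2 (F u) v) s =
  sum2 (fun u w => sum2 (fun u1 u2 => F u1 u2 w) u) s.
Proof.
elim: s F => [|x s IHs] F; first by rewrite !sum2_nil.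
rewrite !sum2_cons IHs !sum2_nil -addrA -sum2D; congr (_ + _).
by apply: eq_sum2 => u v _; rewrite sum2_cons.
Qed.

Lemma sum2_cat F u y w :
  sum2 F (u ++ y :: w) =
  sum2 (fun u1 u2 => F u1 (u2 ++ y :: w)) u +
  sum2 (fun w1 w2 => F (u ++ y :: w1) w2) w.
Proof.
elim: u F => [|x u IHu] F /=; first by rewrite sum2_nil sum2_cons.
by rewrite !sum2_cons IHu addrA.
Qed.

Lemma sum3_cat F u y w :
  sum3 F (u ++ y :: w) =
  sum3 (fun u1 u2 u3 => F u1 u2 (u3 ++ y :: w)) u +
  sum2 (fun u1 u2 => sum2 (fun w1 w2 => F u1 (u2 ++ y :: w1) w2) w) u +
  sum3 (fun w1 w2 w3 => F (u ++ y :: w1) w2 w3) w.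
Proof.
rewrite /sum3 sum2_cat -sum2D; congr (_ + _); apply: eq_sum2 => u1 u2 _.
by rewrite sum2_cat.
Qed.

End SplitSums.

Lemma sum2_morph (T : Type) (V W : zmodType) (g : {additive V -> W})
    (F : seq T -> seq T -> V) s :
  g (sum2 F s) = sum2 (fun u v => g (F u v)) s.
Proof. exact: raddf_sum. Qed.

(* The quiver Q: two vertices, loops a and b at vertex 1, an arrow c : 1 -> 2 *)
Variant vertex := vertex1 | vertex2.
Variant arrow := arrow_a | arrow_b | arrow_c.

Definition src (e : arrow) : vertex := vertex1.
Definition tgt (e : arrow) : vertex :=
  if e is arrow_c then vertex2 else vertex1.

Definition vertex_to_bool (i : vertex) := if i is vertex1 then true else false.
Definition vertex_of_bool (t : bool) := if t then vertex1 else vertex2.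
Lemma vertex_boolK : cancel vertex_to_bool vertex_of_bool. Proof. by case. Qed.
HB.instance Definition _ := Equality.copy vertex (can_type vertex_boolK).

Definition arrow_to_nat (e : arrow) : nat :=
  match e with arrow_a => 0%N | arrow_b => 1%N | arrow_c => 2%N end.
Definition arrow_of_nat (n : nat) : arrow :=
  match n with 0%N => arrow_a | 1%N => arrow_b | _ => arrow_c end.
Lemma arrow_natK : cancel arrow_to_nat arrow_of_nat. Proof. by case. Qed.
HB.instance Definition _ := Equality.copy arrow (can_type arrow_natK).

(* A path is a pair (i, s): the source and the arrows from left to right;     *)
(* (i, [::]) is the stationary path at i.                                     *)
Fixpoint is_path (i : vertex) (s : seq arrow) : bool :=
  if s is e :: s' then (src e == i) && is_path (tgt e) s' else true.

Definition path_end (i : vertex) (s : seq arrow) : vertex :=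
  last i (map tgt s).

Lemma is_path_cat i s t :
  is_path i (s ++ t) = is_path i s && is_path (path_end i s) t.
Proof. by elim: s i => //= e s IHs i; rewrite IHs andbA. Qed.

Lemma path_end_cat i s t :
  path_end i (s ++ t) = path_end (path_end i s) t.
Proof. by rewrite /path_end map_cat last_cat. Qed.

Section PathAlgebra.
Variable K : fieldType.

(* An element of KQ is the family of its coefficients.  There are finitely    *)
(* many paths of each length, so finitely supported means bounded length.     *)
Definition path_supported (x : vertex * seq arrow -> K^o) : Prop :=
  (forall p, ~~ is_path p.1 p.2 -> x p = 0) /\
  (exists n, forall p, (n <= size p.2)%N -> x p = 0).

Definition path_pred : {pred vertex * seq arrow -> K^o} :=
  fun x => `[< path_supported x >].

Record path_alg := PathAlg {
  path_coef :> vertex * seq arrow -> K^o;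
  _ : path_coef \in path_pred
}.

HB.instance Definition _ := [isSub for path_coef].
HB.instance Definition _ := [Choice of path_alg by <:].

Lemma path_pred_submod : GRing.submod_closed path_pred.
Proof.
split; first by apply/asboolP; split=> //; exists 0%N.
move=> k x y /asboolP[xP [n xn]] /asboolP[yP [m ym]]; apply/asboolP; split.
  by move=> p pP; rewrite !fctE xP ?yP // scaler0 addr0.
exists (maxn n m) => p; rewrite geq_max => /andP[np mp].
by rewrite !fctE xn ?ym // scaler0 addr0.
Qed.
HB.instance Definition _ := GRing.isSubmodClosed.Build K _ path_pred
  path_pred_submod.
HB.instance Definition _ := [SubChoice_isSubLmodule of path_alg by <:].

Lemma path_algP (x : path_alg) : path_supported x.
Proof. by apply/asboolP; case: x. Qed.

Lemma path_alg_eq (x y : path_alg) :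
  (forall i s, x (i, s) = y (i, s)) -> x = y.
Proof. by move=> xy; apply/val_inj/funext => -[i s]; apply: xy. Qed.

Lemma path_coefD (x y : path_alg) p : (x + y) p = x p + y p.
Proof. by []. Qed.

Lemma path_coefZ (k : K) (x : path_alg) p : (k *: x) p = k * x p.
Proof. by []. Qed.

Definition path_one_fun (p : vertex * seq arrow) : K^o := (nilp p.2)%:R.

Definition path_mul_fun (x y : vertex * seq arrow -> K^o)
    (p : vertex * seq arrow) : K^o :=
  sum2 (fun s t => (x (p.1, s) : K) * y (path_end p.1 s, t)) p.2.

Definition path_basis_fun (q p : vertex * seq arrow) : K^o :=
  (is_path q.1 q.2 && (p == q))%:R.

Fact path_one_subproof : path_one_fun \in path_pred.
Proof.
apply/asboolP; split; first by move=> [i [|e s]].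
by exists 1%N => -[i [|e s]].
Qed.
Definition path_one : path_alg := PathAlg path_one_subproof.

Fact path_mul_subproof (x y : path_alg) : path_mul_fun x y \in path_pred.
Proof.
have [xP [n xn]] := path_algP x; have [yP [m ym]] := path_algP y.
apply/asboolP; split=> [[i s] /= iP|].
  rewrite /path_mul_fun -(sum2_0 K s); apply: eq_sum2 => u v /= uv.
  move: iP; rewrite -uv is_path_cat negb_and.
  by case/orP=> ?; [rewrite xP ?mul0r | rewrite yP ?mulr0].
exists (n + m)%N => -[i s] /= sP.
rewrite /path_mul_fun -(sum2_0 K s); apply: eq_sum2 => u v /= uv.
have [nu|un] := leqP n (size u); first by rewrite xn ?mul0r.
rewrite ym ?mulr0 //= -(leq_add2l (size u)) -size_cat uv.
by apply: leq_trans sP; rewrite leq_add2r ltnW.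
Qed.
Definition path_mul (x y : path_alg) : path_alg :=
  PathAlg (path_mul_subproof x y).

Fact path_basis_subproof q : path_basis_fun q \in path_pred.
Proof.
apply/asboolP; split=> [p|].
  by rewrite /path_basis_fun; have [->|] := eqVneq; rewrite ?andbF // andbT => /negPf->.
exists (size q.2).+1 => p; rewrite /path_basis_fun.
by have [->|] := eqVneq; rewrite ?andbF // ltnn.
Qed.
(* The basis element of KQ given by the path q (and 0 if q is not a path). *)
Definition path_basis (q : vertex * seq arrow) : path_alg :=
  PathAlg (path_basis_subproof q).

Fact path_mulA : associative path_mul.
Proof.
move=> x y z; apply: path_alg_eq => i s /=; rewrite /path_mul_fun /=.
have -> : sum2 (fun u v => (x (i, u) : K) * (path_mul y z) (path_end i u, v)) s
   = sum2 (fun u v => sum2 (fun v1 v2 =>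
      (x (i, u) : K) * y (path_end i u, v1) * z (path_end i (u ++ v1), v2)) v) s.
  apply: eq_sum2 => u v _; rewrite /= /path_mul_fun /=.
  rewrite /sum2 mulr_sumr; apply: eq_bigr => j _.
  by rewrite path_end_cat mulrA.
rewrite (sum2A (fun u v1 v2 =>
   (x (i, u) : K) * y (path_end i u, v1) * z (path_end i (u ++ v1), v2))).
apply: eq_sum2 => u v _; rewrite /= /path_mul_fun /=.
rewrite /sum2 mulr_suml; apply: eq_bigr => j _.
by rewrite cat_take_drop.
Qed.

Fact path_mul1 : left_id path_one path_mul.
Proof.
move=> x; apply: path_alg_eq => i s /=; rewrite /path_mul_fun /=.
case: s => [|e s]; first by rewrite sum2_nil mul1r.
rewrite sum2_cons mul1r -[RHS]addr0; congr (_ + _).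
by rewrite -[RHS](sum2_0 K s); apply: eq_sum2 => u v _; rewrite mul0r.
Qed.

Fact path_mulr1 : right_id path_one path_mul.
Proof.
move=> x; apply: path_alg_eq => i s /=; rewrite /path_mul_fun /=.
elim/last_ind: s => [|s e _]; first by rewrite sum2_nil mulr1.
rewrite -cats1 sum2_cat sum2_nil mulr1 -[RHS]add0r; congr (_ + _).
rewrite -[RHS](sum2_0 K s); apply: eq_sum2 => u v _.
by case: v => [|f v]; rewrite mulr0.
Qed.

Fact path_mulDl : left_distributive path_mul +%R.
Proof.
move=> x y z; apply: path_alg_eq => i s; rewrite path_coefD /= /path_mul_fun /=.
rewrite -[RHS]sum2D; apply: eq_sum2 => u v _; exact: mulrDl.
Qed.
Fact path_mulDr : right_distributive path_mul +%R.
Proof.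
move=> x y z; apply: path_alg_eq => i s; rewrite path_coefD /= /path_mul_fun /=.
rewrite -[RHS]sum2D; apply: eq_sum2 => u v _; exact: mulrDr.
Qed.
Fact path_one_neq0 : path_one != 0.
Proof.
apply/eqP => /(congr1 (fun x : path_alg => x (vertex1, [::]))) /eqP.
by rewrite /= oner_eq0.
Qed.
HB.instance Definition _ := GRing.Zmodule_isNzRing.Build path_alg
  path_mulA path_mul1 path_mulr1 path_mulDl path_mulDr path_one_neq0.

Fact path_scalerAl (k : K) (x y : path_alg) : k *: (x * y) = (k *: x) * y.
Proof.
apply: path_alg_eq => i s; rewrite path_coefZ /= /path_mul_fun /sum2 /=.
rewrite mulr_sumr; apply: eq_bigr => j _; exact: mulrA.
Qed.
HB.instance Definition _ := GRing.Lmodule_isLalgebra.Build K path_alg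
  path_scalerAl.
Fact path_scalerAr (k : K) (x y : path_alg) : k *: (x * y) = x * (k *: y).
Proof.
apply: path_alg_eq => i s; rewrite path_coefZ /= /path_mul_fun /sum2 /=.
rewrite mulr_sumr; apply: eq_bigr => j _; exact: mulrCA.
Qed.
HB.instance Definition _ := GRing.Lalgebra_isAlgebra.Build K path_alg
  path_scalerAr.

Definition arrow_elt (e : arrow) : path_alg := path_basis (src e, [:: e]).

Definition xs_relations : seq path_alg :=
  let a := arrow_elt arrow_a in
  let b := arrow_elt arrow_b in
  let c := arrow_elt arrow_c in
  [:: a ^+ 2; b ^+ 2; a * b - b * a; a * c].

Definition xs_ideal : ideal2 path_alg :=
  ideal_gen (fun x => x \in xs_relations).

(* The Xu--Snashall algebra A = KQ/I. *)
Definition xs_alg : Type := quot_alg xs_ideal.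

HB.instance Definition _ := GRing.PzRing.on xs_alg.
HB.instance Definition _ := GRing.Lmodule.on xs_alg.

End PathAlgebra.

Section XuSnashallNontrivial.
Variable K : fieldType.

(* The coefficient of the stationary path at vertex 2 is a K-algebra map      *)
(* KQ -> K vanishing on I, so that 1 is not in I and A != 0.                  *)
Definition xs_aug_pred : {pred path_alg K} :=
  fun x => x (vertex2, [::]) == 0.

Lemma path_mul_stationary (x y : path_alg K) i :
  (x * y) (i, [::]) = (x (i, [::]) : K) * y (i, [::]).
Proof. exact: sum2_nil. Qed.

Lemma xs_aug_zmod : zmod_closed xs_aug_pred.
Proof.
split; first exact: eqxx.
move=> x y /eqP x0 /eqP y0; apply/eqP.
by rewrite path_coefD x0 add0r -[RHS]oppr0 -[in RHS]y0.
Qed.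
Lemma xs_aug_Ml (a u : path_alg K) : u \in xs_aug_pred -> a * u \in xs_aug_pred.
Proof. by move=> /eqP E; apply/eqP; rewrite path_mul_stationary E mulr0. Qed.
Lemma xs_aug_Mr (a u : path_alg K) : u \in xs_aug_pred -> u * a \in xs_aug_pred.
Proof. by move=> /eqP E; apply/eqP; rewrite path_mul_stationary E mul0r. Qed.
HB.instance Definition _ :=
  GRing.isZmodClosed.Build (path_alg K) xs_aug_pred xs_aug_zmod.
HB.instance Definition _ :=
  isIdeal2.Build (path_alg K) xs_aug_pred xs_aug_Ml xs_aug_Mr.

Fact xs_one_neq0 : 1 != 0 :> xs_alg K.
Proof.
apply/eqP => E; have /smallestP/(_ (xs_aug_pred : ideal2 _)) : 1 \in xs_ideal K.
  by rewrite -[1]subr0; apply/pi_quotE; rewrite [LHS]E !piE.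
have arr e : arrow_elt K e \in xs_aug_pred by apply/eqP; case: e.
have rel x : x \in xs_relations K -> x \in xs_aug_pred.
  rewrite !inE => /or4P[] /eqP->; rewrite ?rpredB ?expr2 //;
    by apply: xs_aug_Ml; apply: arr.
by move=> /(_ rel) /eqP /eqP; rewrite oner_eq0.
Qed.
HB.instance Definition _ := GRing.PzSemiRing_isNonZero.Build (xs_alg K) xs_one_neq0.
HB.instance Definition _ := GRing.Lmodule_isLalgebra.Build K (xs_alg K)
  (@quot_scalerAl K (path_alg K) (xs_ideal K)).
HB.instance Definition _ := GRing.Lalgebra_isAlgebra.Build K (xs_alg K)
  (@quot_scalerAr K (path_alg K) (xs_ideal K)).

End XuSnashallNontrivial.

Section Hochschild.
Variables (K : fieldType) (A : algType K).
Implicit Types (f g h : seq A -> A) (s u v w : seq A).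

(* An element of the direct sum of the C^n(A) = Hom_K(A^{(x) n}, A) is one    *)
(* function on lists: its component in degree n is its restriction to lists   *)
(* of length n, a K-multilinear map in n variables, and it has finitely many  *)
(* nonzero components.                                                        *)
Definition multilinear f : Prop :=
  forall u w (k : K) (x y : A),
    f (u ++ (k *: x + y) :: w) = k *: f (u ++ x :: w) + f (u ++ y :: w).

Definition bounded_degree f : Prop :=
  exists n, forall s, (n <= size s)%N -> f s = 0.

(* For s = [:: a_1; ...; a_(n+1)]; the index i below is the usual one minus 1 *)
Definition hoch_delta f s : A :=
  if s is a :: t then
    (-1) ^+ (size t).+1 *: (a * f t)
    + \sum_(i < size t) (-1) ^+ (size t - i) *:
        f (take i s ++ (s`_i * s`_i.+1) :: drop i.+2 s)
    + f (belast a t) * last a t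
  else 0.

Definition hoch_one s : A := (nilp s)%:R.

Definition hoch_cup f g s : A :=
  sum2 (fun u v => (-1) ^+ (size u * size v) *: (f u * g v)) s.

(* In a term f (u ++ g v :: w) of f o_i g, f and g are taken in degrees       *)
(* m = size u + size w + 1 and n = size v, and i = size u + 1.  Exponents     *)
(* n - 1 and m - 1 are written n + 1 and m + 1 since n and m may be 0.        *)
Definition hoch_circ f g s : A :=
  sum3 (fun u v w =>
    (-1) ^+ (size u * (size v).+1) *: f (u ++ g v :: w)) s.

(* f o g - (-1)^((m-1)(n-1)) g o f, with f in degree m = size v and g in      *)
(* degree n = size u + size w + 1 in the second sum.                          *)
Definition hoch_bracket f g s : A :=
  hoch_circ f g s -
  sum3 (fun u v w =>
    (-1) ^+ ((size v).+1 * (size u + size w).+2) *: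
      ((-1) ^+ (size u * (size v).+1) *: g (u ++ f v :: w))) s.

Lemma sgn_parity m n : odd m = odd n -> (-1) ^+ m = (-1) ^+ n :> K.
Proof. by move=> mn; rewrite -signr_odd mn signr_odd. Qed.

Lemma sum2Z (k : K) (F : seq A -> seq A -> A) s :
  sum2 (fun u v => k *: F u v) s = k *: sum2 F s.
Proof. by rewrite /sum2 scaler_sumr. Qed.

Lemma sum3_lin (k : K) (F G : seq A -> seq A -> seq A -> A) s :
  sum3 (fun u v w => k *: F u v w + G u v w) s = k *: sum3 F s + sum3 G s.
Proof.
rewrite /sum3 -sum2Z -sum2D; apply: eq_sum2 => u v _.
by rewrite sum2D sum2Z.
Qed.

Lemma sum3Z (k : K) (F : seq A -> seq A -> seq A -> A) s :
  sum3 (fun u v w => k *: F u v w) s = k *: sum3 F s.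
Proof. by rewrite /sum3 -sum2Z; apply: eq_sum2 => u v _; rewrite sum2Z. Qed.

Lemma sum3D (F G : seq A -> seq A -> seq A -> A) s :
  sum3 (fun u v w => F u v w + G u v w) s = sum3 F s + sum3 G s.
Proof. by rewrite /sum3 -sum2D; apply: eq_sum2 => u v _; rewrite sum2D. Qed.

Lemma eq_sum3 (F G : seq A -> seq A -> seq A -> A) s :
  (forall u v w, u ++ v ++ w = s -> F u v w = G u v w) -> sum3 F s = sum3 G s.
Proof.
move=> FG; apply: eq_sum2 => u v uv; apply: eq_sum2 => v1 v2 v12.
by apply: FG; rewrite v12.
Qed.

Lemma sum3_0 s : sum3 (fun _ _ _ => 0 : A) s = 0.
Proof. by rewrite -[RHS](sum2_0 A s); apply: eq_sum2 => u v _; rewrite sum2_0. Qed.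

Definition sum5 (F : seq A -> seq A -> seq A -> seq A -> seq A -> A) s : A :=
  sum3 (fun u v => sum3 (F u v)) s.

Lemma eq_sum5 F G s : (forall u1 u2 u3 u4 u5, F u1 u2 u3 u4 u5 = G u1 u2 u3 u4 u5) ->
  sum5 F s = sum5 G s.
Proof. by move=> FG; do 2!apply: eq_sum3 => *; apply: FG. Qed.

Lemma sum5_left F s :
  sum3 (fun U v w => sum3 (fun u1 u2 u3 => F u1 u2 u3 v w) U) s = sum5 F s.
Proof.
rewrite /sum5 /sum3.
transitivity (sum2 (fun U V => sum2 (fun u1 u23 => sum2 (fun u2 u3 =>
   sum2 (fun v w => F u1 u2 u3 v w) V) u23) U) s).
  apply: eq_sum2 => U V _; rewrite /sum2 exchange_big; apply: eq_bigr => i _ /=.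
  by rewrite exchange_big.
rewrite -(sum2A (fun u1 u23 V => sum2 (fun u2 u3 =>
   sum2 (fun v w => F u1 u2 u3 v w) V) u23)).
apply: eq_sum2 => u1 r _.
by rewrite -(sum2A (fun u2 u3 V => sum2 (fun v w => F u1 u2 u3 v w) V)).
Qed.

Lemma sum5_mid F s :
  sum3 (fun U v W => sum2 (fun u1 u2 => sum2 (fun w1 w2 =>
    F u1 u2 v w1 w2) W) U) s = sum5 F s.
Proof.
rewrite /sum5 /sum3.
transitivity (sum2 (fun U V => sum2 (fun u1 u2 =>
   sum2 (fun v W => sum2 (fun w1 w2 => F u1 u2 v w1 w2) W) V) U) s).
  by apply: eq_sum2 => U V _; rewrite /sum2 exchange_big.
by rewrite -(sum2A (fun u1 u2 V =>
   sum2 (fun v W => sum2 (fun w1 w2 => F u1 u2 v w1 w2) W) V)).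
Qed.

Lemma sum5_in F s :
  sum3 (fun u V w => sum3 (fun v1 v2 v3 => F u v1 v2 v3 w) V) s = sum5 F s.
Proof.
rewrite /sum5 /sum3; apply: eq_sum2 => u r _.
rewrite -(sum2A (fun v1 V w => sum2 (fun v2 v3 => F u v1 v2 v3 w) V)).
by apply: eq_sum2 => v1 q _; rewrite -(sum2A (fun v2 v3 w => F u v1 v2 v3 w)).
Qed.

Section Multilinear.
Variable f : seq A -> A.
Hypothesis fL : multilinear f.

Lemma mlinD u w x y : f (u ++ (x + y) :: w) = f (u ++ x :: w) + f (u ++ y :: w).
Proof. by have := fL u w 1 x y; rewrite !scale1r. Qed.
Lemma mlin0 u w : f (u ++ 0 :: w) = 0.
Proof. by apply: (addrI (f (u ++ 0 :: w))); rewrite -mlinD !addr0. Qed.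
Lemma mlinZ u w k x : f (u ++ (k *: x) :: w) = k *: f (u ++ x :: w).
Proof. by rewrite -[k *: x]addr0 fL mlin0 addr0. Qed.
Lemma mlin_sum2 u w F s :
  f (u ++ sum2 F s :: w) = sum2 (fun a b => f (u ++ F a b :: w)) s.
Proof.
exact: (big_morph (fun x => f (u ++ x :: w)) (mlinD u w) (mlin0 u w)).
Qed.
Lemma mlin_sum3 u w F s :
  f (u ++ sum3 F s :: w) = sum3 (fun a b c => f (u ++ F a b c :: w)) s.
Proof.
by rewrite /sum3 mlin_sum2; apply: eq_sum2 => a b _; rewrite mlin_sum2.
Qed.
End Multilinear.

(* Insertion of g in f with arbitrary signs. *)
Definition hcomp (e : nat -> nat -> nat -> nat) f g s : A :=
  sum3 (fun u v w =>
    (-1) ^+ e (size u) (size v) (size w) *: f (u ++ g v :: w)) s.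

Lemma eq_hcomp e f f' g g' s : f =1 f' -> g =1 g' ->
  hcomp e f g s = hcomp e f' g' s.
Proof. by move=> ff gg; apply: eq_sum3 => u v w _; rewrite ff gg. Qed.

Lemma hcompDl e f f' g s :
  hcomp e (fun t => f t + f' t) g s = hcomp e f g s + hcomp e f' g s.
Proof. by rewrite -sum3D; apply: eq_sum3 => *; rewrite scalerDr. Qed.
Lemma hcompNl e f g s : hcomp e (fun t => - f t) g s = - hcomp e f g s.
Proof.
by rewrite -scaleN1r -sum3Z; apply: eq_sum3 => *; rewrite scalerN scaleN1r.
Qed.
Lemma hcompDr e f g g' s : multilinear f ->
  hcomp e f (fun t => g t + g' t) s = hcomp e f g s + hcomp e f g' s.
Proof.
by move=> fL; rewrite -sum3D; apply: eq_sum3 => *; rewrite mlinD ?scalerDr.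
Qed.
Lemma hcompNr e f g s : multilinear f ->
  hcomp e f (fun t => - g t) s = - hcomp e f g s.
Proof.
move=> fL; rewrite -scaleN1r -sum3Z; apply: eq_sum3 => u v w _.
by rewrite -scaleN1r mlinZ // !scalerA mulrC.
Qed.

Lemma hcomp_outer e e' f g h s :
  hcomp e (hcomp e' f g) h s =
  sum5 (fun u1 u2 u3 v w => (-1) ^+
      (e (size u1 + (size u2 + size u3)) (size v) (size w) +
       e' (size u1) (size u2) (size u3 + (size w).+1)) *:
      f (u1 ++ g u2 :: (u3 ++ h v :: w))) s
  + sum5 (fun u1 u2 v w1 w2 => (-1) ^+
      (e (size u1 + size u2) (size v) (size w1 + size w2) +
       e' (size u1) (size u2 + (size w1).+1) (size w2)) *:
      f (u1 ++ g (u2 ++ h v :: w1) :: w2)) s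
  + sum5 (fun u v w1 w2 w3 => (-1) ^+
      (e (size u) (size v) (size w1 + (size w2 + size w3)) +
       e' (size u + (size w1).+1) (size w2) (size w3)) *:
      f (u ++ h v :: (w1 ++ g w2 :: w3))) s.
Proof.
rewrite -sum5_left -sum5_mid /sum5 -!sum3D; apply: eq_sum3 => U v W _.
rewrite /hcomp sum3_cat !scalerDr; congr (_ + _ + _).
- rewrite -sum3Z; apply: eq_sum3 => u1 u2 u3 <-.
  by rewrite scalerA -exprD !size_cat.
- rewrite -sum2Z; apply: eq_sum2 => u1 u2 <-.
  rewrite -sum2Z; apply: eq_sum2 => w1 w2 <-.
  by rewrite scalerA -exprD !size_cat.
- rewrite -sum3Z; apply: eq_sum3 => w1 w2 w3 <-.
  by rewrite scalerA -exprD !size_cat /= -catA.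
Qed.

Lemma hcomp_inner e e' f g h s : multilinear f ->
  hcomp e f (hcomp e' g h) s =
  sum5 (fun u v1 v2 v3 w => (-1) ^+
      (e (size u) (size v1 + (size v2 + size v3)) (size w) +
       e' (size v1) (size v2) (size v3)) *:
      f (u ++ g (v1 ++ h v2 :: v3) :: w)) s.
Proof.
move=> fL; rewrite -sum5_in; apply: eq_sum3 => u V w _.
rewrite /hcomp mlin_sum3 // -sum3Z; apply: eq_sum3 => v1 v2 v3 <-.
by rewrite mlinZ // scalerA -exprD !size_cat.
Qed.

Definition sgnc (i j _ : nat) := (i * j.+1)%N.
Definition sgnr (_ j k : nat) := (k * j.+1)%N.

Lemma hoch_bracketE f g s :
  hoch_bracket f g s = hcomp sgnc f g s - hcomp sgnr g f s.
Proof.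
congr (_ - _); apply: eq_sum3 => u v w _; rewrite scalerA -exprD.
congr (_ *: _); apply: sgn_parity.
rewrite /sgnr !(oddD, oddM, oddS) /=.
by case: (odd (size u)); case: (odd (size v)); case: (odd (size w)).
Qed.

Definition hmu s : A :=
  match s with [:: x; y] => x * y | _ => 0 end.

Definition hiota s : A := if s is [:: x] then x else 0.

Lemma hmu_neq2 s : size s != 2%N -> hmu s = 0.
Proof. by case: s => [|x [|y [|z s]]]. Qed.

Lemma hmu_multilinear : multilinear hmu.
Proof.
move=> [|a [|b [|c u]]] [|d [|e w]] k x y /=; rewrite ?scaler0 ?addr0 //.
  by rewrite mulrDl scalerAl.
by rewrite mulrDr scalerAr.
Qed.

Lemma hmu_cat u x w :
  hmu (u ++ x :: w) = hoch_one u * (x * hiota w) + hiota u * x * hoch_one w.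
Proof.
case: u => [|a [|b u]] /=; rewrite /hoch_one /=.
- rewrite mul1r mul0r mul0r addr0.
  by case: w => [|y [|z w]] //=; rewrite mulr0.
- rewrite mul0r add0r; case: w => [|y w] /=; first by rewrite mulr1.
  by rewrite mulr0.
- by rewrite !mul0r addr0; case: u.
Qed.

Lemma sum2_onel (F : seq A -> seq A -> A) s :
  sum2 (fun u v => hoch_one u * F u v) s = F [::] s.
Proof.
case: s => [|a s]; first by rewrite sum2_nil mul1r.
rewrite sum2_cons mul1r -[RHS]addr0; congr (_ + _).
by rewrite -[RHS](sum2_0 A s); apply: eq_sum2 => u v _; rewrite mul0r.
Qed.

Lemma sum2_oner (F : seq A -> seq A -> A) s :
  sum2 (fun u v => F u v * hoch_one v) s = F s [::].
Proof.
elim/last_ind: s => [|s a _]; first by rewrite sum2_nil mulr1.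
rewrite -cats1 sum2_cat sum2_nil mulr1 -[RHS]add0r; congr (_ + _).
rewrite -[RHS](sum2_0 A s); apply: eq_sum2 => u v _.
by rewrite /hoch_one; case: v => [|b v]; rewrite mulr0.
Qed.

Definition hleft f s :=
  sum2 (fun u v => (-1) ^+ (size v).+1 *: (hiota u * f v)) s.
Definition hright f s := sum2 (fun u v => f u * hiota v) s.

Lemma hcomp_mul f s : hcomp sgnc hmu f s = hleft f s + hright f s.
Proof.
rewrite /hcomp /hleft /hright addrC.
transitivity (
  sum3 (fun u v w => hoch_one u * ((-1) ^+ sgnc (size u) (size v) (size w) *:
       (f v * hiota w))) s +
  sum3 (fun u v w => ((-1) ^+ sgnc (size u) (size v) (size w) *: (hiota u * f v))
       * hoch_one w) s).
  rewrite -sum3D; apply: eq_sum3 => u v w _.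
  by rewrite hmu_cat scalerDr; congr (_ + _);
    [exact: scalerAr | exact: scalerAl].
congr (_ + _).
  rewrite /sum3 (_ : sum2 _ _ = sum2 (fun u r => hoch_one u * sum2 (fun v w =>
     (-1) ^+ sgnc (size u) (size v) (size w) *: (f v * hiota w)) r) s).
    by rewrite sum2_onel; apply: eq_sum2 => u v _; rewrite scale1r.
  by apply: eq_sum2 => u r _; rewrite [in RHS]/sum2 mulr_sumr.
apply: eq_sum2 => u r _; rewrite sum2_oner.
case: u => [|a [|b u]] /=; rewrite ?mul0r ?scaler0 //.
by rewrite /sgnc mul1n.
Qed.

Lemma hleft_cons f a t : hleft f (a :: t) = (-1) ^+ (size t).+1 *: (a * f t).
Proof.
rewrite /hleft sum2_cons mul0r scaler0 add0r.
case: t => [|b t]; first by rewrite sum2_nil.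
rewrite sum2_cons -[RHS]addr0; congr (_ + _).
by rewrite -[RHS](sum2_0 A t); apply: eq_sum2 => u v _; rewrite mul0r scaler0.
Qed.

Lemma hright_rcons f p x : hright f (rcons p x) = f p * x.
Proof.
rewrite /hright -cats1 sum2_cat sum2_nil mulr0 addr0.
elim/last_ind: p => [|p y _]; first by rewrite sum2_nil.
rewrite -cats1 sum2_cat sum2_nil /= -[RHS]add0r; congr (_ + _).
rewrite -[RHS](sum2_0 A p); apply: eq_sum2 => u v _.
by case: v => [|? [|? ?]]; rewrite mulr0.
Qed.

Lemma hoch_deltaE f s : multilinear f ->
  hoch_delta f s = hleft f s + hright f s - hcomp sgnr f hmu s.
Proof.
move=> fL; have sum_mid (F : seq A -> A -> A -> seq A -> A) a t :
  \sum_(i < size t) F (take i (a :: t)) ((a :: t)`_i) ((a :: t)`_i.+1)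
      (drop i.+2 (a :: t)) =
  sum3 (fun u v w => if v is [:: x; y] then F u x y w else 0) (a :: t).
  elim: t a F => [|b t IHt] a F.
    by rewrite big_ord0 /sum3 !(sum2_cons, sum2_nil) /= !addr0.
  rewrite big_ord_recl [RHS]sum2_cons; congr (_ + _).
    rewrite !sum2_cons /= drop0 !add0r.
    case: t {IHt} => [|c t]; first by rewrite sum2_nil.
    rewrite sum2_cons -[LHS]addr0; congr (_ + _).
    rewrite -[LHS](sum2_0 A t); apply: eq_sum2 => u v _.
    by case: u.
  rewrite -/(sum3 (fun u v w => if v is [:: x; y] then F (a :: u) x y w else 0) _).
  by rewrite -IHt.
have -> : hcomp sgnr f hmu s = sum3 (fun u v w => if v is [:: x; y]
    then (-1) ^+ size w *: f (u ++ x * y :: w) else 0) s.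
  apply: eq_sum3 => u v w _; case: v => [|x [|y [|z v]]];
    rewrite ?mlin0 ?scaler0 //.
  by congr (_ *: _); apply: sgn_parity; rewrite oddM andbT.
case: s => [|a t].
  rewrite /hleft /hright /sum3 !sum2_nil /= mul0r mulr0 scaler0.
  by rewrite !addr0 subr0.
rewrite hleft_cons [in hright _ _]lastI hright_rcons /=.
rewrite addrAC; congr (_ + _ + _).
rewrite -(sum_mid (fun u x y w => (-1) ^+ size w *: f (u ++ x * y :: w))).
rewrite -sumrN; apply: eq_bigr => i _; rewrite -scaleNr; congr (_ *: _).
by rewrite size_drop /= subSS -[in LHS](subnSK (ltn_ord i)) exprS mulN1r.
Qed.

Definition heps f s := (-1) ^+ (size s).+1 *: f s.

Definition twistl (e : nat -> nat -> nat -> nat) i j k :=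
  (e i j k + (i + k.+1).+1)%N.
Definition twistr (e : nat -> nat -> nat -> nat) i j k := (e i j k + j.+1)%N.

Lemma hcomp_epsl e f g s : hcomp e (heps f) g s = hcomp (twistl e) f g s.
Proof.
by apply: eq_sum3 => u v w _; rewrite /heps scalerA -exprD size_cat.
Qed.
Lemma hcomp_epsr e f g s : multilinear f ->
  hcomp e f (heps g) s = hcomp (twistr e) f g s.
Proof.
by move=> fL; apply: eq_sum3 => u v w _; rewrite mlinZ // scalerA -exprD.
Qed.

Lemma hmu_gap u x v y w :
  ~~ [&& nilp u, nilp v & nilp w] -> hmu (u ++ x :: (v ++ y :: w)) = 0.
Proof. by case: u => [|? [|? [|? ?]]] //; case: v => [|? []] //; case: w. Qed.

Lemma eq_sum5_sgn (m n : seq A -> seq A -> seq A -> seq A -> seq A -> nat) F s :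
  (forall u1 u2 u3 u4 u5, F u1 u2 u3 u4 u5 = 0 \/
     odd (m u1 u2 u3 u4 u5) = odd (n u1 u2 u3 u4 u5)) ->
  sum5 (fun u1 u2 u3 u4 u5 => (-1) ^+ m u1 u2 u3 u4 u5 *: F u1 u2 u3 u4 u5) s =
  sum5 (fun u1 u2 u3 u4 u5 => (-1) ^+ n u1 u2 u3 u4 u5 *: F u1 u2 u3 u4 u5) s.
Proof.
move=> FP; apply: eq_sum5 => u1 u2 u3 u4 u5.
by case: (FP u1 u2 u3 u4 u5) => [->|/sgn_parity ->]; rewrite ?scaler0.
Qed.

Definition hcross f g s :=
  sum5 (fun u1 u2 u3 v w => (-1) ^+ (size u2 * (size v).+1) *:
     hmu (u1 ++ f u2 :: (u3 ++ g v :: w))) s +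
  sum5 (fun u v w1 w2 w3 => (-1) ^+ (size w2).+1 *:
     hmu (u ++ g v :: (w1 ++ f w2 :: w3))) s.

Ltac parity := rewrite /twistl /twistr /sgnc /sgnr;
  rewrite ?(oddD, oddM, oddS) /= ?(oddD, oddM, oddS) /=;
  repeat match goal with |- context [odd ?n] => case: (odd n) end;
  by [].

Lemma hcross_left f g s : multilinear f -> multilinear g ->
  hcomp sgnc hmu (hcomp sgnc f g) s - hcomp sgnr (hcomp sgnc f g) hmu s =
  hcomp sgnc (hcomp sgnc hmu f) g s - hcomp sgnc (hcomp sgnr f hmu) g s
  + (hcomp (twistl sgnc) f (hcomp sgnc hmu g) s
     - hcomp (twistl sgnc) f (hcomp sgnr g hmu) s) - hcross f g s.
Proof.
move=> fL gL.
rewrite !hcomp_outer !hcomp_inner //; last exact: hmu_multilinear.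
rewrite /hcross.
set a1 := sum5 _ s; set b1 := sum5 _ s; set b2 := sum5 _ s; set b3 := sum5 _ s.
set d1 := sum5 _ s; set d2 := sum5 _ s; set d3 := sum5 _ s.
set e1 := sum5 _ s; set e2 := sum5 _ s; set e3 := sum5 _ s.
set h := sum5 _ s; set k := sum5 _ s; set t1 := sum5 _ s; set t3 := sum5 _ s.
have -> : a1 = d2.
  by apply: eq_sum5_sgn => *; right; parity.
have -> : b1 = e3.
  apply: eq_sum5_sgn => u1 u2 u3 v w; have [E|/hmu_neq2->] := eqVneq (size v) 2%N.
    by right; rewrite E; parity.
  by left; rewrite -cat_cons catA (mlin0 fL).
have -> : b3 = e1.
  apply: eq_sum5_sgn => u1 v u3 w2 w; have [E|/hmu_neq2->] := eqVneq (size v) 2%N.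
    by right; rewrite E; parity.
  by left; rewrite (mlin0 fL).
have -> : b2 = k.
  apply: eq_sum5_sgn => u1 u2 v w1 w2; have [E|/hmu_neq2->] := eqVneq (size v) 2%N.
    by right; rewrite E; parity.
  by left; rewrite (mlin0 gL) (mlin0 fL).
have -> : e2 = h.
  apply: eq_sum5_sgn => u1 u2 v w1 w2.
  have [E|/hmu_neq2->] := eqVneq (size (u2 ++ g v :: w1)) 2%N; last first.
    by left; rewrite (mlin0 fL).
  by right; move/(congr1 odd): E; rewrite size_cat; parity.
have -> : d1 = t1.
  apply: eq_sum5_sgn => u1 u2 u3 v w.
  have [/and3P[/nilP-> /nilP-> /nilP->]|/hmu_gap->] := boolP [&& nilp u1, nilp u3 & nilp w].
    by right; parity.
  by left.
have -> : d3 = t3.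
  apply: eq_sum5_sgn => u1 u2 u3 v w.
  have [/and3P[/nilP-> /nilP-> /nilP->]|/hmu_gap->] := boolP [&& nilp u1, nilp u3 & nilp w].
    by right; parity.
  by left.
have alg (V : zmodType) (x1 x2 x3 y1 y2 y3 z1 z2 : V) :
   x2 - (y3 + z2 + y1) = (x1 + x2 + x3) - (y1 + z1 + y3) + (z1 - z2) - (x1 + x3).
  rewrite !opprD !addrA.
  rewrite [RHS](ACl (2*6*8*4*(1*9)*(3*10)*(7*5)))/=.
  by rewrite !subrr !addr0.
exact: alg.
Qed.

Lemma hcross_right f g s : multilinear f -> multilinear g ->
  hcomp sgnc hmu (hcomp sgnr g f) s - hcomp sgnr (hcomp sgnr g f) hmu s =
  hcomp sgnr g (hcomp sgnc hmu f) s - hcomp sgnr g (hcomp sgnr f hmu) s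
  + (hcomp (twistr sgnr) (hcomp sgnc hmu g) f s
     - hcomp (twistr sgnr) (hcomp sgnr g hmu) f s) - hcross f g s.
Proof.
move=> fL gL.
rewrite !hcomp_outer !hcomp_inner //; last exact: hmu_multilinear.
rewrite /hcross.
set a1 := sum5 _ s; set b1 := sum5 _ s; set b2 := sum5 _ s; set b3 := sum5 _ s.
set h := sum5 _ s; set k := sum5 _ s.
set d1 := sum5 _ s; set d2 := sum5 _ s; set d3 := sum5 _ s.
set e1 := sum5 _ s; set e2 := sum5 _ s; set e3 := sum5 _ s.
set t1 := sum5 _ s; set t3 := sum5 _ s.
have -> : a1 = d2.
  apply: eq_sum5_sgn => u1 u2 u3 v w.
  have [E|/hmu_neq2->] := eqVneq (size (u1 ++ g (u2 ++ f u3 :: v) :: w)) 2%N; last by left.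
  by right; move/(congr1 odd): E; rewrite size_cat; parity.
have -> : b1 = e3.
  apply: eq_sum5_sgn => u1 u2 u3 v w; have [E|/hmu_neq2->] := eqVneq (size v) 2%N.
    by right; rewrite E; parity.
  by left; rewrite -cat_cons catA (mlin0 gL).
have -> : b3 = e1.
  apply: eq_sum5_sgn => u1 v u3 w2 w; have [E|/hmu_neq2->] := eqVneq (size v) 2%N.
    by right; rewrite E; parity.
  by left; rewrite (mlin0 gL).
have -> : b2 = k.
  apply: eq_sum5_sgn => u1 u2 v w1 w2; have [E|/hmu_neq2->] := eqVneq (size v) 2%N.
    by right; rewrite E; parity.
  by left; rewrite (mlin0 fL) (mlin0 gL).
have -> : e2 = h.
  apply: eq_sum5_sgn => u1 u2 v w1 w2.
  have [E|/hmu_neq2->] := eqVneq (size (u2 ++ f v :: w1)) 2%N; last first.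
    by left; rewrite (mlin0 gL).
  by right; move/(congr1 odd): E; rewrite size_cat; parity.
have -> : d3 = t1.
  apply: eq_sum5_sgn => u1 u2 u3 v w.
  have [/and3P[/nilP-> /nilP-> /nilP->]|/hmu_gap->] := boolP [&& nilp u1, nilp u3 & nilp w].
    by right; parity.
  by left.
have -> : d1 = t3.
  apply: eq_sum5_sgn => u1 u2 u3 v w.
  have [/and3P[/nilP-> /nilP-> /nilP->]|/hmu_gap->] := boolP [&& nilp u1, nilp u3 & nilp w].
    by right; parity.
  by left.
have alg (V : zmodType) (x1 x2 x3 y1 y2 y3 z1 z2 : V) :
   x2 - (y3 + z2 + y1) = (z1 - z2) + ((x3 + x2 + x1) - (y1 + z1 + y3)) - (x1 + x3).
  rewrite !opprD !addrA.
  rewrite [RHS](ACl (4*8*2*6*(1*7)*(3*10)*(5*9)))/=.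
  by rewrite !subrr !addr0.
exact: alg.
Qed.

Lemma multilinear_hcomp e f g :
  multilinear f -> multilinear g -> multilinear (hcomp e f g).
Proof.
move=> fL gL u w k x y; rewrite /hcomp !sum3_cat !scalerDr.
rewrite addrACA [X in _ = X + _]addrACA; congr (_ + _ + _).
- rewrite -sum3_lin; apply: eq_sum3 => u1 u2 u3 _.
  rewrite -!cat_cons !catA fL scalerDr !scalerA mulrC !size_cat.
  by congr (_ + _).
- rewrite -sum2Z -sum2D; apply: eq_sum2 => u1 u2 _.
  rewrite -sum2Z -sum2D; apply: eq_sum2 => w1 w2 _.
  by rewrite gL fL scalerDr !scalerA mulrC !size_cat.
- rewrite -sum3_lin; apply: eq_sum3 => w1 w2 w3 _.
  by rewrite -!catA /= fL scalerDr !scalerA mulrC !size_cat.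
Qed.

Lemma bounded_hcomp e f g : multilinear f ->
  bounded_degree f -> bounded_degree g -> bounded_degree (hcomp e f g).
Proof.
move=> fL [n fn] [m gm]; exists (n + m)%N => s sP.
rewrite -[RHS](sum3_0 s); apply: eq_sum3 => u v w uvw.
have [mv|vm] := leqP m (size v); first by rewrite gm // mlin0 // scaler0.
rewrite fn ?scaler0 // size_cat /= addnS; apply: leqW; rewrite -(leq_add2r m).
apply: leq_trans sP _; rewrite -uvw !size_cat addnCA addnC leq_add2l.
exact: ltnW.
Qed.

Lemma bounded_hmu : bounded_degree hmu.
Proof. by exists 3%N => -[|? [|? [|? ?]]]. Qed.

Lemma hoch_deltaC f s : multilinear f ->
  hoch_delta f s = hcomp sgnc hmu f s - hcomp sgnr f hmu s.
Proof. by move=> fL; rewrite hoch_deltaE // hcomp_mul. Qed.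

Lemma multilinearB f g : multilinear f -> multilinear g ->
  multilinear (fun s => f s - g s).
Proof.
move=> fL gL u w k x y; rewrite fL gL scalerBr opprD.
by rewrite -!addrA; congr (_ + _); rewrite addrCA.
Qed.

Lemma multilinear_delta f : multilinear f -> multilinear (hoch_delta f).
Proof.
move=> fL; rewrite (funext (fun s => hoch_deltaC s fL)).
by apply: multilinearB; apply: multilinear_hcomp => //; apply: hmu_multilinear.
Qed.

Lemma multilinear_eps f : multilinear f -> multilinear (heps f).
Proof.
move=> fL u w k x y; rewrite /heps fL !size_cat /= scalerDr !scalerA.
by rewrite [k * _]mulrC.
Qed.

Lemma multilinear_bracket f g : multilinear f -> multilinear g ->
  multilinear (hoch_bracket f g).
Proof.
move=> fL gL; rewrite (funext (hoch_bracketE f g)).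
by apply: multilinearB; apply: multilinear_hcomp.
Qed.

Lemma bounded_bracket f g : multilinear f -> multilinear g ->
  bounded_degree f -> bounded_degree g -> bounded_degree (hoch_bracket f g).
Proof.
move=> fL gL fB gB; have [n Hn] := bounded_hcomp sgnc fL fB gB.
have [m Hm] := bounded_hcomp sgnr gL gB fB; exists (maxn n m) => s.
by rewrite geq_max hoch_bracketE => /andP[? ?]; rewrite Hn // Hm // subrr.
Qed.

Lemma hoch_delta_bracket f g s : multilinear f -> multilinear g ->
  hoch_delta (hoch_bracket f g) s =
  hoch_bracket (hoch_delta f) g s + hoch_bracket (heps f) (hoch_delta g) s.
Proof.
move=> fL gL; have mL := hmu_multilinear.
rewrite hoch_deltaC; last exact: multilinear_bracket.
rewrite !hoch_bracketE (hcomp_epsl sgnc) hcomp_epsr; last exact: multilinear_delta.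
rewrite (funext (hoch_bracketE f g)) (funext (fun s => hoch_deltaC s fL)).
rewrite (funext (fun s => hoch_deltaC s gL)).
rewrite !(hcompDl, hcompNl) !(hcompDr, hcompNr) //.
have alg (V : zmodType) (a b c d x1 x2 x3 x4 y1 y2 y3 y4 z : V) :
    a - b = x1 - x2 + (x3 - x4) - z -> c - d = y1 - y2 + (y3 - y4) - z ->
    a - c - (b - d) = x1 - x2 - (y1 - y2) + (x3 - x4 - (y3 - y4)).
  move=> E1 E2; have -> : a - c - (b - d) = (a - b) - (c - d).
    by rewrite !opprB !addrA [LHS](ACl (1*4*3*2))/=.
  by rewrite E1 E2 opprB addrA addrNK opprD addrACA.
exact: alg (hcross_left s fL gL) (hcross_right s fL gL).
Qed.

Lemma sum2Ml (F : seq A -> seq A -> A) s x :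
  sum2 F s * x = sum2 (fun u v => F u v * x) s.
Proof. exact: mulr_suml. Qed.
Lemma sum2Mr (F : seq A -> seq A -> A) s x :
  x * sum2 F s = sum2 (fun u v => x * F u v) s.
Proof. exact: mulr_sumr. Qed.

(* Signed convolutions; the cup product is hconv muln. *)
Definition hconv (e : nat -> nat -> nat) f g s : A :=
  sum2 (fun u v => (-1) ^+ e (size u) (size v) *: (f u * g v)) s.

Lemma hconvDl e f f' g s :
  hconv e (fun t => f t + f' t) g s = hconv e f g s + hconv e f' g s.
Proof. by rewrite -sum2D; apply: eq_sum2 => *; rewrite mulrDl scalerDr. Qed.
Lemma hconvDr e f g g' s :
  hconv e f (fun t => g t + g' t) s = hconv e f g s + hconv e f g' s.
Proof. by rewrite -sum2D; apply: eq_sum2 => *; rewrite mulrDr scalerDr. Qed.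
Lemma hconvNl e f g s : hconv e (fun t => - f t) g s = - hconv e f g s.
Proof. by rewrite -sum2N; apply: eq_sum2 => *; rewrite mulNr scalerN. Qed.
Lemma hconvNr e f g s : hconv e f (fun t => - g t) s = - hconv e f g s.
Proof. by rewrite -sum2N; apply: eq_sum2 => *; rewrite mulrN scalerN. Qed.

Lemma hconv_left e e' f g h s :
  hconv e (hconv e' f g) h s = sum3 (fun u v w =>
    (-1) ^+ (e (size u + size v) (size w) + e' (size u) (size v))%N *:
      (f u * g v * h w)) s.
Proof.
rewrite /sum3 [RHS](sum2A (fun u v w =>
  (-1) ^+ (e (size u + size v) (size w) + e' (size u) (size v))%N *:
      (f u * g v * h w))).
apply: eq_sum2 => U w _.
rewrite /hconv sum2Ml -sum2Z.
apply: eq_sum2 => u v <-.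
by rewrite -scalerAl scalerA -exprD size_cat.
Qed.

Lemma hconv_right e e' f g h s :
  hconv e f (hconv e' g h) s = sum3 (fun u v w =>
    (-1) ^+ (e (size u) (size v + size w) + e' (size v) (size w))%N *:
      (f u * g v * h w)) s.
Proof.
apply: eq_sum2 => u W _.
rewrite /hconv sum2Mr -sum2Z.
apply: eq_sum2 => v w <-.
by rewrite -scalerAr scalerA -exprD size_cat mulrA.
Qed.

Lemma eq_sum3_sgn (m n : seq A -> seq A -> seq A -> nat)
    (F : seq A -> seq A -> seq A -> A) s :
  (forall u v w, F u v w = 0 \/ odd (m u v w) = odd (n u v w)) ->
  sum3 (fun u v w => (-1) ^+ m u v w *: F u v w) s =
  sum3 (fun u v w => (-1) ^+ n u v w *: F u v w) s.
Proof.
move=> FP; apply: eq_sum3 => u v w _.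
by case: (FP u v w) => [->|/sgn_parity ->]; rewrite ?scaler0.
Qed.

Definition hsgn f s := (-1) ^+ size s *: f s.

Lemma hconv_sgn e f g s :
  hconv e (hsgn f) g s = hconv (fun i j => (e i j + i)%N) f g s.
Proof. by apply: eq_sum2 => u v _; rewrite -scalerAl scalerA -exprD. Qed.

Lemma hiota_neq1 s : size s != 1%N -> hiota s = 0.
Proof. by case: s => [|x [|y s]]. Qed.

Lemma hright_conv f s : hright f s = hconv (fun _ _ => 0%N) f hiota s.
Proof. by apply: eq_sum2 => u v _; rewrite scale1r. Qed.

Lemma hconv_hcomp e e' f g h s :
  hcomp e (hconv e' f g) h s =
  sum3 (fun u v W => sum2 (fun w x => (-1) ^+
     (e (size u) (size v) (size w + size x) +
      e' (size u + (size w).+1) (size x))%N *: (f (u ++ h v :: w) * g x)) W) s +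
  sum2 (fun x R => sum3 (fun u v w => (-1) ^+
     (e (size x + size u) (size v) (size w) +
      e' (size x) (size u + (size w).+1))%N *: (f x * g (u ++ h v :: w))) R) s.
Proof.
transitivity (sum3 (fun u v W => sum2 (fun w x => (-1) ^+
     (e (size u) (size v) (size w + size x) +
      e' (size u + (size w).+1) (size x))%N *: (f (u ++ h v :: w) * g x)) W) s
 + sum3 (fun U v w => sum2 (fun x u => (-1) ^+
     (e (size x + size u) (size v) (size w) +
      e' (size x) (size u + (size w).+1))%N *: (f x * g (u ++ h v :: w))) U) s).
  rewrite -sum3D; apply: eq_sum3 => u v w _.
  rewrite /hconv sum2_cat scalerDr addrC -!sum2Z; congr (_ + _).
    by apply: eq_sum2 => w1 w2 <-; rewrite scalerA -exprD !size_cat.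
  by apply: eq_sum2 => u1 u2 <-; rewrite scalerA -exprD !size_cat.
congr (_ + _); rewrite /sum3 [RHS](sum2A (fun x u R => sum2 (fun v w => (-1) ^+
     (e (size x + size u) (size v) (size w) +
      e' (size x) (size u + (size w).+1))%N *: (f x * g (u ++ h v :: w))) R)).
by apply: eq_sum2 => U R _; rewrite /sum2 exchange_big.
Qed.

Lemma hcomp_conv_left e e' f g h s :
  hconv e (hcomp e' f h) g s =
  sum3 (fun u v W => sum2 (fun w x => (-1) ^+
     (e (size u + (size v + size w)) (size x) +
      e' (size u) (size v) (size w))%N *: (f (u ++ h v :: w) * g x)) W) s.
Proof.
rewrite /sum3 -/(sum3 _ _).
transitivity (sum2 (fun U x => sum2 (fun u R => sum2 (fun v w => (-1) ^+
     (e (size u + (size v + size w)) (size x) +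
      e' (size u) (size v) (size w))%N *: (f (u ++ h v :: w) * g x)) R) U) s).
  apply: eq_sum2 => U x _.
  rewrite /hcomp /sum3 sum2Ml -sum2Z.
  apply: eq_sum2 => u R uR; rewrite sum2Ml -sum2Z.
  apply: eq_sum2 => v w vw; rewrite -scalerAl scalerA -exprD.
  by rewrite -uR -vw !size_cat.
rewrite -(sum2A (fun u R x => sum2 (fun v w => (-1) ^+
     (e (size u + (size v + size w)) (size x) +
      e' (size u) (size v) (size w))%N *: (f (u ++ h v :: w) * g x)) R)).
by apply: eq_sum2 => u Q _; rewrite -(sum2A (fun v w x => (-1) ^+
     (e (size u + (size v + size w)) (size x) +
      e' (size u) (size v) (size w))%N *: (f (u ++ h v :: w) * g x))).
Qed.

Lemma hcomp_conv_right e e' f g h s :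
  hconv e f (hcomp e' g h) s =
  sum2 (fun x R => sum3 (fun u v w => (-1) ^+
     (e (size x) (size u + (size v + size w)) +
      e' (size u) (size v) (size w))%N *: (f x * g (u ++ h v :: w))) R) s.
Proof.
apply: eq_sum2 => x R _.
rewrite /hcomp /sum3 sum2Mr -sum2Z.
apply: eq_sum2 => u Q uQ; rewrite sum2Mr -sum2Z.
apply: eq_sum2 => v w vw; rewrite -scalerAr scalerA -exprD.
by rewrite -uQ -vw !size_cat.
Qed.

Lemma multilinear_cup f g : multilinear f -> multilinear g ->
  multilinear (hoch_cup f g).
Proof.
move=> fL gL u w k x y; rewrite /hoch_cup !sum2_cat scalerDr addrACA.
rewrite -!sum2Z -!sum2D; congr (_ + _); apply: eq_sum2 => p q _.
  by rewrite gL mulrDr -scalerAr scalerDr !scalerA mulrC !size_cat.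
by rewrite fL mulrDl -scalerAl scalerDr !scalerA mulrC !size_cat.
Qed.

Lemma bounded_cup f g :
  bounded_degree f -> bounded_degree g -> bounded_degree (hoch_cup f g).
Proof.
move=> [n fn] [m gm]; exists (n + m)%N => s sP.
rewrite -[RHS](sum2_0 A s); apply: eq_sum2 => u v uv.
have [nu|un] := leqP n (size u); first by rewrite fn // mul0r scaler0.
rewrite gm ?mulr0 ?scaler0 // -(leq_add2l (size u)) -size_cat uv.
by apply: leq_trans sP; rewrite leq_add2r ltnW.
Qed.

Lemma hoch_delta_cup f g s : multilinear f -> multilinear g ->
  hoch_delta (hoch_cup f g) s =
  hoch_cup (hoch_delta f) g s + hoch_cup (hsgn f) (hoch_delta g) s.
Proof.
move=> fL gL; rewrite hoch_deltaE; last exact: multilinear_cup.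
rewrite (funext (fun s => hoch_deltaE s fL)) (funext (fun s => hoch_deltaE s gL)).
rewrite -[hoch_cup (fun=> _) g s]/(hconv muln _ g s).
rewrite -[hoch_cup (hsgn f) _ s]/(hconv muln (hsgn f) _ s) hconv_sgn.
rewrite !(hconvDl, hconvNl, hconvDr, hconvNr).
rewrite -[hoch_cup f g]/(hconv muln f g) hconv_hcomp.
rewrite hcomp_conv_left hcomp_conv_right.
rewrite hright_conv -[hleft _ s]/(hconv (fun _ j => j.+1) hiota _ s).
rewrite -[hleft f]/(hconv (fun _ j => j.+1) hiota f).
rewrite -[hleft g]/(hconv (fun _ j => j.+1) hiota g).
rewrite (funext (hright_conv f)) (funext (hright_conv g)).
rewrite !hconv_left !hconv_right.
set l := sum3 _ s; set r := sum3 _ s; set m1 := sum3 _ s; set m2 := sum2 _ s.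
set l1 := sum3 _ s; set r1 := sum3 _ s; set m1' := sum3 _ s.
set l2 := sum3 _ s; set r2 := sum3 _ s; set m2' := sum2 _ s.
have -> : l = l1.
  apply: eq_sum3_sgn => u v w.
  have [E|/hiota_neq1->] := eqVneq (size u) 1%N; last by left; rewrite !mul0r.
  by right; rewrite E; parity.
have -> : r = r2.
  apply: eq_sum3_sgn => u v w.
  have [E|/hiota_neq1->] := eqVneq (size w) 1%N; last by left; rewrite !mulr0.
  by right; rewrite E; parity.
have -> : r1 = - l2.
  rewrite /l2 -scaleN1r -sum3Z; under [RHS]eq_sum3 do rewrite scalerA -exprS.
  apply: eq_sum3_sgn => u v w.
  have [E|/hiota_neq1->] := eqVneq (size v) 1%N.
    by right; rewrite E; parity.
  by left; rewrite mulr0 mul0r.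
have -> : m1 = m1'.
  apply: eq_sum3 => u v W _; apply: eq_sum2 => w x _.
  have [E|/hmu_neq2->] := eqVneq (size v) 2%N; last by rewrite mlin0 // mul0r !scaler0.
  by congr (_ *: _); apply: sgn_parity; rewrite E; parity.
have -> : m2 = m2'.
  apply: eq_sum2 => x R _; apply: eq_sum3 => u v w _.
  have [E|/hmu_neq2->] := eqVneq (size v) 2%N; last by rewrite mlin0 // mulr0 !scaler0.
  by congr (_ *: _); apply: sgn_parity; rewrite E; parity.
rewrite opprD !addrA. rewrite [RHS](ACl (1*5*3*6*(4*2)))/= addrN addr0.
by [].
Qed.

Lemma hoch_delta_sgn f s :
  hoch_delta (heps f) s = (-1) ^+ size s *: hoch_delta f s.
Proof.
case: s => [|a t]; first by rewrite scaler0.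
rewrite /hoch_delta /heps !scalerDr scaler_sumr; congr (_ + _ + _).
- by rewrite -scalerAr !scalerA mulrC.
- apply: eq_bigr => i _; rewrite !scalerA mulrC.
  congr (((-1) ^+ _ * _) *: _).
  rewrite size_cat /= size_drop size_takel /=; last exact/ltnW/ltnW/ltn_ord.
  by rewrite addnS -addSn subnKC.
- by rewrite -scalerAl size_belast.
Qed.

(* The Hochschild cochains, with the cup product: a K-algebra. *)
Definition cochain_pred : {pred seq A -> A} :=
  fun f => `[< multilinear f /\ bounded_degree f >].

Record cochain := Cochain {
  cochain_fun :> seq A -> A;
  _ : cochain_fun \in cochain_pred
}.

HB.instance Definition _ := [isSub for cochain_fun].
HB.instance Definition _ := [Choice of cochain by <:].

Lemma cochain_submod : GRing.submod_closed cochain_pred.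
Proof.
split.
  apply/asboolP; split; last by exists 0%N.
  move=> u w k x y; change (0 = k *: 0 + 0 :> A).
  by rewrite scaler0 addr0.
move=> c f g /asboolP[fL [n fn]] /asboolP[gL [m gm]]; apply/asboolP; split.
  move=> u w k x y; rewrite !fctE fL gL !scalerDr !scalerA mulrC.
  by rewrite addrACA.
exists (maxn n m) => s; rewrite geq_max => /andP[ns ms].
by rewrite !fctE fn ?gm // scaler0 addr0.
Qed.
HB.instance Definition _ := GRing.isSubmodClosed.Build K _ cochain_pred
  cochain_submod.
HB.instance Definition _ := [SubChoice_isSubLmodule of cochain by <:].

Lemma cochainL (f : cochain) : multilinear f.
Proof. by case: f => f /= /asboolP[]. Qed.
Lemma cochainB (f : cochain) : bounded_degree f.
Proof. by case: f => f /= /asboolP[]. Qed.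
Lemma cochain_eq (f g : cochain) : f =1 g -> f = g.
Proof. by move=> fg; apply/val_inj/funext. Qed.
Lemma cochainD (f g : cochain) s : (f + g) s = f s + g s. Proof. by []. Qed.
Lemma cochainN (f : cochain) s : (- f) s = - f s. Proof. by []. Qed.
Lemma cochainZ k (f : cochain) s : (k *: f) s = k *: f s. Proof. by []. Qed.

Fact cochain_one_subproof : hoch_one \in cochain_pred.
Proof.
apply/asboolP; split; last by exists 1%N => -[].
by move=> [|? ?] w k x y; rewrite /hoch_one /= scaler0 addr0.
Qed.
Definition cochain_one : cochain := Cochain cochain_one_subproof.

Fact cochain_cup_subproof (f g : cochain) : hoch_cup f g \in cochain_pred.
Proof.
apply/asboolP; split; first exact: multilinear_cup (cochainL f) (cochainL g).
exact: bounded_cup (cochainB f) (cochainB g).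
Qed.
Definition cochain_cup (f g : cochain) : cochain :=
  Cochain (cochain_cup_subproof f g).

Fact cochain_bracket_subproof (f g : cochain) :
  hoch_bracket f g \in cochain_pred.
Proof.
apply/asboolP; split.
  exact: multilinear_bracket (cochainL f) (cochainL g).
exact: bounded_bracket (cochainL f) (cochainL g) (cochainB f) (cochainB g).
Qed.
Definition cochain_bracket (f g : cochain) : cochain :=
  Cochain (cochain_bracket_subproof f g).

Fact cochain_eps_subproof (f : cochain) : heps f \in cochain_pred.
Proof.
apply/asboolP; split; first exact/multilinear_eps/cochainL.
by have [n fn] := cochainB f; exists n => s /fn E; rewrite /heps E scaler0.
Qed.
Definition cochain_eps (f : cochain) : cochain :=
  Cochain (cochain_eps_subproof f).

Fact cochain_sgn_subproof (f : cochain) : hsgn f \in cochain_pred.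
Proof.
apply/asboolP; split.
  move=> u w k x y; rewrite /hsgn cochainL !size_cat /= scalerDr !scalerA.
  by rewrite [k * _]mulrC.
by have [n fn] := cochainB f; exists n => s /fn E; rewrite /hsgn E scaler0.
Qed.
Definition cochain_sgn (f : cochain) : cochain :=
  Cochain (cochain_sgn_subproof f).

Fact cochain_cupA : associative cochain_cup.
Proof.
move=> f g h; apply: cochain_eq => s /=.
rewrite -![hoch_cup _ _]/(hconv muln _ _) hconv_left hconv_right.
by apply: eq_sum3_sgn => u v w; right; parity.
Qed.
Fact cochain_cup1 : left_id cochain_one cochain_cup.
Proof.
move=> f; apply: cochain_eq => s /=.
rewrite -[RHS](sum2_onel (fun _ v => f v) s); apply: eq_sum2 => u v _.
by case: u => [|? ?]; rewrite ?scale1r // !mul0r scaler0.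
Qed.
Fact cochain_cupr1 : right_id cochain_one cochain_cup.
Proof.
move=> f; apply: cochain_eq => s /=.
rewrite -[RHS](sum2_oner (fun u _ => f u) s); apply: eq_sum2 => u v _.
by case: v => [|? ?]; rewrite ?muln0 ?scale1r // !mulr0 scaler0.
Qed.
Fact cochain_cupDl : left_distributive cochain_cup +%R.
Proof.
by move=> f g h; apply: cochain_eq => s; apply: (hconvDl muln f g h).
Qed.
Fact cochain_cupDr : right_distributive cochain_cup +%R.
Proof.
by move=> f g h; apply: cochain_eq => s; apply: (hconvDr muln f g h).
Qed.
Fact cochain_one_neq0 : cochain_one != 0.
Proof.
apply/eqP => /(congr1 (fun f : cochain => f [::])) /eqP.
by rewrite /= oner_eq0.
Qed.
HB.instance Definition _ := GRing.Zmodule_isNzRing.Build cochain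
  cochain_cupA cochain_cup1 cochain_cupr1 cochain_cupDl cochain_cupDr
  cochain_one_neq0.

Fact cochain_scalerAl k (f g : cochain) : k *: (f * g) = (k *: f) * g.
Proof.
apply: cochain_eq => s; rewrite cochainZ -[LHS]sum2Z.
by apply: eq_sum2 => u v _; rewrite -scalerAl !scalerA mulrC.
Qed.
HB.instance Definition _ := GRing.Lmodule_isLalgebra.Build K cochain
  cochain_scalerAl.
Fact cochain_scalerAr k (f g : cochain) : k *: (f * g) = f * (k *: g).
Proof.
apply: cochain_eq => s; rewrite cochainZ -[LHS]sum2Z.
by apply: eq_sum2 => u v _; rewrite -scalerAr !scalerA mulrC.
Qed.
HB.instance Definition _ := GRing.Lalgebra_isAlgebra.Build K cochain
  cochain_scalerAr.

Definition cocycle_pred : {pred cochain} :=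
  fun f : cochain => `[< forall s, hoch_delta f s = 0 >].

Record cocycle := Cocycle {
  cocycle_val :> cochain;
  _ : cocycle_val \in cocycle_pred
}.

HB.instance Definition _ := [isSub for cocycle_val].
HB.instance Definition _ := [Choice of cocycle by <:].

Lemma hoch_delta0 s : hoch_delta (fun=> 0) s = 0.
Proof.
case: s => //= a t; rewrite mulr0 mul0r scaler0 add0r addr0 big1 // => i _.
exact: scaler0.
Qed.

Lemma hoch_cup0l f s : hoch_cup (fun=> 0) f s = 0.
Proof.
by rewrite -[RHS](sum2_0 A s); apply: eq_sum2 => u v _; rewrite mul0r scaler0.
Qed.
Lemma hoch_cup0r f s : hoch_cup f (fun=> 0) s = 0.
Proof.
by rewrite -[RHS](sum2_0 A s); apply: eq_sum2 => u v _; rewrite mulr0 scaler0.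
Qed.

Lemma hoch_delta_lin k (f g : cochain) s :
  hoch_delta (k *: f + g : cochain) s = k *: hoch_delta f s + hoch_delta g s.
Proof.
rewrite !hoch_deltaC; do ?exact: cochainL.
have E (e : nat -> nat -> nat -> nat) :
    hcomp e (k *: f + g : cochain) hmu s = k *: hcomp e f hmu s + hcomp e g hmu s.
  rewrite -sum3_lin; apply: eq_sum3 => u v w _.
  by rewrite cochainD cochainZ scalerDr !scalerA mulrC.
have E' : hcomp sgnc hmu (k *: f + g : cochain) s =
    k *: hcomp sgnc hmu f s + hcomp sgnc hmu g s.
  rewrite -sum3_lin; apply: eq_sum3 => u v w _.
  by rewrite cochainD cochainZ hmu_multilinear scalerDr !scalerA mulrC.
by rewrite E E' scalerBr opprD addrACA.
Qed.

Lemma cocycle_subalg : GRing.subalg_closed cocycle_pred.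
Proof.
split.
- apply/asboolP => -[|a [|b t]] //.
    by rewrite /= big_ord0 addr0 /hoch_one /= mulr1 mul1r expr1 scaleN1r addNr.
  rewrite /= /hoch_one /= mulr0 mul0r scaler0 add0r addr0 big1 // => i _.
  by case: (nat_of_ord i) => [|j] /=; rewrite scaler0.
- move=> k f g /asboolP fZ /asboolP gZ; apply/asboolP => s.
  by rewrite hoch_delta_lin fZ gZ scaler0 addr0.
- move=> f g /asboolP fZ /asboolP gZ; apply/asboolP => s.
  rewrite hoch_delta_cup; [|exact: cochainL..].
  by rewrite (funext fZ) (funext gZ) hoch_cup0l hoch_cup0r addr0.
Qed.
HB.instance Definition _ := GRing.isSubalgClosed.Build K _ cocycle_pred
  (GRing.subalg_closed_semi cocycle_subalg).
HB.instance Definition _ := [SubChoice_isSubAlgebra of cocycle by <:].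

Lemma cocycleP (z : cocycle) s : hoch_delta z s = 0.
Proof. by case: z => z /= /asboolP. Qed.

Definition coboundary_pred : {pred cocycle} :=
  fun z => `[< exists h : cochain, forall s, z s = hoch_delta h s >].

Lemma coboundaryP (z : cocycle) :
  reflect (exists h : cochain, forall s, z s = hoch_delta h s)
          (z \in coboundary_pred).
Proof. exact: asboolP. Qed.

Lemma coboundary_zmod : zmod_closed coboundary_pred.
Proof.
split.
  by apply/coboundaryP; exists 0 => s; rewrite [RHS]hoch_delta0.
move=> y z /coboundaryP[h hy] /coboundaryP[k kz].
apply/coboundaryP; exists (- 1 *: k + h) => s.
by rewrite hoch_delta_lin -hy -kz scaleN1r addrC.
Qed.

Lemma coboundary_Ml (a z : cocycle) :
  z \in coboundary_pred -> a * z \in coboundary_pred.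
Proof.
move=> /coboundaryP[h hz]; apply/coboundaryP.
exists (cochain_sgn (val a) * h) => s.
rewrite hoch_delta_cup; [|exact: cochainL..].
have -> : hoch_delta (cochain_sgn (val a)) = fun=> 0.
  have -> : cochain_sgn (val a) = - 1 *: cochain_eps (val a) + 0.
    apply: cochain_eq => t; rewrite addr0 cochainZ /= /hsgn /heps.
    by rewrite scalerA exprS mulN1r mulN1r opprK.
  by apply/funext => t; rewrite hoch_delta_lin hoch_delta0 hoch_delta_sgn
    cocycleP !scaler0 addr0.
rewrite hoch_cup0l add0r; apply: eq_sum2 => u v _.
by rewrite hz /= /hsgn scalerA -expr2 sqrr_sign scale1r.
Qed.

Lemma coboundary_Mr (a z : cocycle) :
  z \in coboundary_pred -> z * a \in coboundary_pred.
Proof.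
move=> /coboundaryP[h hz]; apply/coboundaryP.
exists (h * val a) => s; rewrite hoch_delta_cup; [|exact: cochainL..].
rewrite (funext (cocycleP a)) hoch_cup0r addr0; apply: eq_sum2 => u v _.
by rewrite hz.
Qed.

HB.instance Definition _ :=
  GRing.isZmodClosed.Build cocycle coboundary_pred coboundary_zmod.
HB.instance Definition _ :=
  isIdeal2.Build cocycle coboundary_pred coboundary_Ml coboundary_Mr.

Definition coboundary : ideal2 cocycle := coboundary_pred.

(* HH^*(A), the direct sum of all HH^n(A), with the cup product. *)
Definition HH : Type := quot_alg coboundary.

HB.instance Definition _ := GRing.PzRing.on HH.
HB.instance Definition _ := GRing.Lmodule.on HH.

Definition HH_class (z : cocycle) : HH := \pi_(quot_alg coboundary) z.

Fact HH_one_neq0 : 1 != 0 :> HH.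
Proof.
apply/eqP => E; have /coboundaryP[h /(_ [::]) /eqP] : (1 : cocycle) \in coboundary.
  by rewrite -[1]subr0; apply/pi_quotE; rewrite [LHS]E !piE.
by rewrite /= /hoch_one oner_eq0.
Qed.
HB.instance Definition _ := GRing.PzSemiRing_isNonZero.Build HH HH_one_neq0.
HB.instance Definition _ := GRing.Lmodule_isLalgebra.Build K HH
  (@quot_scalerAl K cocycle coboundary).
HB.instance Definition _ := GRing.Lalgebra_isAlgebra.Build K HH
  (@quot_scalerAr K cocycle coboundary).

Lemma hcomp0l e f s : hcomp e (fun=> 0) f s = 0.
Proof. by rewrite -[RHS](sum3_0 s); apply: eq_sum3 => *; rewrite /= scaler0. Qed.
Lemma hcomp0r e f s : multilinear f -> hcomp e f (fun=> 0) s = 0.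
Proof.
by move=> fL; rewrite -[RHS](sum3_0 s); apply: eq_sum3 => *;
  rewrite mlin0 ?scaler0.
Qed.
Lemma hoch_bracket0l f s : multilinear f -> hoch_bracket (fun=> 0) f s = 0.
Proof. by move=> fL; rewrite hoch_bracketE hcomp0l hcomp0r ?subr0. Qed.
Lemma hoch_bracket0r f s : multilinear f -> hoch_bracket f (fun=> 0) s = 0.
Proof. by move=> fL; rewrite hoch_bracketE hcomp0l hcomp0r ?subr0. Qed.

Lemma hoch_bracketBB f f' g g' s :
    multilinear f -> multilinear f' -> multilinear g -> multilinear g' ->
  hoch_bracket f g s - hoch_bracket f' g' s =
  hoch_bracket (fun t => f t + - f' t) g s +
  hoch_bracket f' (fun t => g t + - g' t) s.
Proof.
move=> fL fL' gL gL'; rewrite !hoch_bracketE.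
rewrite !(hcompDl, hcompNl) !(hcompDr, hcompNr) //.
move: (hcomp sgnc f g s) (hcomp sgnc f' g' s) (hcomp sgnc f' g s) => a a' c.
move: (hcomp sgnr g f s) (hcomp sgnr g' f' s) (hcomp sgnr g f' s) => b b' d.
rewrite !opprB !addrA.
by rewrite [RHS](ACl (1*4*7*6*(2*5)*(3*8)))/= addNr subrr !addr0.
Qed.

Fact cocycle_bracket_subproof (y z : cocycle) :
  cochain_bracket (val y) (val z) \in cocycle_pred.
Proof.
apply/asboolP => s; rewrite hoch_delta_bracket; [|exact: cochainL..].
rewrite (funext (cocycleP y)) (funext (cocycleP z)) hoch_bracket0l.
  by rewrite hoch_bracket0r ?addr0 //; apply/multilinear_eps/cochainL.
exact: cochainL.
Qed.
Definition cocycle_bracket (y z : cocycle) : cocycle :=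
  Cocycle (cocycle_bracket_subproof y z).

(* The bracket of HH^*(A), well defined by HH_bracketE below. *)
Definition HH_bracket (x y : HH) : HH :=
  HH_class (cocycle_bracket (repr x) (repr y)).

Lemma HH_bracketE (y z : cocycle) :
  HH_bracket (HH_class y) (HH_class z) = HH_class (cocycle_bracket y z).
Proof.
rewrite /HH_bracket; apply/esym/pi_quotE.
have := quot_repr_sub coboundary z; have := quot_repr_sub coboundary y.
rewrite -/(HH_class y) -/(HH_class z).
move: (repr (HH_class y)) (repr (HH_class z)) => y' z'.
move=> /coboundaryP[h hy] /coboundaryP[k kz]; apply/coboundaryP.
exists (1 *: cochain_bracket h (val z) + cochain_bracket (cochain_eps (val y')) k).
move=> s; rewrite hoch_delta_lin scale1r.
rewrite !hoch_delta_bracket; do ?exact: cochainL.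
rewrite (funext (cocycleP z)) hoch_bracket0r ?addr0; last first.
  by apply/multilinear_eps/cochainL.
have -> : hoch_delta (cochain_eps (val y')) = fun=> 0.
  by apply/funext => t; rewrite hoch_delta_sgn cocycleP scaler0.
rewrite hoch_bracket0l ?add0r; last exact: cochainL.
rewrite (funext (fun t => esym (hy t))) (funext (fun t => esym (kz t))).
have -> : heps (cochain_eps (val y')) = val y'.
  by apply/funext => t; rewrite /= /heps scalerA -expr2 sqrr_sign scale1r.
by apply: hoch_bracketBB; apply: cochainL.
Qed.

Definition HH_homogeneous (n : nat) (x : HH) : Prop :=
  exists2 z : cocycle, x = HH_class z & forall s, size s != n -> z s = 0.

Definition HH_homogeneous_nilpotent (x : HH) : Prop :=
  (exists n, HH_homogeneous n x) /\ (exists k, x ^+ k = 0).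

(* The ideals called N, G (weak Gerstenhaber) and calligraphic G             *)
(* (Gerstenhaber) generated by the homogeneous nilpotent elements.            *)
Definition nilpotent_ideal : ideal2 HH := ideal_gen HH_homogeneous_nilpotent.

Definition weak_Gerstenhaber_ideal : ideal2 HH :=
  smallest_ideal (fun J : ideal2 HH =>
    {subset nilpotent_ideal <= J} /\
    forall x y, x \in J -> y \in J -> HH_bracket x y \in J).

Definition Gerstenhaber_ideal : ideal2 HH :=
  smallest_ideal (fun J : ideal2 HH =>
    {subset nilpotent_ideal <= J} /\
    forall x y, y \in J -> HH_bracket x y \in J).

End Hochschild.

(* Main.v *)
Require Import Defs.
From HB Require Import structures.
From mathcomp Require Import all_boot all_algebra.
From mathcomp Require Import boolp functions.
From mathcomp Require Import ring zify.

(* Let r be the radical of A; as r^3 = 0, a class with an r-valued cocycle is *)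
(* nilpotent. Conversely, composing with A -> A/r = K x K sends HH^*(A) to    *)
(* Ext(S_1, S_1) x K, where Ext(S_1, S_1) = K<x, y>/(xy + yx) is read off the *)
(* values of cocycles on the words in a and b, and no nonzero element of the  *)
(* image is nilpotent. So N consists of the classes of r-valued cocycles,     *)
(* which are visibly stable under the bracket, whence G = N. The image        *)
(* consists of scalars plus combinations of x^i y^j with j > 0 (pure powers   *)
(* of x are excluded by ac = 0), and with i and j even unless char K = 2. All *)
(* x^i y^q with q | i do occur (q = 1 if char K = 2, and q = 2 otherwise), so *)
(* no finite set generates the quotient: it would impose a bound i <= M j on  *)
(* the exponents. Finally the Euler derivation Theta = b d/db is r-valued,    *)
(* hence lies in N, and, up to N and sign, [x^i y^q, Theta] is q x^i y^q with *)
(* q <> 0 in K; thus the Gerstenhaber ideal contains every class whose degree *)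
(* 0 part is in r.                                                            *)

Set Implicit Arguments.
Unset Strict Implicit.
Unset Printing Implicit Defensive.

Import GRing.Theory.
Local Open Scope ring_scope.
Local Open Scope quotient_scope.

(** The character [co m1] of [A] at vertex 1 and evaluation on words in a and b give a map [evc]
    from cocycles to the skew ring [K<x,y>/(xy + yx)]. It kills coboundaries ([ev_coboundary1]),
    turns cup products into signed products ([ev_cup]), and detects K-valued classes: a K-valued
    cocycle that it kills is a coboundary ([cocycle1_ker]). Vertex 2 contributes nothing in positive
    degree ([co2_coboundary]). So a Hochschild class has zero image exactly when it has a
    radical-valued representative ([evc0_rad], [rad_evc0]).

    The image is constrained by [cocycle_form]: the a- and b-coordinates of the cocycle equation
    make it commute with x and y up to sign, and ac = 0 excludes x^n for n > 0. Under [rho] the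
    elements of the image multiply like ordinary polynomials, so a nilpotent one is zero
    ([evc_nilp]) and N is the kernel ([nilpotent_idealP]). A bracket of radical-valued cochains is a
    combination of their values, hence G = N ([rad_bracket]). A finite set of cocycles bounds the
    slope i/j of the exponents ([cocycle_filtered]), while the cocycles [DaDb i] have unbounded
    slope; this gives [not_quot_fin_gen].

    For the Gerstenhaber ideal, inserting the Euler derivation [Th] multiplies x^i y^j by j
    ([ev_circ_Th]). Bracketing it with the [DaDb i] therefore produces all admissible monomials with
    j > 0 ([Gerstenhaber_emon], [Gerstenhaber_degree]). Conversely the augmentation [aug] kills N
    and every bracket ([aug_bracket]), so exactly the scalars survive. *)

Lemma sum2_head (T : Type) (V : zmodType) (F : seq T -> seq T -> V) s :
  (forall x u v, F (x :: u) v = 0) -> sum2 F s = F [::] s.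
Proof.
move=> F0; case: s => [|x s]; first exact: sum2_nil.
rewrite sum2_cons -[RHS]addr0; congr (_ + _).
by rewrite -[RHS](sum2_0 V s); apply: eq_sum2.
Qed.

(** * Coordinates on the Xu-Snashall algebra *)

(** A K-basis of [A]: the idempotents e_1 and e_2 and the paths a, b, ab, c, bc. The relations leave
    no other path, since ac = 0 also kills abc = bac. *)
Variant xs_mono := m1 | m2 | ma | mb | mab | mc | mbc.

Definition xs_mono_eqb (i j : xs_mono) : bool :=
  match i, j with
  | m1, m1 | m2, m2 | ma, ma | mb, mb | mab, mab | mc, mc | mbc, mbc => true
  | _, _ => false
  end.

Section Coordinates.
Variable K : fieldType.

Definition xs_mul_coef (i : xs_mono) (u v : xs_mono -> K) : K :=
  match i with
  | m1 => u m1 * v m1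
  | m2 => u m2 * v m2
  | ma => u m1 * v ma + u ma * v m1
  | mb => u m1 * v mb + u mb * v m1
  | mab => u m1 * v mab + u ma * v mb + u mb * v ma + u mab * v m1
  | mc => u m1 * v mc + u mc * v m2
  | mbc => u m1 * v mbc + u mb * v mc + u mbc * v m2
  end.

Definition xs_one_coef (i : xs_mono) : K :=
  match i with m1 | m2 => 1 | _ => 0 end.

(** All that the rest of the proof uses about [A]. Working with an arbitrary algebra with such
    coordinates keeps the quotient [KQ/I] out of the later computations. *)
Record xs_coords (A : algType K) := XsCoords {
  co : xs_mono -> A -> K;
  el : xs_mono -> A;
  co_lin : forall i k x y, co i (k *: x + y) = k * co i x + co i y;
  co_el : forall i j, co i (el j) = (xs_mono_eqb i j)%:R;
  co_mul : forall i x y, co i (x * y) = xs_mul_coef i (co^~ x) (co^~ y);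
  co_one : forall i, co i 1 = xs_one_coef i;
  co_inj : forall x y, (forall i, co i x = co i y) -> x = y
}.

Notation v1 := vertex1.
Notation v2 := vertex2.

Definition coef_at (x : path_alg K) i s : K := x (i, s).
Arguments coef_at : simpl never.

(** The coefficients of ab and ba are added because ab = ba in [A]; paths not listed lie in the
    ideal of relations. *)
Definition path_co (i : xs_mono) (x : path_alg K) : K :=
  match i with
  | m1 => coef_at x v1 [::]
  | m2 => coef_at x v2 [::]
  | ma => coef_at x v1 [:: arrow_a]
  | mb => coef_at x v1 [:: arrow_b]
  | mab => coef_at x v1 [:: arrow_a; arrow_b] + coef_at x v1 [:: arrow_b; arrow_a]
  | mc => coef_at x v1 [:: arrow_c]
  | mbc => coef_at x v1 [:: arrow_b; arrow_c]
  end.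

Lemma coef_at_lin k x y i s : coef_at (k *: x + y) i s = k * coef_at x i s + coef_at y i s.
Proof. by []. Qed.

Lemma coef_at_mul x y i s :
  coef_at (x * y) i s = sum2 (fun s t => coef_at x i s * coef_at y (path_end i s) t) s.
Proof. by []. Qed.

Lemma path_mulE (x y : path_alg K) p : (x * y) p = path_mul_fun x y p.
Proof. by []. Qed.

Lemma path_co_lin i k x y :
  path_co i (k *: x + y) = k * path_co i x + path_co i y.
Proof. by case: i; rewrite /= !coef_at_lin; ring. Qed.

Lemma path_co_mul i x y :
  path_co i (x * y) = xs_mul_coef i (path_co^~ x) (path_co^~ y).
Proof.
by case: i; rewrite /= !coef_at_mul !(sum2_cons, sum2_nil) /path_end /=; ring.
Qed.

Definition path_co_ker : {pred path_alg K} :=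
  fun x => `[< forall i, path_co i x = 0 >].

Lemma path_co0 i : path_co i 0 = 0.
Proof. by case: i => //=; rewrite addr0. Qed.

Lemma path_coB i x y : path_co i (x - y) = path_co i x - path_co i y.
Proof. by rewrite addrC -scaleN1r path_co_lin mulN1r addrC. Qed.

Lemma path_co_ker_zmod : zmod_closed path_co_ker.
Proof.
split; first by apply/asboolP => i; exact: path_co0.
move=> x y /asboolP xK /asboolP yK; apply/asboolP => i.
by rewrite path_coB xK yK subr0.
Qed.
Lemma path_co_ker_Ml (u x : path_alg K) :
  x \in path_co_ker -> u * x \in path_co_ker.
Proof.
by move=> /asboolP xK; apply/asboolP => i; rewrite path_co_mul; case: i;
  rewrite /xs_mul_coef !xK; ring.
Qed.
Lemma path_co_ker_Mr (u x : path_alg K) :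
  x \in path_co_ker -> x * u \in path_co_ker.
Proof.
by move=> /asboolP xK; apply/asboolP => i; rewrite path_co_mul; case: i;
  rewrite /xs_mul_coef !xK; ring.
Qed.
HB.instance Definition _ :=
  GRing.isZmodClosed.Build (path_alg K) path_co_ker path_co_ker_zmod.
HB.instance Definition _ :=
  isIdeal2.Build (path_alg K) path_co_ker path_co_ker_Ml path_co_ker_Mr.

Lemma xs_ideal_co x i : x \in xs_ideal K -> path_co i x = 0.
Proof.
move=> /smallestP/(_ (path_co_ker : ideal2 _)) H.
suff /asboolP : x \in path_co_ker by apply.
apply: H => y; rewrite !inE => /or4P[] /eqP->; apply/asboolP => j;
  rewrite ?expr2 ?path_coB ?path_co_mul; case: j; rewrite /= ?mulr0 ?mul0r;
  rewrite /coef_at /= /path_basis_fun /=; ring.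
Qed.

Definition xs_co (i : xs_mono) (x : xs_alg K) : K := path_co i (repr x).

Lemma xs_co_pi i (x : path_alg K) : xs_co i (\pi_(xs_alg K) x) = path_co i x.
Proof.
apply/eqP; rewrite -subr_eq0 -path_coB; apply/eqP/xs_ideal_co.
by rewrite -opprB rpredN; apply: quot_repr_sub.
Qed.

Definition path_el (i : xs_mono) : path_alg K :=
  path_basis K (match i with
  | m1 => (v1, [::]) | m2 => (v2, [::])
  | ma => (v1, [:: arrow_a]) | mb => (v1, [:: arrow_b])
  | mab => (v1, [:: arrow_a; arrow_b])
  | mc => (v1, [:: arrow_c]) | mbc => (v1, [:: arrow_b; arrow_c])
  end).

Definition xs_el (i : xs_mono) : xs_alg K := \pi_(xs_alg K) (path_el i).

Lemma xs_piM (x y : path_alg K) :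
  \pi_(xs_alg K) (x * y) = \pi_(xs_alg K) x * \pi_(xs_alg K) y.
Proof. by rewrite -[LHS]quot_piM. Qed.
Lemma xs_piZ k (x : path_alg K) :
  \pi_(xs_alg K) (k *: x) = k *: \pi_(xs_alg K) x.
Proof. by rewrite -[LHS]quot_piZ. Qed.
Lemma xs_piD (x y : path_alg K) :
  \pi_(xs_alg K) (x + y) = \pi_(xs_alg K) x + \pi_(xs_alg K) y.
Proof. exact: quot_piD. Qed.

Lemma xs_pi0 : \pi_(xs_alg K) (0 : path_alg K) = 0.
Proof. by rewrite !piE. Qed.

Lemma xs_co_lin i k x y : xs_co i (k *: x + y) = k * xs_co i x + xs_co i y.
Proof.
have [x' ->] := Defs.quotP x; have [y' ->] := Defs.quotP y.
by rewrite -xs_piZ -xs_piD !xs_co_pi path_co_lin.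
Qed.

Lemma xs_co_mul i x y : xs_co i (x * y) = xs_mul_coef i (xs_co^~ x) (xs_co^~ y).
Proof.
have [x' ->] := Defs.quotP x; have [y' ->] := Defs.quotP y.
by rewrite -xs_piM xs_co_pi path_co_mul; case: i; rewrite /xs_mul_coef !xs_co_pi.
Qed.

Lemma xs_co_one i : xs_co i 1 = xs_one_coef i.
Proof.
rewrite -[1]/(\pi_(xs_alg K) (1 : path_alg K)) xs_co_pi.
by case: i; rewrite /= /coef_at /= /path_one_fun ?addr0.
Qed.

Lemma xs_co_el i j : xs_co i (xs_el j) = (xs_mono_eqb i j)%:R.
Proof.
by rewrite xs_co_pi; case: i; case: j; rewrite /= /coef_at /= /path_basis_fun /= ?addr0 ?add0r.
Qed.

Lemma path_basisE i s k w :
  path_basis K (i, s) (k, w) = ([&& is_path i s, k == i & w == s])%:R.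
Proof. by rewrite /= /path_basis_fun xpair_eqE. Qed.

Lemma arrow_mulE e x k w : (arrow_elt K e * x) (k, w) =
  if w is f :: w' then if (k == v1) && (f == e) then x (tgt e, w') else 0 else 0.
Proof.
rewrite path_mulE /path_mul_fun; case: w => [|f w].
  by rewrite sum2_nil path_basisE !andbF mul0r.
rewrite sum2_cons path_basisE !andbF mul0r add0r.
rewrite sum2_head => [|y u v]; last by rewrite path_basisE eqseq_cons !andbF mul0r.
rewrite path_basisE eqseq_cons /path_end /= !andbT.
by case: ifP => [/andP[_ /eqP->]|_]; rewrite ?mul1r ?mul0r.
Qed.

Lemma path_el_mul e j t :
  arrow_elt K e * path_basis K (j, t) =
  if tgt e == j then path_basis K (v1, e :: t) else 0.
Proof.
apply: path_alg_eq => k w; rewrite arrow_mulE (fun_if (fun x : path_alg K => x (k, w))).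
case: w => [|f w]; first by rewrite path_basisE !andbF; case: ifP.
rewrite !path_basisE eqseq_cons; have [<-|ne] := eqVneq (tgt e) j; last first.
  by rewrite andbF; case: ifP.
rewrite /=; case: (k == v1); rewrite /= ?andbF //.
by case: (f == e); rewrite /= ?andbF.
Qed.

Definition path_tail_fun (e : arrow) (x : path_alg K) (p : vertex * seq arrow) :
  K^o := if p.1 == tgt e then x (v1, e :: p.2) else 0.

Fact path_tail_subproof e x : path_tail_fun e x \in @path_pred K.
Proof.
have [xP [n xn]] := path_algP x; apply/asboolP; split=> [[i s] /= iP|].
  rewrite /path_tail_fun /=; case: eqP => // Ei.
  by rewrite xP //= -Ei.
by exists n => -[i s] /= ns; rewrite /path_tail_fun; case: ifP => // _; rewrite xn ?leqW.
Qed.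
Definition path_tail e x : path_alg K := PathAlg (path_tail_subproof e x).

Lemma path_decomp (x : path_alg K) :
  x = coef_at x v1 [::] *: path_el m1 + coef_at x v2 [::] *: path_el m2 +
      arrow_elt K arrow_a * path_tail arrow_a x +
      arrow_elt K arrow_b * path_tail arrow_b x +
      arrow_elt K arrow_c * path_tail arrow_c x.
Proof.
apply: path_alg_eq => i s; rewrite !path_coefD !path_coefZ !arrow_mulE !path_basisE.
have xP := proj1 (path_algP x).
have T e t : path_tail e x (tgt e, t) = x (v1, e :: t).
  by rewrite /= /path_tail_fun /= eqxx.
case: i; case: s => [|[] s]; rewrite /= ?T ?mulr0 ?mulr1 ?add0r ?addr0 //;
  by rewrite xP.
Qed.

Lemma xs_relE x y : x - y \in xs_relations K ->
  \pi_(xs_alg K) x = \pi_(xs_alg K) y.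
Proof. by move=> xy; apply/pi_quotE/smallestP => J; apply. Qed.

Let mul_arrow e j t : \pi_(xs_alg K) (arrow_elt K e) * \pi_(xs_alg K) (path_basis K (j, t)) =
  if tgt e == j then \pi_(xs_alg K) (path_basis K (v1, e :: t)) else 0.
Proof. by rewrite -xs_piM path_el_mul; case: ifP => // _; rewrite xs_pi0. Qed.

(** The relations rewrite an arrow times a monomial to a monomial or to 0; together with
    [path_decomp] this makes the monomials span [A]. *)
Lemma xs_el_mul (e : arrow) (j : xs_mono) : exists k i,
   \pi_(xs_alg K) (arrow_elt K e) * xs_el j = k *: xs_el i.
Proof.
pose A := \pi_(xs_alg K) (arrow_elt K arrow_a).
pose B := \pi_(xs_alg K) (arrow_elt K arrow_b).
pose C := \pi_(xs_alg K) (arrow_elt K arrow_c).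
have AA : A * A = 0.
  by rewrite -xs_piM; rewrite -xs_pi0; apply: xs_relE; rewrite subr0 -expr2 !inE eqxx.
have BB : B * B = 0.
  by rewrite -xs_piM; rewrite -xs_pi0; apply: xs_relE; rewrite subr0 -expr2 !inE eqxx orbT.
have BA : B * A = A * B.
  by rewrite -!xs_piM; symmetry; apply: xs_relE; rewrite !inE eqxx !orbT.
have AC : A * C = 0.
  by rewrite -xs_piM; rewrite -xs_pi0; apply: xs_relE; rewrite subr0 !inE eqxx !orbT.
have Eab : xs_el mab = A * B by rewrite mul_arrow.
have Ebc : xs_el mbc = B * C by rewrite mul_arrow.
have zero (z : xs_alg K) : z = 0 -> exists k i, z = k *: xs_el i.
  by move->; exists 0, m1; rewrite scale0r.
have one i (z : xs_alg K) : z = xs_el i -> exists k i, z = k *: xs_el i.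
  by move->; exists 1, i; rewrite scale1r.
case: e; [rewrite -/A|rewrite -/B|rewrite -/C].
- case: j; [apply: (one ma)|apply: zero|apply: zero|apply: (one mab)|apply: zero
           |apply: zero|apply: zero]; rewrite ?Eab ?Ebc //.
  + exact: mul_arrow.
  + exact: mul_arrow.
  + by rewrite mulrA AA mul0r.
  + by rewrite mulrA -BA -mulrA AC mulr0.
- case: j; [apply: (one mb)|apply: zero|apply: (one mab)|apply: zero|apply: zero
           |apply: (one mbc)|apply: zero]; rewrite ?Eab ?Ebc //.
  + exact: mul_arrow.
  + exact: mul_arrow.
  + by rewrite mulrA BA -mulrA BB mulr0.
  + by rewrite mulrA BB mul0r.
- case: j; [apply: zero|apply: (one mc)|..]; try apply: zero; exact: mul_arrow.
Qed.

Definition xs_comb (k : xs_mono -> K) : xs_alg K :=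
  k m1 *: xs_el m1 + k m2 *: xs_el m2 + k ma *: xs_el ma + k mb *: xs_el mb +
  k mab *: xs_el mab + k mc *: xs_el mc + k mbc *: xs_el mbc.

Lemma xs_comb_lin k f g :
  xs_comb (fun i => k * f i + g i) = k *: xs_comb f + xs_comb g.
Proof.
rewrite /xs_comb !scalerDr !scalerA !scalerDl.
by rewrite !addrA [LHS](ACl (1*3*5*7*9*11*13*2*4*6*8*10*12*14)).
Qed.

Lemma xs_comb_el i : xs_el i = xs_comb (fun j => (xs_mono_eqb j i)%:R).
Proof.
by case: i; rewrite /xs_comb /= !scale0r scale1r ?add0r ?addr0.
Qed.

Lemma xs_scalerAr k (x y : xs_alg K) : k *: (x * y) = x * (k *: y).
Proof. exact: scalerAr. Qed.

(** Induction on a strict bound for the lengths of the paths in the support: removing the first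
    arrow lowers it by one. *)
Lemma xs_comb_exists (x : xs_alg K) : exists k, x = xs_comb k.
Proof.
pose C (x : xs_alg K) := exists k, x = xs_comb k.
have C0 : C 0 by exists (fun=> 0); rewrite /xs_comb !scale0r !addr0.
have Clin k y z : C y -> C z -> C (k *: y + z).
  by move=> [f ->] [g ->]; exists (fun i => k * f i + g i); rewrite xs_comb_lin.
have Cel i : C (xs_el i) by exists (fun j => (xs_mono_eqb j i)%:R); exact: xs_comb_el.
have CD y z : C y -> C z -> C (y + z) by move=> Cy Cz; rewrite -[y]scale1r; apply: Clin.
have CZ k y : C y -> C (k *: y) by move=> Cy; rewrite -[_ *: _]addr0; apply: Clin.
have Cmul e y : C y -> C (\pi_(xs_alg K) (arrow_elt K e) * y).
  move=> [k ->]; rewrite /xs_comb !mulrDr -!xs_scalerAr.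
  have T i : C (\pi_(xs_alg K) (arrow_elt K e) * xs_el i).
    by have [l [j ->]] := xs_el_mul e i; apply/CZ/Cel.
  by do ![apply: (CD) | apply: (CZ) | apply: (T)].
have [x' ->] := Defs.quotP x; have [_ [n]] := path_algP x'.
rewrite -/(C _); elim: n x' => [|n IHn] x' x'n.
  suff -> : x' = 0 by rewrite xs_pi0; exact: C0.
  by apply: path_alg_eq => i s; rewrite x'n.
rewrite [x']path_decomp !xs_piD !xs_piM !xs_piZ.
have T e : C (\pi_(xs_alg K) (path_tail e x')).
  apply: IHn => -[i s] /= ns; rewrite /path_tail_fun /=; case: ifP => // _.
  by apply: x'n.
by do ![apply: (CD) | apply: (CZ) | apply: (Cmul) | apply: (T) | apply: (Cel m1) | apply: (Cel m2)].
Qed.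

Lemma xs_co_inj (x y : xs_alg K) : (forall i, xs_co i x = xs_co i y) -> x = y.
Proof.
have co_comb i k : xs_co i (xs_comb k) = k i.
  have coD u v : xs_co i (u + v) = xs_co i u + xs_co i v.
    by have := xs_co_lin i 1 u v; rewrite scale1r mul1r.
  have coZ l j : xs_co i (l *: xs_el j) = l * (xs_mono_eqb i j)%:R.
    have := xs_co_lin i l (xs_el j) 0; rewrite addr0 => ->.
    by rewrite -xs_pi0 xs_co_el xs_co_pi path_co0 addr0.
  by rewrite !coD !coZ; case: i {coD coZ} => /=; ring.
have [f ->] := xs_comb_exists x; have [g ->] := xs_comb_exists y.
move=> fg; have {}fg i : f i = g i by have := fg i; rewrite !co_comb.
by rewrite /xs_comb !fg.
Qed.

Definition xs_alg_coords : xs_coords (xs_alg K) :=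
  XsCoords xs_co_lin xs_co_el xs_co_mul xs_co_one xs_co_inj.

End Coordinates.

(** * Hochschild cochains *)

Section HochschildGeneralities.
Variables (K : fieldType) (A : algType K).
Implicit Types (f g h : seq A -> A) (s t u v w : seq A).

Lemma hoch_delta_ext f g s :
  (forall t, (size t).+1 = size s -> f t = g t) -> hoch_delta f s = hoch_delta g s.
Proof.
case: s => [//|a t] fg; rewrite /hoch_delta.
congr (_ *: (_ * _) + _ + _ * _); [exact: fg | | by rewrite fg //= size_belast].
apply: eq_bigr => i _; rewrite fg // size_cat /= size_drop size_takel /=; last first.
  exact/ltnW/ltnW/ltn_ord.
by rewrite addnS -addSn subnKC.
Qed.

Definition hinner f s : A :=
  if s is _ :: t then
    \sum_(i < size t) (-1) ^+ (size t - i) *: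
        f (take i s ++ (s`_i * s`_i.+1) :: drop i.+2 s)
  else 0.

Arguments hinner : simpl never.
Arguments hoch_delta : simpl never.

Lemma hoch_delta_cons f a t : hoch_delta f (a :: t) =
  (-1) ^+ (size t).+1 *: (a * f t) + hinner f (a :: t) + f (belast a t) * last a t.
Proof. by []. Qed.

Lemma hinner1 f a : hinner f [:: a] = 0.
Proof. exact: big_ord0. Qed.

Lemma hinner_cons f a b t : hinner f (a :: b :: t) =
  (-1) ^+ (size t).+1 *: f (a * b :: t) + hinner (fun u => f (a :: u)) (b :: t).
Proof. by rewrite /hinner big_ord_recl /= drop0. Qed.

Lemma hinner_rcons f s y z : hinner f (rcons (rcons s y) z) =
  - hinner (fun u => f (rcons u z)) (rcons s y) - f (rcons s (y * z)).
Proof.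
elim: s f => [|x [|x' s] IHs] f /=.
- by rewrite hinner_cons !hinner1 expr1 scaleN1r oppr0 addr0 add0r.
- rewrite !hinner_cons !hinner1 /= expr1 !addr0 expr2 mulrNN mulr1 !scale1r !scaleN1r.
  by rewrite opprK.
- rewrite hinner_cons -[x' :: _]/(rcons (rcons (x' :: s) y) z) IHs /=.
  rewrite [in RHS]hinner_cons /= !size_rcons opprD addrA; congr (_ + _ - _).
  by rewrite exprS mulN1r scaleNr.
Qed.

(** Isolates the terms that involve the last argument. This is what allows induction on the degree
    through the partial cochains [rins f z]. *)
Lemma hoch_delta_rcons f s y z : hoch_delta f (rcons (rcons s y) z) =
  - hoch_delta (fun u => f (rcons u z)) (rcons s y) + f (rcons s z) * y
  - f (rcons s (y * z)) + f (rcons s y) * z.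
Proof.
have alg (V : zmodType) (p q r t w : V) :
    - p + (- q - r) + t = - (p + q + w) + w - r + t.
  by rewrite !opprD addrNK !addrA.
case: s => [|x s] /=.
  rewrite !hoch_delta_cons /= -[[:: y; z]]/(rcons (rcons [::] y) z) hinner_rcons /=.
  rewrite hinner1 expr2 mulrNN mulr1 scale1r expr1 scaleN1r.
  by rewrite addr0 opprD opprK subrK oppr0 add0r.
rewrite !hoch_delta_cons -!rcons_cons.
rewrite hinner_rcons /= !belast_rcons !last_rcons !size_rcons.
by rewrite exprS mulN1r scaleNr; exact: alg.
Qed.

Lemma hoch_delta_hsgn f s :
  hoch_delta (hsgn f) s = (-1) ^+ (size s).+1 *: hoch_delta f s.
Proof.
have -> : hsgn f = fun t => - 1 *: heps f t.
  apply/funext => t; rewrite /heps scalerA exprS mulrA mulrNN mulr1 mul1r //.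
have dZ k g : hoch_delta (fun t => k *: g t) s = k *: hoch_delta g s.
  case: s => [|a t]; first by rewrite /= scaler0.
  rewrite /hoch_delta !scalerDr scaler_sumr; congr (_ + _ + _).
  - by rewrite -scalerAr !scalerA mulrC.
  - by apply: eq_bigr => i _; rewrite !scalerA mulrC.
  - by rewrite scalerAl.
by rewrite dZ hoch_delta_sgn scalerA exprS.
Qed.

Definition lin1_fun (g : A -> A) s : A := if s is [:: x] then g x else 0.

Fact lin1_subproof (g : A -> A) :
  (forall k x y, g (k *: x + y) = k *: g x + g y) -> lin1_fun g \in @cochain_pred K A.
Proof.
move=> gL; apply/asboolP; split; last by exists 2%N => -[|? []].
by move=> [|a [|b u]] [|c w] k x y; rewrite /= ?scaler0 ?addr0.
Qed.
Definition lin1 (g : A -> A) (gL : forall k x y, g (k *: x + y) = k *: g x + g y) :=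
  Cochain (lin1_subproof gL).

Lemma hoch_delta_lin1 (g : A -> A) s : hoch_delta (lin1_fun g) s =
  if s is [:: x; y] then g x * y - g (x * y) + x * g y else 0.
Proof.
case: s => [//|x [|y [|z t]]].
- by rewrite hoch_delta_cons hinner1 /= mulr0 mul0r scaler0 !addr0.
- rewrite hoch_delta_cons hinner_cons hinner1 /= expr2 mulrNN mulr1 expr1.
  by rewrite scale1r scaleN1r addr0 addrC [x * _ + _]addrC addrA.
rewrite (@hoch_delta_ext _ (fun=> 0)) ?hoch_delta0 //.
by case=> [|? []].
Qed.

Fact rins_subproof (f : cochain A) (z : A) :
  (fun s => f (rcons s z)) \in @cochain_pred K A.
Proof.
apply/asboolP; split.
  by move=> u w k x y; rewrite !rcons_cat !rcons_cons; apply: cochainL.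
have [n fn] := cochainB f; exists n => s ns; rewrite fn // size_rcons; exact: leqW.
Qed.
Definition rins (f : cochain A) z := Cochain (rins_subproof f z).

Fact lins_subproof (f : cochain A) (z : A) :
  (fun s => f (z :: s)) \in @cochain_pred K A.
Proof.
apply/asboolP; split.
  by move=> u w k x y; rewrite -!cat_cons; apply: cochainL.
have [n fn] := cochainB f; exists n => s ns; rewrite fn //=; exact: leqW.
Qed.
Definition lins (f : cochain A) z := Cochain (lins_subproof f z).

Fact trunc_subproof (P : pred nat) (f : cochain A) :
  (fun s => if P (size s) then f s else 0) \in @cochain_pred K A.
Proof.
apply/asboolP; split.
  move=> u w k x y; rewrite !size_cat /=; case: ifP => _; last by rewrite scaler0 addr0.
  exact: cochainL.
by have [n fn] := cochainB f; exists n => s ns; rewrite fn // if_same.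
Qed.
Definition trunc P (f : cochain A) := Cochain (trunc_subproof P f).

Lemma hoch_delta_trunc P (f : cochain A) s :
  hoch_delta (trunc P f) s = if P (size s).-1 then hoch_delta f s else 0.
Proof.
case: ifP => Ps.
  by apply: hoch_delta_ext => t E; rewrite /= (_ : size t = (size s).-1) ?Ps // -E.
rewrite (@hoch_delta_ext _ (fun=> 0)) ?hoch_delta0 // => t E.
by rewrite /= (_ : size t = (size s).-1) ?Ps // -E.
Qed.

Fact postcomp_subproof (g : A -> A) (f : cochain A) :
  (forall k x y, g (k *: x + y) = k *: g x + g y) ->
  (fun s => g (f s)) \in @cochain_pred K A.
Proof.
move=> gL; have g0 : g 0 = 0.
  by have := gL (-1) 0 0; rewrite scaler0 addr0 scaleN1r addNr.
apply/asboolP; split; first by move=> u w k x y; rewrite cochainL gL.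
by have [n fn] := cochainB f; exists n => s ns; rewrite fn.
Qed.
Definition postcomp (g : A -> A) (gL : forall k x y, g (k *: x + y) = k *: g x + g y)
  (f : cochain A) := Cochain (postcomp_subproof f gL).

End HochschildGeneralities.

Arguments hinner : simpl never.
Arguments hoch_delta : simpl never.

(** * Cochains with values in the simple module at vertex 1 *)

Section XuSnashallCochains.
Variables (K : fieldType) (A : algType K) (B : xs_coords A).
Implicit Types (f g h : cochain A) (s t u v w : seq A) (x y z : A).

Local Notation co := (co B).
Local Notation el := (el B).

Lemma coD i x y : co i (x + y) = co i x + co i y.
Proof. by have := co_lin B i 1 x y; rewrite scale1r mul1r. Qed.
Lemma co0 i : co i 0 = 0.
Proof. by apply: (addrI (co i 0)); rewrite -coD !addr0. Qed.
Lemma coZ i k x : co i (k *: x) = k * co i x.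
Proof. by have := co_lin B i k x 0; rewrite co0 !addr0. Qed.
Lemma coN i x : co i (- x) = - co i x.
Proof. by rewrite -scaleN1r coZ mulN1r. Qed.
Lemma coB i x y : co i (x - y) = co i x - co i y.
Proof. by rewrite coD coN. Qed.
Lemma co1M x y : co m1 (x * y) = co m1 x * co m1 y.
Proof. exact: co_mul. Qed.
Lemma co2M x y : co m2 (x * y) = co m2 x * co m2 y.
Proof. exact: co_mul. Qed.
Lemma co_sum I (r : seq I) P i (F : I -> A) :
  co i (\sum_(j <- r | P j) F j) = \sum_(j <- r | P j) co i (F j).
Proof. exact: (big_morph (co i) (coD i) (co0 i)). Qed.
Lemma co_sum2 i F s :
  co i (sum2 F s : A) = sum2 (fun u v => co i (F u v)) s.
Proof. exact: co_sum. Qed.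

(** [co m1] is multiplicative, so it carries [hoch_delta] to a differential on K-valued cochains,
    which does not see the other coordinates. *)
Lemma co1_delta_ext f g s : (forall t, co m1 (f t) = co m1 (g t)) ->
  co m1 (hoch_delta f s) = co m1 (hoch_delta g s).
Proof.
move=> fg; case: s => [//|a t]; rewrite /hoch_delta !coD !coZ !co1M !fg !co_sum.
by congr (_ + _ + _); apply: eq_bigr => i _; rewrite !coZ fg.
Qed.
Lemma co2_delta_ext f g s : (forall t, co m2 (f t) = co m2 (g t)) ->
  co m2 (hoch_delta f s) = co m2 (hoch_delta g s).
Proof.
move=> fg; case: s => [//|a t]; rewrite /hoch_delta !coD !coZ !co2M !fg !co_sum.
by congr (_ + _ + _); apply: eq_bigr => i _; rewrite !coZ fg.
Qed.

(* Cochains with values in the bimodule A/(r + A e_2 A) = K are represented   *)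
(* by A-valued ones, of which only the coordinate at e_1 matters: cocycle1    *)
(* and coboundary1 describe the cocycles and coboundaries of that complex.    *)
Definition cocycle1 f := forall s, co m1 (hoch_delta f s) = 0.
Definition coboundary1 f := exists h, forall s, co m1 (f s) = co m1 (hoch_delta h s).

Lemma hoch_deltaD f g s : hoch_delta (f + g) s = hoch_delta f s + hoch_delta g s.
Proof. by have := hoch_delta_lin 1 f g s; rewrite !scale1r. Qed.
Lemma hoch_deltaZ k f s : hoch_delta (k *: f) s = k *: hoch_delta f s.
Proof. by have := hoch_delta_lin k f 0 s; rewrite addr0 hoch_delta0 addr0. Qed.
Lemma hoch_deltaN f s : hoch_delta (- f) s = - hoch_delta f s.
Proof. by rewrite -scaleN1r hoch_deltaZ scaleN1r. Qed.

Lemma cocycle1D f g : cocycle1 f -> cocycle1 g -> cocycle1 (f + g).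
Proof. by move=> fZ gZ s; rewrite hoch_deltaD coD fZ gZ addr0. Qed.
Lemma cocycle1Z k f : cocycle1 f -> cocycle1 (k *: f).
Proof. by move=> fZ s; rewrite hoch_deltaZ coZ fZ mulr0. Qed.
Lemma cocycle10 : cocycle1 0.
Proof. by move=> s; rewrite hoch_delta0 co0. Qed.
Lemma hoch_delta_mul f g s : hoch_delta (f * g) s =
  hoch_cup (hoch_delta f) g s + hoch_cup (cochain_sgn f) (hoch_delta g) s.
Proof. by apply: hoch_delta_cup; apply: cochainL. Qed.
Lemma co1_hoch_cup (f g : seq A -> A) s : co m1 (hoch_cup f g s) =
  sum2 (fun u v => (-1) ^+ (size u * size v) * (co m1 (f u) * co m1 (g v))) s.
Proof. by rewrite co_sum2; apply: eq_sum2 => u v _; rewrite coZ co1M. Qed.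
Lemma co1_cup f g s : co m1 ((f * g) s) =
  sum2 (fun u v => (-1) ^+ (size u * size v) * (co m1 (f u) * co m1 (g v))) s.
Proof. exact: co1_hoch_cup. Qed.
Lemma co1_cup0l (f g : seq A -> A) s : (forall t, co m1 (f t) = 0) ->
  co m1 (hoch_cup f g s) = 0.
Proof.
move=> f0; rewrite co1_hoch_cup -[RHS](sum2_0 K s).
by apply: eq_sum2 => u v _; rewrite f0 mul0r mulr0.
Qed.
Lemma co1_cup0r (f g : seq A -> A) s : (forall t, co m1 (g t) = 0) ->
  co m1 (hoch_cup f g s) = 0.
Proof.
move=> f0; rewrite co1_hoch_cup -[RHS](sum2_0 K s).
by apply: eq_sum2 => u v _; rewrite f0 !mulr0.
Qed.
Lemma cocycle1M f g : cocycle1 f -> cocycle1 g -> cocycle1 (f * g).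
Proof. by move=> fZ gZ s; rewrite hoch_delta_mul coD co1_cup0l ?co1_cup0r ?addr0. Qed.
Lemma cocycle11 : cocycle1 1.
Proof. by move=> s; rewrite (@cocycleP K A 1) co0. Qed.
Lemma cocycle1_sgn f : cocycle1 f -> cocycle1 (cochain_sgn f).
Proof. by move=> fZ s; rewrite hoch_delta_hsgn coZ fZ mulr0. Qed.

Lemma coboundary1_ext f g : (forall s, co m1 (f s) = co m1 (g s)) -> coboundary1 f -> coboundary1 g.
Proof. by move=> fg [h fh]; exists h => s; rewrite -fg. Qed.
Lemma coboundary10 f : (forall s, co m1 (f s) = 0) -> coboundary1 f.
Proof. by move=> f0; exists 0 => s; rewrite hoch_delta0 co0. Qed.
Lemma coboundary1D f g : coboundary1 f -> coboundary1 g -> coboundary1 (f + g).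
Proof.
by move=> [h fh] [k gk]; exists (h + k) => s; rewrite coD hoch_deltaD coD fh gk.
Qed.
Lemma coboundary1Z k f : coboundary1 f -> coboundary1 (k *: f).
Proof. by move=> [h fh]; exists (k *: h) => s; rewrite hoch_deltaZ !coZ fh. Qed.
Lemma coboundary1N f : coboundary1 f -> coboundary1 (- f).
Proof. by rewrite -scaleN1r; apply: coboundary1Z. Qed.
Lemma coboundary1B f g : coboundary1 f -> coboundary1 g -> coboundary1 (f - g).
Proof. by move=> fB gB; apply/coboundary1D/coboundary1N. Qed.
Lemma coboundary1_Mr f g : coboundary1 f -> cocycle1 g -> coboundary1 (f * g).
Proof.
move=> [h fh] gZ; exists (h * g) => s; rewrite hoch_delta_mul coD.
rewrite (co1_cup0r _ s gZ) addr0 !co1_hoch_cup.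
by apply: eq_sum2 => u v _; rewrite fh.
Qed.
Lemma coboundary1_Ml f g : cocycle1 f -> coboundary1 g -> coboundary1 (f * g).
Proof.
move=> fZ [h gh]; exists (cochain_sgn f * h) => s; rewrite hoch_delta_mul coD.
rewrite (co1_cup0l _ s (cocycle1_sgn fZ)) add0r !co1_hoch_cup.
apply: eq_sum2 => u v _; rewrite gh; congr (_ * (_ * _)).
by rewrite /= /hsgn !coZ mulrA -expr2 sqrr_sign mul1r.
Qed.

Ltac co_ring := apply: (@co_inj _ _ B); case; rewrite ?(coD, coN, coZ, co_mul, co_el) /=;
  rewrite ?(coD, coN, coZ, co_mul, co_el) /=;
  rewrite ?(coD, coN, coZ, co_mul, co_el) /=; ring.

(* d/da (extended by 0 to c and bc), d/db, b d/db, and the dual of ab: only   *)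
(* b d/db is a derivation of A in every characteristic.                       *)
Definition xDa x := co ma x *: el m1 + co mab x *: el mb.
Definition xDb x := co mb x *: el m1 + co mab x *: el ma + co mbc x *: el mc.
Definition xTh x := co mb x *: el mb + co mab x *: el mab + co mbc x *: el mbc.
Definition xT x := co mab x *: el m1.

Fact xDa_lin k x y : xDa (k *: x + y) = k *: xDa x + xDa y.
Proof. by rewrite /xDa; co_ring. Qed.
Fact xDb_lin k x y : xDb (k *: x + y) = k *: xDb x + xDb y.
Proof. by rewrite /xDb; co_ring. Qed.
Fact xTh_lin k x y : xTh (k *: x + y) = k *: xTh x + xTh y.
Proof. by rewrite /xTh; co_ring. Qed.
Fact xT_lin k x y : xT (k *: x + y) = k *: xT x + xT y.
Proof. by rewrite /xT; co_ring. Qed.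
Definition Da := lin1 xDa_lin.
Definition Db := lin1 xDb_lin.
Definition Th := lin1 xTh_lin.
Definition Tc := lin1 xT_lin.

Lemma co_Da i x : co i (xDa x) =
  match i with m1 => co ma x | mb => co mab x | _ => 0 end.
Proof. by rewrite /xDa coD !coZ !co_el; case: i => /=; ring. Qed.
Lemma co_Db i x : co i (xDb x) =
  match i with m1 => co mb x | ma => co mab x | mc => co mbc x | _ => 0 end.
Proof. by rewrite /xDb !coD !coZ !co_el; case: i => /=; ring. Qed.
Lemma co_Th i x : co i (xTh x) =
  match i with mb => co mb x | mab => co mab x | mbc => co mbc x | _ => 0 end.
Proof. by rewrite /xTh !coD !coZ !co_el; case: i => /=; ring. Qed.
Lemma co_T i x : co i (xT x) = match i with m1 => co mab x | _ => 0 end.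
Proof. by rewrite /xT !coZ !co_el; case: i => /=; ring. Qed.

Lemma cocycle1_Da : cocycle1 Da.
Proof.
move=> s; rewrite hoch_delta_lin1; case: s => [|x [|y []]]; rewrite ?co0 //=.
by rewrite !(coD, coN, co1M, co_Da) co_mul /=; ring.
Qed.
Lemma cocycle1_Db : cocycle1 Db.
Proof.
move=> s; rewrite hoch_delta_lin1; case: s => [|x [|y []]]; rewrite ?co0 //=.
by rewrite !(coD, coN, co1M, co_Db) co_mul /=; ring.
Qed.

Lemma lin1_mul (g h : A -> A) s : hoch_cup (lin1_fun g) (lin1_fun h) s =
  if s is [:: x; y] then - (g x * h y) else 0.
Proof.
case: s => [|x s]; rewrite /hoch_cup; first by rewrite sum2_nil /= mul0r scaler0.
rewrite sum2_cons sum2_head /= => [|y u v]; last by rewrite mul0r scaler0.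
rewrite mul0r scaler0 add0r.
case: s => [|y [|z s]] /=; rewrite ?mulr0 ?scaler0 //.
by rewrite muln1 expr1 scaleN1r.
Qed.

(** The relation xy + yx = 0 of the cohomology ring: because ab = ba, the dual [Tc] of ab bounds the
    symmetrised product. *)
Lemma coboundary1_DaDb : coboundary1 (Da * Db + Db * Da).
Proof.
exists Tc => s; rewrite cochainD /= !lin1_mul hoch_delta_lin1.
case: s => [|x [|y []]]; rewrite ?addr0 //.
by rewrite !(coD, coN, co1M, co_Da, co_Db, co_T) co_mul /=; ring.
Qed.

End XuSnashallCochains.

(** * Evaluation of cochains on words in a and b *)

(* The ring K<x, y>/(xy + yx), seen through its embedding in some ring T,    *)
(* with the functional rho sending x^i y^j to X^i Y^j (Y the outer variable). *)
Record skew_ring (K : fieldType) := SkewRing {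
  skT :> nzRingType;
  sk : K -> skT;
  sx : skT;
  sy : skT;
  rho : skT -> {poly {poly K}};
  skD : forall c d, sk (c + d) = sk c + sk d;
  skM : forall c d, sk (c * d) = sk c * sk d;
  sk1 : sk 1 = 1;
  skC : forall c t, t * sk c = sk c * t;
  sy_sx : sy * sx = - (sx * sy);
  rhoD : forall s t, rho (s + t) = rho s + rho t;
  rho_sk : forall c t, rho (sk c * t) = c%:P%:P * rho t;
  rho_sx : forall t, rho (sx * t) = 'X%:P * rho t;
  rho_sy : forall t, rho (t * sy) = 'X * rho t;
  rho1 : rho 1 = 1
}.

(** * A model of the skew ring by 2 x 2 matrices *)

Section MatrixModel.
Variable K : fieldType.
Local Notation T := 'M[{poly {poly K}}]_2.

Let msk (c : K) : T := (c%:P%:P)%:M.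
(** diag(X, -X) anticommutes with Y times the swap matrix. The first row of x^i y^j has the single
    nonzero entry X^i Y^j, so the sum of that row serves as [rho]. *)
Let mx : T := \matrix_(i, j)
  (if i == j then (if i == 0 then 'X%:P else - 'X%:P) else 0).
Let my : T := \matrix_(i, j) (if i == j then 0 else 'X).
Let mrho (t : T) : {poly {poly K}} := t 0 0 + t 0 1.

Fact msk_D c d : msk (c + d) = msk c + msk d.
Proof. by rewrite /msk !polyCD raddfD. Qed.
Fact msk_M c d : msk (c * d) = msk c * msk d.
Proof. by rewrite /msk !polyCM scalar_mxM. Qed.
Fact msk_1 : msk 1 = 1.
Proof. by rewrite /msk !polyC1. Qed.
Fact msk_C c t : t * msk c = msk c * t.
Proof. exact: scalar_mxC. Qed.
Fact my_mx : my * mx = - (mx * my).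
Proof.
apply/matrixP => i j; rewrite !mxE !big_ord_recl !big_ord0 !mxE.
by case: i => [[|[|i]] Hi] //; case: j => [[|[|j]] Hj] //=; ring.
Qed.
Fact mrho_D s t : mrho (s + t) = mrho s + mrho t.
Proof. by rewrite /mrho !mxE addrACA. Qed.
Fact mrho_sk c t : mrho (msk c * t) = c%:P%:P * mrho t.
Proof. by rewrite /mrho -[_ * t]/(msk c *m t) mul_scalar_mx !mxE mulrDr. Qed.
Fact mrho_mx t : mrho (mx * t) = 'X%:P * mrho t.
Proof.
by rewrite /mrho !mxE !big_ord_recl !big_ord0 !mxE /= !mul0r !addr0 mulrDr.
Qed.
Fact mrho_my t : mrho (t * my) = 'X * mrho t.
Proof.
rewrite /mrho !mxE !big_ord_recl !big_ord0 !mxE /= mulr0 add0r !addr0 mulr0 addr0.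
by rewrite addrC -mulrDl mulrC; congr (_ * (_ + _)); congr (t _ _); apply/val_inj.
Qed.
Fact mrho_1 : mrho 1 = 1.
Proof. by rewrite /mrho !mxE /= addr0. Qed.

Definition skew_matrices : skew_ring K :=
  SkewRing msk_D msk_M msk_1 msk_C my_mx mrho_D mrho_sk mrho_mx mrho_my mrho_1.

End MatrixModel.

(** * Monomials and homogeneous forms in the skew ring *)

Section SkewRing.
Variables (K : fieldType) (S : skew_ring K).
Implicit Types (s t : S) (c d : K).

Local Notation sk := (@sk K S).
Local Notation sx := (sx S).
Local Notation sy := (sy S).
Local Notation rho := (@rho K S).

Lemma sk0 : sk 0 = 0.
Proof. by apply: (addrI (sk 0)); rewrite -skD !addr0. Qed.
Lemma skN c : sk (- c) = - sk c.
Proof. by apply: (addrI (sk c)); rewrite -skD !subrr sk0. Qed.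
Lemma sksign n : sk ((-1) ^+ n) = (-1) ^+ n.
Proof.
elim: n => [|n IHn]; first by rewrite !expr0 sk1.
by rewrite !exprS skM IHn skN sk1.
Qed.
Lemma skCA t c s : t * (sk c * s) = sk c * (t * s).
Proof. by rewrite mulrA skC -mulrA. Qed.
Lemma signC n t : t * (-1) ^+ n = (-1) ^+ n * t.
Proof. by rewrite -sksign skC. Qed.

Lemma sxy_comm i j : sy ^+ j * sx ^+ i = (-1) ^+ (i * j) * (sx ^+ i * sy ^+ j).
Proof.
have H i' : sy * sx ^+ i' = (-1) ^+ i' * (sx ^+ i' * sy).
  elim: i' => [|i' IH]; first by rewrite !expr0 !mul1r mulr1.
  by rewrite [in LHS]exprSr mulrA IH -!mulrA sy_sx mulrN mulrN -mulNr exprS mulN1r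
    [in RHS]exprSr !mulrA.
elim: j => [|j IH]; first by rewrite muln0 !expr0 !mul1r mulr1.
rewrite exprSr -mulrA H [LHS]mulrA signC -mulrA [sy ^+ j * _]mulrA IH mulnS exprD -!mulrA.
by rewrite -exprSr.
Qed.

Lemma rho0 : rho 0 = 0.
Proof. by apply: (addrI (rho 0)); rewrite -rhoD !addr0. Qed.
Lemma rho_sum I r P (F : I -> S) :
  rho (\sum_(i <- r | P i) F i) = \sum_(i <- r | P i) rho (F i).
Proof. exact: (big_morph rho (@rhoD K S) rho0). Qed.
Lemma rho_sxn i t : rho (sx ^+ i * t) = 'X%:P ^+ i * rho t.
Proof.
elim: i => [|i IHi]; first by rewrite !expr0 !mul1r.
by rewrite !exprS -!mulrA rho_sx IHi.
Qed.
Lemma rho_syn i t : rho (t * sy ^+ i) = 'X ^+ i * rho t.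
Proof.
elim: i => [|i IHi]; first by rewrite !expr0 mulr1 mul1r.
by rewrite exprSr mulrA rho_sy IHi exprS mulrA.
Qed.
Lemma rho_mono c i j :
  rho (sk c * (sx ^+ i * sy ^+ j)) = (c%:P * 'X^i)%:P * 'X^j.
Proof.
rewrite rho_sk rho_sxn -[sy ^+ j]mul1r rho_syn rho1 mulr1.
by rewrite polyCM polyC_exp mulrA.
Qed.

Definition skew_form n (g : nat -> K) : S :=
  \sum_(i < n.+1) sk (g i) * (sx ^+ i * sy ^+ (n - i)).

(** The monomials x^i y^j are linearly independent in [S], since [rho] sends them to distinct
    monomials of a polynomial ring. *)
Lemma coef_skew_form n g j : (j <= n)%N -> (rho (skew_form n g))`_(n - j)`_j = g j.
Proof.
move=> jn; rewrite /skew_form rho_sum coef_sum coef_sum (bigD1 (inord j)) //=.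
rewrite inordK // rho_mono coefMXn ltnn subnn coefC eqxx coefCM coefXn eqxx mulr1.
rewrite big1 ?addr0 // => i ne; rewrite rho_mono coefMXn.
case: ltnP => [|ij]; first by rewrite coef0.
rewrite coefC; case: eqP => [/eqP|_]; last by rewrite coef0.
rewrite subn_eq0 => ji; case/eqP: ne; apply/val_inj; rewrite /= inordK //.
by apply/eqP; rewrite eqn_leq; have := ltn_ord i; lia.
Qed.

Lemma skew_form_cons n (g h : nat -> K) :
  sx * skew_form n g + sy * skew_form n h =
  skew_form n.+1 (fun i => (if i is i'.+1 then g i' else 0) +
                           (if (i <= n)%N then (-1) ^+ i * h i else 0)).
Proof.
rewrite /skew_form !mulr_sumr.
under [RHS]eq_bigr do rewrite skD mulrDl.
rewrite big_split; congr (_ + _).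
  rewrite [RHS]big_ord_recl /= sk0 mul0r add0r; apply: eq_bigr => i _.
  by rewrite /bump /= add1n subSS exprS (skCA sx) -!mulrA.
rewrite [RHS]big_ord_recr /= ltnn sk0 mul0r addr0; apply: eq_bigr => i _.
rewrite leq_ord subSn ?leq_ord // (skCA sy) mulrC skM sksign -mulrA; congr (_ * _).
have := sxy_comm i 1; rewrite expr1 muln1 => E.
by rewrite [LHS]mulrA E -!mulrA -exprS.
Qed.

End SkewRing.

(** * The evaluation map: products and coboundaries *)

Section Words.
Variables (K : fieldType) (A : algType K) (B : xs_coords A) (S : skew_ring K).
Implicit Types (f g h : cochain A) (s t u v w : seq A) (x y z : A).
Implicit Types (phi psi : seq A -> K).

Local Notation co := (co B).
Local Notation el := (el B).
Local Notation sk := (@sk K S).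
Local Notation X := (sx S).
Local Notation Y := (sy S).

(* The sum over the words w of length n in a and b of phi(w) times the word   *)
(* w in the skew variables; it kills coboundaries because x and y anticommute *)
(* while a and b commute and square to zero.                                  *)
Fixpoint ev n phi : S :=
  if n is n'.+1 then
    X * ev n' (fun s => phi (el ma :: s)) + Y * ev n' (fun s => phi (el mb :: s))
  else sk (phi [::]).

Lemma evS n phi : ev n.+1 phi =
  X * ev n (fun s => phi (el ma :: s)) + Y * ev n (fun s => phi (el mb :: s)).
Proof. by []. Qed.

Lemma ev_ext n phi psi : (forall s, size s = n -> phi s = psi s) ->
  ev n phi = ev n psi.
Proof.
elim: n phi psi => [|n IHn] phi psi E /=; first by rewrite E.
by congr (_ * _ + _ * _); apply: IHn => s ns; rewrite E //= ns.
Qed.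
Lemma evD n phi psi : ev n (fun s => phi s + psi s) = ev n phi + ev n psi.
Proof.
elim: n phi psi => [|n IHn] phi psi; first exact: skD.
by rewrite !evS !IHn !mulrDr addrACA.
Qed.
Lemma evZ n k phi : ev n (fun s => k * phi s) = sk k * ev n phi.
Proof.
elim: n phi => [|n IHn] phi; first exact: skM.
by rewrite !evS !IHn mulrDr (skCA X) (skCA Y).
Qed.
Lemma ev0 n : ev n (fun=> 0) = 0.
Proof. by have := evZ n 0 (fun=> 0); rewrite sk0 !mul0r. Qed.
Lemma ev_eq0 n phi : (forall s, size s = n -> phi s = 0) -> ev n phi = 0.
Proof. by move=> H; rewrite -[RHS](ev0 n); apply: ev_ext. Qed.
Lemma evN n phi : ev n (fun s => - phi s) = - ev n phi.
Proof.
rewrite -mulN1r -[-1]/(-1 : S) -(sk1 S) -skN -evZ.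
by apply: ev_ext => s _; rewrite mulN1r.
Qed.

Lemma ev_rcons n phi : ev n.+1 phi =
  ev n (fun s => phi (rcons s (el ma))) * X + ev n (fun s => phi (rcons s (el mb))) * Y.
Proof.
elim: n phi => [|n IHn] phi; first by rewrite /= !skC.
rewrite evS (IHn (fun s => phi (el ma :: s))) (IHn (fun s => phi (el mb :: s))) !evS.
by rewrite !mulrDl !mulrDr !mulrA addrACA.
Qed.

(** A word splits uniquely into a prefix and a suffix of given lengths, so convolutions become sums
    of products of evaluations. *)
Lemma ev_conv n (e : nat -> nat -> K) phi psi :
  ev n (fun s => sum2 (fun u v => e (size u) (size v) * (phi u * psi v)) s) =
  \sum_(k < n.+1) sk (e k (n - k)%N) * (ev k phi * ev (n - k) psi).
Proof.
elim: n e phi => [|n IHn] e phi.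
  by rewrite big_ord1 /= sum2_nil !skM.
rewrite big_ord_recl subn0.
under eq_bigr => k _ do rewrite lift0 subSS.
have H x : ev n (fun s => sum2 (fun u v => e (size u) (size v) * (phi u * psi v)) (x :: s)) =
  sk (e 0 n.+1) * (sk (phi [::]) * ev n (fun s => psi (x :: s))) +
  \sum_(k < n.+1) sk (e k.+1 (n - k)%N) * (ev k (fun s => phi (x :: s)) * ev (n - k) psi).
  rewrite -(IHn (fun i j => e i.+1 j) (fun s => phi (x :: s))) -!evZ -evD.
  by apply: ev_ext => s ns; rewrite sum2_cons /= ns.
rewrite evS !H (evS n psi) !mulrDr addrACA; congr (_ + _).
  by rewrite -[ev 0 _]/(sk (phi [::])) !(skCA X) !(skCA Y).
rewrite !mulr_sumr -big_split /=; apply: eq_bigr => k _.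
by rewrite (skCA X) (skCA Y) mulrDl mulrDr !mulrA.
Qed.

Lemma ev_cup n f g : ev n (fun s => co m1 ((f * g) s)) =
  \sum_(k < n.+1) (-1) ^+ (k * (n - k)) *
     (ev k (fun s => co m1 (f s)) * ev (n - k) (fun s => co m1 (g s))).
Proof.
rewrite (ev_ext (psi := fun s => sum2 (fun u v => (-1) ^+ (size u * size v) *
   (co m1 (f u) * co m1 (g v))) s)); last by move=> s _; exact: co1_cup.
rewrite (ev_conv n (fun i j => (-1) ^+ (i * j))); apply: eq_bigr => k _.
by rewrite sksign.
Qed.

Lemma el_aa : el ma * el ma = 0.
Proof. by apply: (@co_inj _ _ B); case; rewrite co_mul /= !co_el co0 /=; ring. Qed.
Lemma el_bb : el mb * el mb = 0.
Proof. by apply: (@co_inj _ _ B); case; rewrite co_mul /= !co_el co0 /=; ring. Qed.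
Lemma el_ac : el ma * el mc = 0.
Proof. by apply: (@co_inj _ _ B); case; rewrite co_mul /= !co_el co0 /=; ring. Qed.
Lemma el_ba : el mb * el ma = el ma * el mb.
Proof. by apply: (@co_inj _ _ B); case; rewrite !co_mul /= !co_el /=; ring. Qed.

Lemma mlin_head0 (f : seq A -> A) s : multilinear f -> f (0 :: s) = 0.
Proof. by move=> fL; apply: (mlin0 fL [::]). Qed.

Lemma multilinear_cons (f : seq A -> A) x : multilinear f ->
  multilinear (fun s => f (x :: s)).
Proof. by move=> fL u w k y z; rewrite -!cat_cons fL. Qed.

(** Merging two neighbouring letters gives a^2 = b^2 = 0, or ab and ba; the last two are equal but
    are weighted by XY and YX = -XY. The merge in first position cancels this way, and the others
    are handled by induction on [n]. *)
Lemma ev_hinner i n (f : seq A -> A) : multilinear f ->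
  ev n (fun s => co i (hinner f s)) = 0.
Proof.
move=> fL; case: n => [|n]; first by rewrite /= /hoch_delta /hinner /= ?co0 sk0.
elim: n f fL => [|n IHn] f fL.
  by rewrite /= !hinner1 co0 sk0 !mulr0 addr0.
have H x : ev n.+1 (fun s => co i (hinner f (x :: s))) =
   X * (sk ((-1) ^+ n.+1) * ev n (fun t => co i (f (x * el ma :: t)))) +
   Y * (sk ((-1) ^+ n.+1) * ev n (fun t => co i (f (x * el mb :: t)))).
  rewrite -[RHS]addr0 -(IHn _ (multilinear_cons x fL)) !evS addrACA -!mulrDr -!evZ -!evD.
  by congr (_ * _ + _ * _); apply: ev_ext => s ns; rewrite hinner_cons coD coZ ns.
rewrite evS !H el_aa el_bb el_ba.
have -> : ev n (fun t => co i (f (0 :: t))) = 0.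
  by apply: ev_eq0 => s _; rewrite mlin_head0 // co0.
by rewrite !mulr0 add0r addr0 !mulrA sy_sx !mulNr subrr.
Qed.

Lemma ev_delta i n f : ev n.+1 (fun s => co i (hoch_delta f s)) =
  (-1) ^+ n.+1 * (X * ev n (fun s => co i (el ma * f s)) +
                  Y * ev n (fun s => co i (el mb * f s)))
  + (ev n (fun s => co i (f s * el ma)) * X + ev n (fun s => co i (f s * el mb)) * Y).
Proof.
pose L s : K := if s is a :: t then (-1) ^+ (size t).+1 * co i (a * f t) else 0.
pose R s : K := if s is a :: t then co i (f (belast a t) * last a t) else 0.
have -> : ev n.+1 (fun s => co i (hoch_delta f s)) =
    ev n.+1 L + ev n.+1 R + ev n.+1 (fun s => co i (hinner f s)).
  rewrite -!evD; apply: ev_ext => -[//|a t] _.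
  by rewrite hoch_delta_cons !coD coZ addrAC.
rewrite ev_hinner ?addr0; last exact: cochainL.
congr (_ + _).
  rewrite evS mulrDr -sksign -(skCA X) -(skCA Y) -!evZ.
  by congr (_ * _ + _ * _); apply: ev_ext => s ns; rewrite /L ns.
by rewrite ev_rcons; congr (_ * _ + _ * _); apply: ev_ext => s _;
  case: s => //= a t; rewrite belast_rcons last_rcons.
Qed.

(** By [ev_delta] only the outer terms of the differential remain, and [co m1] is multiplicative and
    vanishes at a and b. *)
Lemma ev_coboundary1 n f : coboundary1 B f -> ev n (fun s => co m1 (f s)) = 0.
Proof.
move=> [h fh]; rewrite (ev_ext (psi := fun s => co m1 (hoch_delta h s))) //.
case: n => [|n]; first by rewrite /= /hoch_delta /hinner /= ?co0 sk0.
have z l : l = ma \/ l = mb -> forall x, co m1 (el l * x) = 0 /\ co m1 (x * el l) = 0.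
  by move=> Hl x; rewrite !co1M co_el; case: Hl => ->; rewrite /= mul0r mulr0.
have [za zb] := (z ma (or_introl erefl), z mb (or_intror erefl)).
rewrite ev_delta !ev_eq0 ?mulr0 ?mul0r ?addr0 ?mulr0 // => s _;
  by rewrite ?(proj1 (za _)) ?(proj2 (za _)) ?(proj1 (zb _)) ?(proj2 (zb _)).
Qed.

(** Every word is sorted into x^i y^(n-i) up to sign; only a^n contributes to x^n, which gives the
    second claim. *)
Lemma ev_span n phi : exists g : nat -> K,
  ev n phi = skew_form S n g /\ g n = phi (nseq n (el ma)).
Proof.
elim: n phi => [|n IHn] phi.
  exists (fun=> phi [::]); split=> //.
  by rewrite /skew_form big_ord1 /= !mulr1.
have [g [Eg gn]] := IHn (fun s => phi (el ma :: s)).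
have [h [Eh _]] := IHn (fun s => phi (el mb :: s)).
exists (fun i => (if i is i'.+1 then g i' else 0) +
                 (if (i <= n)%N then (-1) ^+ i * h i else 0)).
by rewrite evS Eg Eh skew_form_cons ltnn addr0 gn.
Qed.

End Words.

(** * Cohomology with coefficients in the simple module at vertex 1 *)

Section Cohomology.
Variables (K : fieldType) (A : algType K) (B : xs_coords A) (S : skew_ring K).
Implicit Types (f g h : cochain A) (s t u v w : seq A) (x y z : A).

Local Notation co := (co B).
Local Notation el := (el B).
Local Notation sk := (@sk K S).
Local Notation X := (sx S).
Local Notation Y := (sy S).
Local Notation Da := (Da B).
Local Notation Db := (Db B).
Local Notation Tc := (Tc B).
Local Notation cocycle1 := (cocycle1 B).
Local Notation coboundary1 := (coboundary1 B).

Definition evc f n : S := ev B S n (fun s => co m1 (f s)).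

Lemma evcE f n : evc f n = ev B S n (fun s => co m1 (f s)).
Proof. by []. Qed.
Lemma evcD f g n : evc (f + g) n = evc f n + evc g n.
Proof. by rewrite /evc -evD; apply: ev_ext => s _; rewrite cochainD coD. Qed.
Lemma evcZ k f n : evc (k *: f) n = sk k * evc f n.
Proof. by rewrite /evc -evZ; apply: ev_ext => s _; rewrite cochainZ coZ. Qed.
Lemma evcN f n : evc (- f) n = - evc f n.
Proof. by rewrite /evc -evN; apply: ev_ext => s _; rewrite cochainN coN. Qed.
Lemma evcB f g n : evc (f - g) n = evc f n - evc g n.
Proof. by rewrite evcD evcN. Qed.
Lemma evc0 n : evc 0 n = 0.
Proof. by have := evcZ 0 0 n; rewrite scale0r sk0 mul0r. Qed.
Lemma evc_coboundary1 f n : coboundary1 f -> evc f n = 0.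
Proof. exact: ev_coboundary1. Qed.

Lemma mul_lin1_rcons f (g : A -> A)
    (gL : forall k x y, g (k *: x + y) = k *: g x + g y) s z :
  (f * lin1 gL) (rcons s z) = (-1) ^+ size s *: (f s * g z).
Proof.
rewrite -[LHS]/(hoch_cup f (lin1_fun g) (rcons s z)) /hoch_cup -cats1 sum2_cat sum2_nil /=.
rewrite mulr0 scaler0 addr0.
elim/last_ind: s => [|s y _]; first by rewrite sum2_nil.
rewrite -[in sum2 _ _]cats1 sum2_cat sum2_nil /= cats1 muln1 -[RHS]add0r; congr (_ + _).
rewrite -[RHS](sum2_0 A s); apply: eq_sum2 => u v _.
by case: v => [|? [|? ?]]; rewrite /= mulr0 scaler0.
Qed.

Lemma mul_lin1_nil f (g : A -> A)
    (gL : forall k x y, g (k *: x + y) = k *: g x + g y) :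
  (f * lin1 gL) [::] = 0.
Proof. by rewrite -[LHS]/(hoch_cup _ _ _) /hoch_cup sum2_nil /= mulr0 scaler0. Qed.

Lemma evc_mulDa f n : evc (f * Da) n.+1 = (-1) ^+ n * (evc f n * X).
Proof.
rewrite /evc ev_rcons -sksign [sk _ * _]mulrA -evZ -[RHS]addr0; congr (_ * _ + _).
  by apply: ev_ext => s <-; rewrite mul_lin1_rcons coZ co1M co_Da co_el mulr1.
rewrite ev_eq0 ?mul0r // => s _.
by rewrite mul_lin1_rcons coZ co1M co_Da co_el !mulr0.
Qed.
Lemma evc_mulDb f n : evc (f * Db) n.+1 = (-1) ^+ n * (evc f n * Y).
Proof.
rewrite /evc ev_rcons -sksign [sk _ * _]mulrA -evZ -[RHS]add0r; congr (_ + _ * _).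
  rewrite ev_eq0 ?mul0r // => s _.
  by rewrite mul_lin1_rcons coZ co1M co_Db co_el !mulr0.
by apply: ev_ext => s <-; rewrite mul_lin1_rcons coZ co1M co_Db co_el mulr1.
Qed.
Lemma evc_mulDa0 f : evc (f * Da) 0 = 0.
Proof. by rewrite /evc /ev mul_lin1_nil co0 sk0. Qed.
Lemma evc_mulDb0 f : evc (f * Db) 0 = 0.
Proof. by rewrite /evc /ev mul_lin1_nil co0 sk0. Qed.

Definition mono1 (c : {poly K}) : cochain A := horner_alg Da c.
(** Substitutes [Da] for the inner variable and [Db] for the outer one, with the powers of [Da] on
    the left, as the two cochains do not commute. *)
Definition mono (p : {poly {poly K}}) : cochain A := (map_poly mono1 p).[Db].

Lemma mono1_MXaddC c k : mono1 (c * 'X + k%:P) = mono1 c * Da + k *: 1.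
Proof. by rewrite /mono1 rmorphD rmorphM /= horner_algX horner_algC. Qed.
Lemma mono0 : mono 0 = 0.
Proof. by rewrite /mono /mono1 raddf0 horner0. Qed.
Lemma monoD p q : mono (p + q) = mono p + mono q.
Proof. by rewrite /mono /mono1 raddfD hornerD. Qed.
Lemma monoN p : mono (- p) = - mono p.
Proof. by rewrite /mono /mono1 raddfN hornerN. Qed.
Lemma mono_MXaddC p c : mono (p * 'X + c%:P) = mono p * Db + mono1 c.
Proof.
by rewrite /mono /mono1 rmorphD rmorphM /= map_polyX map_polyC hornerD hornerMX hornerC.
Qed.
Lemma monoMX p : mono (p * 'X) = mono p * Db.
Proof. by have := mono_MXaddC p 0; rewrite polyC0 addr0 /mono1 raddf0 addr0. Qed.
Lemma monoC c : mono c%:P = mono1 c.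
Proof. by have := mono_MXaddC 0 c; rewrite mul0r add0r mono0 mul0r add0r. Qed.

Lemma cocycle1_mono1 c : cocycle1 (mono1 c).
Proof.
elim/poly_ind: c => [|c k IH]; first by rewrite /mono1 raddf0; exact: cocycle10.
rewrite mono1_MXaddC; apply: cocycle1D; first by apply: cocycle1M => //; exact: cocycle1_Da.
by apply/cocycle1Z/cocycle11.
Qed.
Lemma cocycle1_mono p : cocycle1 (mono p).
Proof.
elim/poly_ind: p => [|p c IH]; first by rewrite mono0; exact: cocycle10.
rewrite mono_MXaddC; apply: cocycle1D; last exact: cocycle1_mono1.
by apply: cocycle1M => //; exact: cocycle1_Db.
Qed.

Lemma evc1 n : evc 1 n = if n is 0%N then 1 else 0.
Proof.
case: n => [|n]; first by rewrite /evc /= /hoch_one /= co_one sk1.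
rewrite /evc ev_eq0 // => -[//|x s] _.
by rewrite -[(1 : cochain A) _]/(hoch_one _) /hoch_one /= co0.
Qed.

Lemma evc_mono1 c n : evc (mono1 c) n = (-1) ^+ 'C(n, 2) * (sk c`_n * X ^+ n).
Proof.
elim/poly_ind: c n => [|c k IH] n.
  by rewrite /mono1 raddf0 evc0 coef0 sk0 mul0r mulr0.
rewrite mono1_MXaddC evcD evcZ evc1 coefD coefMX coefC.
case: n => [|n] /=.
  by rewrite evc_mulDa0 !add0r !expr0 mul1r.
rewrite mulr0 addr0 addr0 evc_mulDa IH binS bin1 addnC exprD -!mulrA.
by rewrite -exprSr.
Qed.

(** [rho] need not be injective on [S], but it is on homogeneous forms, and the values of [evc] are
    such forms. *)
Lemma rho_evc_eq0 f n : rho (evc f n) = 0 -> evc f n = 0.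
Proof.
rewrite /evc; have [g [-> _]] := ev_span B S n (fun s => co m1 (f s)) => r0.
rewrite /skew_form big1 // => i _.
have := coef_skew_form S g (leq_ord i); rewrite r0 !coef0 => <-.
by rewrite sk0 mul0r.
Qed.

Lemma evc_mono_inj p : (forall n, evc (mono p) n = 0) -> p = 0.
Proof.
elim/poly_ind: p => [//|p c IH] H.
have H' n : (rho (evc (mono p * Db) n))`_0 = 0 /\ (n != 0 -> 
   rho (evc (mono p * Db) n) = (-1) ^+ n.-1 * ('X * rho (evc (mono p) n.-1))).
  case: n => [|n]; first by rewrite evc_mulDb0 rho0 coef0.
  have E : rho (evc (mono p * Db) n.+1) = (-1) ^+ n * ('X * rho (evc (mono p) n)).
    rewrite evc_mulDb -sksign rho_sk -rho_sy.
    by rewrite !rmorphXn /= !rmorphN1.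
  by split=> //; rewrite E mulrCA coefXM.
(* [mono p * Db] only contributes multiples of the outer variable, so the constant coefficient in
   that variable sees [mono1 c] alone. *)
have c0 : c = 0.
  apply/polyP => n; rewrite coef0.
  have := H n; rewrite mono_MXaddC evcD evc_mono1 => /(congr1 (@rho K S)).
  rewrite rhoD rho0 => /(congr1 (fun q : {poly {poly K}} => q`_0)).
  have rX k : rho (sk k * X ^+ n) = (k%:P * 'X^n)%:P.
    by have := rho_mono S k n 0; rewrite !expr0 !mulr1.
  rewrite coefD (proj1 (H' n)) add0r coef0 -sksign mulrA -skM rX coefC eqxx.
  move=> /(congr1 (fun q : {poly K} => q`_n)).
  rewrite coefCM coefXn eqxx mulr1 coef0 => /eqP.
  by rewrite mulf_eq0 expf_eq0 oppr_eq0 oner_eq0 andbF /= => /eqP.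
rewrite c0 IH ?mul0r ?add0r // => n.
apply: rho_evc_eq0; have := proj2 (H' n.+1) isT; have := H n.+1.
rewrite c0 addr0 monoMX => ->; rewrite rho0 /= => /esym/eqP.
by rewrite !mulf_eq0 expf_eq0 oppr_eq0 oner_eq0 andbF polyX_eq0 /= => /eqP.
Qed.

Lemma mono_mulDa p : exists q, coboundary1 (mono p * Da - mono q).
Proof.
elim/poly_ind: p => [|p c [q Hq]].
  by exists 0; rewrite mono0 mul0r subr0; apply: coboundary10 => s; rewrite co0.
(* Modulo coboundaries, [Da] moves to the left of [Db] at the cost of a sign. *)
exists (- q * 'X + (c * 'X)%:P).
have E : mono1 (c * 'X) = mono1 c * Da.
  by have := mono1_MXaddC c 0; rewrite scale0r polyC0 !addr0.
have H := coboundary1_Ml (cocycle1_mono p) (coboundary1_DaDb B).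
have H' := coboundary1_Mr Hq (cocycle1_Db B).
apply: coboundary1_ext (coboundary1B H H') => s.
rewrite !mono_MXaddC E monoN mulNr !mulrBl !mulrDl !mulrDr !mulrA.
by rewrite !(cochainD, cochainN, coD, coN); ring.
Qed.

Lemma rcons_lin f s k x y :
  f (rcons s (k *: x + y)) = k *: f (rcons s x) + f (rcons s y).
Proof. by rewrite -!cats1 cochainL. Qed.
Lemma rconsZ f s k x : f (rcons s (k *: x)) = k *: f (rcons s x).
Proof. by rewrite -!cats1 (mlinZ (cochainL f)). Qed.

Section Step.
Variable f : cochain A.
Hypothesis fZ : cocycle1 f.

(** The sign cancels the one of the cup product with a 1-cochain: [rsgn z * Da] takes the value [f
    (rcons s z) * Da [:: y]] at [rcons s y]. *)
Definition rsgn z := cochain_sgn (rins f z).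

Lemma cocycle1_rcons s y z : co m1 (hoch_delta (rins f z) (rcons s y)) =
  co m1 (f (rcons s z)) * co m1 y - co m1 (f (rcons s (y * z)))
  + co m1 (f (rcons s y)) * co m1 z.
Proof.
have := fZ (rcons (rcons s y) z); rewrite hoch_delta_rcons !(coD, coN, co1M) => E.
by apply/esym/subr0_eq; rewrite -[RHS]E; ring.
Qed.

(** Inserting e_1 as last argument is a partial contracting homotopy. What it leaves is [f] with its
    last argument y replaced by the part of y e_1 in the span of a, b and ab. *)
Lemma cocycle1_decomp :
  coboundary1 (f - ((co m1 (f [::])) *: 1 + rsgn (el ma) * Da + rsgn (el mb) * Db
           + rsgn (el mab) * Tc)).
Proof.
exists (rins f (el m1)); elim/last_ind => [|s y _].
  rewrite !(cochainD, cochainN, cochainZ) !mul_lin1_nil !addr0 /hoch_delta /=.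
  by rewrite /hoch_one /= coB coZ co_one mulr1 subrr co0.
rewrite cocycle1_rcons co_el mulr1.
have -> : y * el m1 = co m1 y *: el m1 + (co ma y *: el ma + (co mb y *: el mb +
    co mab y *: el mab)).
  by apply: (@co_inj _ _ B); case; rewrite co_mul /= !(coD, coZ) !co_el /=; ring.
rewrite !rcons_lin rconsZ !(cochainD, cochainN, cochainZ) !mul_lin1_rcons /= /hsgn /=.
have -> : (hoch_one (rcons s y) : A) = 0 by rewrite /hoch_one; case: s.
rewrite !(coD, coN, coZ, co1M, co_Da, co_Db, co_T, co0) /=.
have := sqrr_sign K (size s); rewrite expr2; move: ((-1) ^+ size s) => e ee.
ring: ee.
Qed.

Lemma cocycle1_rab : cocycle1 (rins f (el mab)).
Proof.
elim/last_ind => [|s y _]; first by rewrite /hoch_delta co0.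
rewrite cocycle1_rcons; have -> : y * el mab = co m1 y *: el mab.
  by apply: (@co_inj _ _ B); case; rewrite co_mul /= !(coD, coZ) !co_el /=; ring.
by rewrite rconsZ coZ co_el mulr0 addr0 mulrC subrr.
Qed.

Lemma delta_ra s : co m1 (hoch_delta (rsgn (el ma)) s) = - co m1 ((rins f (el mab) * Db) s).
Proof.
elim/last_ind: s => [|s y _].
  by rewrite mul_lin1_nil /hoch_delta co0 oppr0.
rewrite mul_lin1_rcons hoch_delta_hsgn coZ cocycle1_rcons.
have -> : y * el ma = co m1 y *: el ma + co mb y *: el mab.
  by apply: (@co_inj _ _ B); case; rewrite co_mul /= !(coD, coZ) !co_el /=; ring.
rewrite rcons_lin rconsZ !(coD, coZ, co1M, co_Db) co_el size_rcons /=.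
by rewrite !exprS; ring.
Qed.

Lemma delta_rb s : co m1 (hoch_delta (rsgn (el mb)) s) = - co m1 ((rins f (el mab) * Da) s).
Proof.
elim/last_ind: s => [|s y _].
  by rewrite mul_lin1_nil /hoch_delta co0 oppr0.
rewrite mul_lin1_rcons hoch_delta_hsgn coZ cocycle1_rcons.
have -> : y * el mb = co m1 y *: el mb + co ma y *: el mab.
  by apply: (@co_inj _ _ B); case; rewrite co_mul /= !(coD, coZ) !co_el /=; ring.
rewrite rcons_lin rconsZ !(coD, coZ, co1M, co_Da) co_el size_rcons /=.
by rewrite !exprS; ring.
Qed.

End Step.

Lemma coboundary1_trunc f n : (forall s, (n <= size s)%N -> f s = 0) -> coboundary1 f ->
  exists2 h : cochain A, (forall s, co m1 (f s) = co m1 (hoch_delta h s)) &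
    (forall s, (n <= (size s).+1)%N -> h s = 0).
Proof.
move=> fn [h fh]; exists (trunc (fun k => k.+1 < n)%N h); last first.
  by move=> s ns /=; rewrite ltnNge ns.
move=> s; rewrite hoch_delta_trunc; case: s => [|x s] /=.
  by rewrite fh /hoch_delta co0 if_same co0.
case: ifP => [_|/negbT]; first exact: fh.
by rewrite -leqNgt => ns; rewrite fn.
Qed.

(* Induction on the degree, splitting f = f_a Da + f_b Db + f_ab Tc up to a   *)
(* scalar and a coboundary according to the last argument.  Here f_ab is a    *)
(* cocycle and f_ab Db, f_ab Da are the coboundaries of -f_a, -f_b; since     *)
(* multiplication by Db is injective on cohomology, f_ab = delta e, and       *)
(* f_a + e Db and f_b + e Da are cocycles.                                    *)
Lemma cocycle1_span n f : (forall s, (n <= size s)%N -> f s = 0) -> cocycle1 f ->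
  exists p, coboundary1 (f - mono p).
Proof.
elim: n f => [|n IHn] f fn fZ.
  by exists 0; apply: coboundary10 => s; rewrite mono0 subr0 fn // co0.
pose fab := rins f (el mab).
have fabn s : (n <= size s)%N -> fab s = 0 by move=> ns; rewrite /= fn // size_rcons.
have [p0 Hp0] := IHn fab fabn (cocycle1_rab fZ).
have fabB : coboundary1 fab.
  suff p00 : p0 = 0 by move: Hp0; rewrite p00 mono0 subr0.
  apply: evc_mono_inj => m.
  have H1 : coboundary1 (fab * Db).
    exists (- rsgn f (el ma)) => s; rewrite hoch_deltaN coN delta_ra // opprK //.
  have := evc_coboundary1 m.+1 (coboundary1B H1 (coboundary1_Mr Hp0 (cocycle1_Db B))).
  rewrite mulrBl opprB addrC subrK evc_mulDb => /(congr1 (@rho K S)) /eqP.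
  rewrite -sksign rho_sk rho_sy rho0 !mulf_eq0 !polyC_eq0 expf_eq0 oppr_eq0 oner_eq0.
  by rewrite andbF polyX_eq0 /= => /eqP; apply: rho_evc_eq0.
have [e fe en] := coboundary1_trunc fabn fabB.
pose f1 := rsgn f (el ma) + e * Db.
pose f2 := rsgn f (el mb) + e * Da.
have bnd z (g : A -> A) (gL : forall k x y, g (k *: x + y) = k *: g x + g y) s :
    (n <= size s)%N -> (rsgn f z + e * lin1 gL) s = 0.
  move=> ns; rewrite cochainD /= /hsgn fn ?size_rcons // scaler0 add0r.
  rewrite -[LHS]/((e * lin1 gL) s).
  elim/last_ind: s ns => [|s y _]; first by rewrite mul_lin1_nil.
  by rewrite size_rcons => /en E; rewrite mul_lin1_rcons E mul0r scaler0.
have de (g : cochain A) s : cocycle1 g ->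
    co m1 (hoch_delta (e * g) s) = co m1 ((fab * g) s).
  move=> gZ; rewrite hoch_delta_mul coD (co1_cup0r _ s gZ) addr0 !co1_hoch_cup.
  by apply: eq_sum2 => u v _; rewrite -fe.
have f1Z : cocycle1 f1.
  move=> s; rewrite hoch_deltaD coD delta_ra // de; last exact: cocycle1_Db.
  by rewrite addNr.
have f2Z : cocycle1 f2.
  move=> s; rewrite hoch_deltaD coD delta_rb // de; last exact: cocycle1_Da.
  by rewrite addNr.
have [p1 H1] := IHn f1 (bnd _ _ _) f1Z.
have [p2 H2] := IHn f2 (bnd _ _ _) f2Z.
have [p1' H1'] := mono_mulDa p1.
(* Leibniz rule for e Tc: at e_1, [fab] is the differential of e, and that of Tc is Da Db + Db
   Da. *)
have H3 : coboundary1 (e * (Da * Db + Db * Da) - rsgn f (el mab) * Tc).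
  exists (cochain_sgn e * Tc) => s; rewrite hoch_delta_mul coD cochainD cochainN coD coN.
  rewrite addrC; congr (_ + _); rewrite co1_cup co1_hoch_cup.
    rewrite -sum2N; apply: eq_sum2 => u v _; rewrite hoch_delta_hsgn [in RHS]coZ -fe.
    by rewrite /= /hsgn coZ exprS; ring.
  apply: eq_sum2 => u v _; congr (_ * (_ * _)).
    by rewrite /= /hsgn !coZ mulrA -expr2 sqrr_sign mul1r.
  rewrite cochainD /= !lin1_mul hoch_delta_lin1.
  case: v => [|x [|y []]]; rewrite ?addr0 //.
  by rewrite !(coD, coN, co1M, co_Da, co_Db, co_T) co_mul /=; ring.
(* With f_a = f1 - e Db and f_b = f2 - e Da, the decomposition becomes a scalar plus f1 Da + f2 Db,
   and the remaining terms are those of [H3]. *)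
exists ((co m1 (f [::]))%:P%:P + p1' + p2 * 'X).
have H4 := coboundary1D (coboundary1D (cocycle1_decomp fZ) (coboundary1_Mr H1 (cocycle1_Da B)))
  (coboundary1B (coboundary1D (coboundary1_Mr H2 (cocycle1_Db B)) H1') H3).
apply: coboundary1_ext H4 => s; rewrite !monoD monoMX monoC.
have -> : mono1 (co m1 (f [::]))%:P = (co m1 (f [::])) *: 1.
  by rewrite /mono1 horner_algC.
rewrite /f1 /f2 !mulrBl !mulrDl !mulrDr !mulrA.
by rewrite !(cochainD, cochainN, coD, coN); ring.
Qed.

Lemma cocycle1_ker f : cocycle1 f -> (forall n, evc f n = 0) -> coboundary1 f.
Proof.
move=> fZ f0; have [n fn] := cochainB f; have [p Hp] := cocycle1_span fn fZ.
suff p0 : p = 0 by move: Hp; rewrite p0 mono0 subr0.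
apply: evc_mono_inj => m.
by have := evc_coboundary1 m Hp; rewrite evcB f0 sub0r => /eqP; rewrite oppr_eq0 => /eqP.
Qed.

End Cohomology.

(** * The image of Hochschild cocycles in the skew ring *)

Section Cocycles.
Variables (K : fieldType) (A : algType K) (B : xs_coords A) (S : skew_ring K).
Implicit Types (f g h : cochain A) (s t u v w : seq A) (x y z : A).

Local Notation co := (co B).
Local Notation el := (el B).
Local Notation sk := (@sk K S).
Local Notation X := (sx S).
Local Notation Y := (sy S).
Local Notation Da := (Da B).
Local Notation Db := (Db B).
Local Notation Th := (Th B).
Local Notation evc := (evc B S).
Local Notation cocyc f := (forall s, hoch_delta f s = 0).

(** This says that (-1)^i = 1 in [K]. *)
Definition signless (i : nat) : bool := ((2 : K) == 0) || ~~ odd i.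

Lemma signlessE i : signless i = ((2 : K) == 0) || ~~ odd i.
Proof. by []. Qed.

Lemma signless_sign i n : signless i -> (-1) ^+ (i * n) = 1 :> S.
Proof.
move=> gi; rewrite -sksign -(sk1 S); congr sk.
case/orP: gi => [/eqP two0|ei].
  suff -> : (-1 : K) = 1 by rewrite expr1n.
  by apply/eqP; rewrite -subr_eq0 -opprD -[1 + 1]/(2 : K) two0 oppr0.
by rewrite -signr_odd oddM (negPf ei).
Qed.

Lemma skew_formZ c n (g : nat -> K) :
  sk c * skew_form S n g = skew_form S n (fun i => c * g i).
Proof.
by rewrite /skew_form mulr_sumr; apply: eq_bigr => i _; rewrite skM mulrA.
Qed.

Lemma skew_form_X n (g : nat -> K) :
  skew_form S n g * X = X * skew_form S n (fun i => (-1) ^+ (n - i) * g i).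
Proof.
rewrite /skew_form mulr_suml mulr_sumr; apply: eq_bigr => i _.
rewrite -!mulrA (skCA X) [(-1) ^+ _ * _]mulrC skM sksign -mulrA; congr (_ * _).
have := sxy_comm S 1 (n - i); rewrite expr1 mul1n => ->.
by rewrite [LHS]mulrA signC -mulrA; congr (_ * _); rewrite !mulrA -exprS -exprSr.
Qed.

Lemma skew_form_Y n (g : nat -> K) :
  Y * skew_form S n g = skew_form S n (fun i => (-1) ^+ i * g i) * Y.
Proof.
rewrite /skew_form mulr_suml mulr_sumr; apply: eq_bigr => i _.
rewrite (skCA Y) mulrC skM sksign -!mulrA; congr (_ * _).
have := sxy_comm S i 1; rewrite expr1 muln1 => E.
by rewrite mulrA E -!mulrA -exprS -exprSr.
Qed.

Lemma skew_form_inj n (g g' : nat -> K) :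
  rho (skew_form S n g) = rho (skew_form S n g') ->
  forall i, (i <= n)%N -> g i = g' i.
Proof.
by move=> E i ni; rewrite -(coef_skew_form S g ni) -(coef_skew_form S g' ni) E.
Qed.

Lemma signless_neg (c : K) i : c = (-1) ^+ i * c -> c != 0 -> signless i.
Proof.
move=> E c0; rewrite /signless; case oi: (odd i); rewrite ?orbT // orbF.
move: E; rewrite -signr_odd oi expr1 mulN1r => /eqP; rewrite -subr_eq0 opprK.
have -> : c + c = 2 * c by ring.
by rewrite mulf_eq0 (negPf c0) orbF.
Qed.

Section OneCocycle.
Variable z : cochain A.
Hypothesis zZ : cocyc z.

(** The a-coordinate of the cocycle equation: left and right multiplication by a move the
    e_1-coordinate to a, and those by b do not reach it. *)
Lemma evc_commX n : X * evc z n = (-1) ^+ n * (evc z n * X).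
Proof.
have := ev_delta B S ma n z; rewrite ev_eq0 => [|s _]; last by rewrite zZ co0.
rewrite [W in _ = _ * (_ + Y * W) + _]ev_eq0 => [|s _]; last first.
  by rewrite co_mul /= !co_el /=; ring.
rewrite [W in _ = _ + (_ + W * Y)]ev_eq0 => [|s _]; last first.
  by rewrite co_mul /= !co_el /=; ring.
have -> : ev B S n (fun s => co ma (el ma * z s)) = evc z n.
  by apply: ev_ext => s _; rewrite co_mul /= !co_el /=; ring.
have -> : ev B S n (fun s => co ma (z s * el ma)) = evc z n.
  by apply: ev_ext => s _; rewrite co_mul /= !co_el /=; ring.
rewrite mulr0 mul0r !addr0 exprS mulN1r mulNr => /esym/eqP.
rewrite addrC subr_eq0 => /eqP ->.
by rewrite mulrA -signr_odd; case: odd; rewrite ?mulrNN mulr1 mul1r.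
Qed.

Lemma evc_commY n : Y * evc z n = (-1) ^+ n * (evc z n * Y).
Proof.
have := ev_delta B S mb n z; rewrite ev_eq0 => [|s _]; last by rewrite zZ co0.
rewrite [W in _ = _ * (X * W + _) + _]ev_eq0 => [|s _]; last first.
  by rewrite co_mul /= !co_el /=; ring.
rewrite [W in _ = _ + (W * X + _)]ev_eq0 => [|s _]; last first.
  by rewrite co_mul /= !co_el /=; ring.
have -> : ev B S n (fun s => co mb (el mb * z s)) = evc z n.
  by apply: ev_ext => s _; rewrite co_mul /= !co_el /=; ring.
have -> : ev B S n (fun s => co mb (z s * el mb)) = evc z n.
  by apply: ev_ext => s _; rewrite co_mul /= !co_el /=; ring.
rewrite mulr0 mul0r !add0r exprS mulN1r mulNr => /esym/eqP.
rewrite addrC subr_eq0 => /eqP ->.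
by rewrite mulrA -signr_odd; case: odd; rewrite ?mulrNN mulr1 mul1r.
Qed.

(** Evaluate the cocycle equation at (a, ..., a, c): all inner products are a^2 or ac, hence zero,
    and the c-coordinate retains only z(a, ..., a) c. *)
Lemma cocycle_pure_a n : co m1 (z (nseq n.+1 (el ma))) = 0.
Proof.
have H m (f : seq A -> A) : multilinear f -> hinner f (rcons (nseq m (el ma)) (el mc)) = 0.
  elim: m f => [|[|m] IH] f fL; first exact: hinner1.
    by rewrite hinner_cons hinner1 el_ac mlin_head0 // scaler0 addr0.
  rewrite hinner_cons -[el ma :: rcons _ _]/(rcons (nseq m.+1 (el ma)) (el mc)) IH.
    by rewrite el_aa mlin_head0 // scaler0 addr0.
  exact: multilinear_cons.
have := zZ (rcons (nseq n.+1 (el ma)) (el mc)).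
rewrite -[rcons _ _]/(el ma :: rcons (nseq n (el ma)) (el mc)) hoch_delta_cons.
rewrite -[el ma :: _]/(rcons (nseq n.+1 (el ma)) (el mc)) H; last exact: cochainL.
rewrite belast_rcons last_rcons addr0 => /(congr1 (co mc)).
by rewrite coD coZ !co_mul /= !co_el co0 /= => <-; ring.
Qed.

(** Comparing coefficients in the commutation with x gives (-1)^i = 1 wherever [g i] is nonzero; y
    gives the same for n - i. *)
Lemma cocycle_form n : exists g : nat -> K, [/\ evc z n = skew_form S n g,
   forall i, (i <= n)%N -> g i != 0 -> signless i && signless (n - i) &
   (0 < n)%N -> g n = 0].
Proof.
have [g [Eg gn]] := ev_span B S n (fun s => co m1 (z s)).
have Ez : evc z n = skew_form S n g by [].
exists g; split=> //; last by case: n gn {Eg Ez} => // n -> _; apply: cocycle_pure_a.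
have cancelX (p q : {poly {poly K}}) : 'X%:P * p = 'X%:P * q -> p = q.
  by apply: mulfI; rewrite polyC_eq0 polyX_eq0.
have cancelY (p q : {poly {poly K}}) : 'X * p = 'X * q -> p = q.
  by apply: mulfI; rewrite polyX_eq0.
have sgn2 m (c : K) : (-1) ^+ m * ((-1) ^+ m * c) = c.
  by rewrite mulrA -expr2 sqrr_sign mul1r.
move=> i ni gi0; apply/andP; split.
  apply: (signless_neg (c := g i)) => //.
  have := evc_commX n; rewrite Ez skew_form_X -sksign -(skCA X) skew_formZ.
  move=> /(congr1 (@rho K S)); rewrite !rho_sx => /cancelX/skew_form_inj/(_ i ni) {1}->.
  by rewrite mulrA -exprD -[in LHS]signr_odd -[in RHS]signr_odd oddD oddB //; case: odd; case: odd.
apply: (signless_neg (c := g i)) => //.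
have := evc_commY n; rewrite Ez skew_form_Y -sksign mulrA skew_formZ.
move=> /(congr1 (@rho K S)); rewrite !rho_sy => /cancelY/skew_form_inj/(_ i ni) E.
rewrite -[LHS](sgn2 i) E mulrA -exprD -[in LHS]signr_odd -[in RHS]signr_odd oddD oddB //.
by case: odd; case: odd.
Qed.

(** If some coefficient is nonzero, then i and n - i, hence n, are [signless], and the sign in
    [evc_commY] disappears. *)
Lemma evc_symY n : evc z n * Y = Y * evc z n.
Proof.
have [g [Eg gg _]] := cocycle_form n.
have [gn|bn] := boolP (signless n).
  by rewrite evc_commY -[n in (-1) ^+ n]muln1 signless_sign // mul1r.
suff -> : evc z n = 0 by rewrite mul0r mulr0.
rewrite Eg /skew_form big1 // => i _.
have [->|gi] := eqVneq (g i) 0; first by rewrite sk0 mul0r.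
have /andP[g1 g2] := gg i (leq_ord i) gi; case/negP: bn.
move: g1 g2; rewrite /signless; case: (_ == _) => //=.
by rewrite oddB ?leq_ord //; case: odd; case: odd.
Qed.

(** [rho] is not multiplicative in general, because of the signs; if t commutes with y then x^i y^j
    t = x^i t y^j and no sign arises. *)
Lemma rho_evc_mul n (t : S) : t * Y = Y * t -> rho (evc z n * t) = rho (evc z n) * rho t.
Proof.
move=> tY; have [g [-> _ _]] := cocycle_form n.
have tYn j : Y ^+ j * t = t * Y ^+ j.
  by elim: j => [|j IH]; rewrite ?mul1r ?mulr1 // exprSr -mulrA -tY mulrA IH mulrA.
rewrite /skew_form mulr_suml !rho_sum mulr_suml; apply: eq_bigr => i _.
rewrite -!mulrA !rho_sk -mulrA !rho_sxn -!mulrA tYn rho_syn.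
by rewrite -[Y ^+ _]mul1r rho_syn rho1 mulr1 !mulrA.
Qed.

Lemma evc_nilp n k : evc z n ^+ k = 0 -> evc z n = 0.
Proof.
move=> Ek; apply: rho_evc_eq0.
have comm j : evc z n ^+ j * Y = Y * evc z n ^+ j.
  elim: j => [|j IH]; first by rewrite mul1r mulr1.
  by rewrite exprS -mulrA IH mulrA evc_symY mulrA.
have rhoX j : rho (evc z n ^+ j) = rho (evc z n) ^+ j.
  elim: j => [|j IH]; first by rewrite !expr0 rho1.
  by rewrite !exprS rho_evc_mul // IH.
have /eqP := rhoX k; rewrite Ek rho0 eq_sym expf_eq0 => /andP[_ /eqP]//.
Qed.

End OneCocycle.

End Cocycles.

(** * Explicit cocycles and a bracket *)

Section ExplicitCocycles.
Variables (K : fieldType) (A : algType K) (B : xs_coords A) (S : skew_ring K).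
Implicit Types (f g h : cochain A) (s t u v w : seq A) (x y z : A).

Local Notation co := (co B).
Local Notation el := (el B).
Local Notation sk := (@sk K S).
Local Notation X := (sx S).
Local Notation Y := (sy S).
Local Notation Da := (Da B).
Local Notation Db := (Db B).
Local Notation Th := (Th B).
Local Notation evc := (evc B S).
Local Notation signless := (signless K).
Local Notation cocyc f := (forall s, hoch_delta f s = 0).

Lemma evc_mul f g n : evc (f * g) n =
  \sum_(k < n.+1) (-1) ^+ (k * (n - k)) * (evc f k * evc g (n - k)).
Proof. exact: ev_cup. Qed.

Lemma evc_mul_hom f g d e n :
  (forall m, m != d -> evc f m = 0) -> (forall m, m != e -> evc g m = 0) ->
  evc (f * g) n = if n == (d + e)%N then (-1) ^+ (d * e) * (evc f d * evc g e) else 0.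
Proof.
move=> fd ge; rewrite evc_mul; case: eqP => [->|ne].
  rewrite (bigD1 (inord d)) //= inordK ?ltnS ?leq_addr // addKn big1 ?addr0 // => i.
  move=> id; rewrite fd ?mul0r ?mulr0 //; apply: contra_neq id => id.
  by apply/val_inj; rewrite /= inordK ?ltnS ?leq_addr.
rewrite big1 // => i _; have [id|id] := eqVneq (nat_of_ord i) d; last first.
  by rewrite fd // mul0r mulr0.
rewrite (ge (n - i)%N) ?mulr0 //; apply/eqP => E; apply: ne.
by rewrite -id -E subnKC // -ltnS.
Qed.

(** The image of [f] is a nonzero multiple of x^i y^j. *)
Definition emon f i j := exists2 c : K, c != 0 &
  forall m, evc f m = if m == (i + j)%N then sk c * (X ^+ i * Y ^+ j) else 0.

Lemma sign_neq0 n : (-1) ^+ n != 0 :> K.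
Proof. by rewrite expf_eq0 oppr_eq0 oner_eq0 andbF. Qed.

Lemma emon_mul f g i j k l : emon f i j -> emon g k l -> emon (f * g) (i + k) (j + l).
Proof.
move=> [c c0 fE] [d d0 gE].
exists ((-1) ^+ ((i + j) * (k + l)) * (c * d) * (-1) ^+ (k * j)).
  by rewrite !mulf_neq0 ?sign_neq0.
move=> m; rewrite (@evc_mul_hom _ _ (i + j) (k + l)); first last.
- by move=> n /negPf nE; rewrite gE nE.
- by move=> n /negPf nE; rewrite fE nE.
rewrite addnACA; case: eqP => // _; rewrite fE gE !eqxx.
rewrite !skM !sksign -!mulrA; congr (_ * (_ * _)).
rewrite (skCA (Y ^+ j)) (skCA (X ^+ i)); congr (_ * _).
by rewrite [Y ^+ j * _]mulrA sxy_comm !mulrA signC !exprD !mulrA.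
Qed.

Lemma emon1 : emon 1 0 0.
Proof.
exists 1; first exact: oner_neq0.
by move=> m; rewrite evc1 sk1 !expr0 !mulr1; case: m.
Qed.
Lemma emon_Da : emon Da 1 0.
Proof.
exists 1; first exact: oner_neq0.
move=> m; rewrite -[Da]mul1r; case: m => [|m]; first by rewrite evc_mulDa0.
rewrite evc_mulDa evc1; case: m => [|m] /=; last by rewrite mul0r mulr0.
by rewrite !expr0 expr1 sk1 !mul1r mulr1.
Qed.
Lemma emon_Db : emon Db 0 1.
Proof.
exists 1; first exact: oner_neq0.
move=> m; rewrite -[Db]mul1r; case: m => [|m]; first by rewrite evc_mulDb0.
rewrite evc_mulDb evc1; case: m => [|m] /=; last by rewrite mul0r mulr0.
by rewrite !expr0 expr1 sk1 !mul1r.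
Qed.
Lemma emon_exp f i j n : emon f i j -> emon (f ^+ n) (i * n) (j * n).
Proof.
move=> fE; elim: n => [|n IHn]; first by rewrite !muln0 expr0; exact: emon1.
by rewrite exprS !mulnS; apply: emon_mul.
Qed.

Definition step : nat := if (2 : K) == 0 then 1%N else 2%N.

Lemma step_gt0 : (0 < step)%N. Proof. by rewrite /step; case: ifP. Qed.
Lemma step_neq0 : step%:R != 0 :> K.
Proof. by rewrite /step; case: ifP => [_|/negbT //]; exact: oner_neq0. Qed.
Lemma signless_step n : signless n = (step %| n)%N.
Proof.
rewrite signlessE /step; case: (_ == _); rewrite ?dvd1n // dvdn2 //.
Qed.

Lemma delta_lin2 (d1 d2 : A -> A)
    (L1 : forall k x y, d1 (k *: x + y) = k *: d1 x + d1 y)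
    (L2 : forall k x y, d2 (k *: x + y) = k *: d2 x + d2 y) s :
  hoch_delta (lin1 L1 * lin1 L2) s =
  if s is [:: x; y; z] then
    x * (d1 y * d2 z) - d1 (x * y) * d2 z + d1 x * d2 (y * z) - d1 x * d2 y * z
  else 0.
Proof.
have E t : (lin1 L1 * lin1 L2) t = if t is [:: x; y] then - (d1 x * d2 y) else 0.
  by rewrite -[LHS]/(hoch_cup _ _ _) lin1_mul.
case: (eqVneq (size s) 3) => [|s3].
  case: s => [|x [|y [|z []]]] // _.
  rewrite hoch_delta_cons !hinner_cons hinner1 !E /= addr0.
  rewrite !exprS expr0 mulr1 mulrNN mulr1 mulN1r scale1r !scaleN1r.
  by rewrite mulrN !opprK mulNr addrA.
rewrite (@hoch_delta_ext _ _ _ (fun=> 0)); last first.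
  move=> t ts; rewrite E; case: t ts => [|x [|y []]] //= ts.
  by rewrite -ts in s3.
by rewrite hoch_delta0; case: s s3 => [|x [|y [|z []]]].
Qed.

(** As b^2 = 0, the obstruction to [Db] being a derivation contains Db(b) b + b Db(b) = 2b. It
    vanishes in characteristic 2, and in every characteristic the square is a cocycle. *)
Lemma Db_exp_cocycle : cocyc (Db ^+ step).
Proof.
rewrite /step; case: ifP => [/eqP two0|_] s.
  rewrite expr1 hoch_delta_lin1; case: s => [|x [|y []]] //.
  have two (w c : K) : c = w + w -> c = 0.
    have E : w + w = 2 * w by ring.
    by move=> ->; rewrite E two0 mul0r.
  (* Each coordinate of the coboundary is w + w, with w given by the match. *)
  apply: (@co_inj _ _ B) => i; rewrite [RHS]co0; apply: (two (match i with
    | mb => co mb x * co mb y | mab => co mb x * co mab y + co mab x * co mb y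
    | mbc => co mb x * co mbc y | _ => 0 end)).
  by case: i; do 3 rewrite ?(coD, coN, co_mul, co_Db, co0) /=; ring.
rewrite expr2 delta_lin2; case: s => [|x [|y [|z []]]] //.
by apply: (@co_inj _ _ B); case;
  do 3 rewrite ?(coD, coN, co_mul, co_Db, co0) /=; ring.
Qed.

(** Powers of [Da] fail to be cocycles because Da(a) c = c although ac = 0; the defect is confined
    to the span of c and bc. *)
Lemma Da_q_mval s i : i <> mc -> i <> mbc -> co i (hoch_delta (Da ^+ step) s) = 0.
Proof.
move=> i1 i2; rewrite /step; case: ifP => [/eqP two0|_].
  have two (w c : K) : c = w + w -> c = 0.
    have E : w + w = 2 * w by ring.
    by move=> ->; rewrite E two0 mul0r.
  rewrite expr1 hoch_delta_lin1; case: s => [|x [|y []]]; rewrite ?co0 //.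
  apply: (two (match i with
    | ma => co ma x * co ma y | mab => co ma x * co mab y + co mab x * co ma y
    | _ => 0 end)).
  by case: i i1 i2 => // _ _; do 3 rewrite ?(coD, coN, co_mul, co_Da, co0) /=; ring.
rewrite expr2 delta_lin2; case: s => [|x [|y [|z []]]]; rewrite ?co0 //.
by case: i i1 i2 => // _ _; do 3 rewrite ?(coD, coN, co_mul, co_Da, co0) /=; ring.
Qed.

Lemma co2_Db_exp n s : co m2 ((Db ^+ n.+1) s) = 0.
Proof.
rewrite exprSr; elim/last_ind: s => [|s y _].
  by rewrite mul_lin1_nil co0.
by rewrite mul_lin1_rcons coZ co2M co_Db !mulr0.
Qed.

(** The paths c and bc end at vertex 2, where no arrow starts, so an element without e_2-coordinate
    annihilates them from the right. *)
Lemma mval_cup0 (f g : seq A -> A) s i :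
  (forall s i, i <> mc -> i <> mbc -> co i (f s) = 0) ->
  (forall s, co m2 (g s) = 0) -> co i (hoch_cup f g s) = 0.
Proof.
move=> fM g2; rewrite co_sum2 -[RHS](sum2_0 K s); apply: eq_sum2 => u v _.
have [E1 E2 Ea Eb] : [/\ co m1 (f u) = 0, co m2 (f u) = 0, co ma (f u) = 0 & co mb (f u) = 0].
  by split; apply: fM.
have Eab : co mab (f u) = 0 by apply: fM.
by rewrite coZ co_mul; case: i; rewrite /= ?g2 ?(E1, E2, Ea, Eb, Eab); ring.
Qed.
Lemma mval_cupr (f g : seq A -> A) s i :
  (forall s i, i <> mc -> i <> mbc -> co i (f s) = 0) ->
  i <> mc -> i <> mbc -> co i (hoch_cup g f s) = 0.
Proof.
move=> fM i1 i2; rewrite co_sum2 -[RHS](sum2_0 K s); apply: eq_sum2 => u v _.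
have [E1 E2 Ea Eb] : [/\ co m1 (f v) = 0, co m2 (f v) = 0, co ma (f v) = 0 & co mb (f v) = 0].
  by split; apply: fM.
have Eab : co mab (f v) = 0 by apply: fM.
by rewrite coZ co_mul; case: i i1 i2 => // _ _; rewrite /= ?(E1, E2, Ea, Eb, Eab); ring.
Qed.

Lemma mval_cupl (f g : seq A -> A) s i :
  (forall s i, i <> mc -> i <> mbc -> co i (f s) = 0) ->
  i <> mc -> i <> mbc -> co i (hoch_cup f g s) = 0.
Proof.
move=> fM i1 i2; rewrite co_sum2 -[RHS](sum2_0 K s); apply: eq_sum2 => u v _.
have [E1 E2 Ea Eb] : [/\ co m1 (f u) = 0, co m2 (f u) = 0, co ma (f u) = 0 & co mb (f u) = 0].
  by split; apply: fM.
have Eab : co mab (f u) = 0 by apply: fM.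
by rewrite coZ co_mul; case: i i1 i2 => // _ _; rewrite /= ?(E1, E2, Ea, Eb, Eab); ring.
Qed.

Lemma Da_exp_mval n s i : (step %| n)%N -> i <> mc -> i <> mbc ->
  co i (hoch_delta (Da ^+ n) s) = 0.
Proof.
case/dvdnP=> k ->; rewrite mulnC exprM; elim: k s i => [|k IH] s i i1 i2.
  by rewrite expr0 (@cocycleP K A 1) co0.
rewrite exprS hoch_delta_mul coD mval_cupl ?mval_cupr ?addr0 //.
exact: Da_q_mval.
Qed.

Definition DaDb i : cochain A := Da ^+ i * Db ^+ step.

(** The defect of [Da ^+ i], in the span of c and bc, is killed by the factor [Db ^+ step], whose
    values have no e_2-coordinate. *)
Lemma DaDb_cocycle i : (step %| i)%N -> cocyc (DaDb i).
Proof.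
move=> qi s; rewrite hoch_delta_mul.
have -> : hoch_delta (Db ^+ step) = fun=> 0 by apply/funext => t; exact: Db_exp_cocycle.
rewrite hoch_cup0r addr0; apply: (@co_inj _ _ B) => j; rewrite co0.
apply: mval_cup0 => [t k|t]; first exact: Da_exp_mval.
by rewrite -(prednK step_gt0) co2_Db_exp.
Qed.

Lemma emon_DaDb i : emon (DaDb i) i step.
Proof.
have := emon_mul (emon_exp i emon_Da) (emon_exp step emon_Db).
by rewrite !mul1n !mul0n addn0 add0n.
Qed.

Lemma Th_cocycle : cocyc Th.
Proof.
move=> s; rewrite hoch_delta_lin1; case: s => [|x [|y []]] //.
by apply: (@co_inj _ _ B); case; do 3 rewrite ?(coD, coN, co_mul, co_Th, co0) /=; ring.
Qed.

Lemma lin1_rad_Th s i : i = m1 \/ i = m2 -> co i (Th s) = 0.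
Proof. by case: s => [|x []] Hi /=; rewrite ?co0 // co_Th; case: Hi => ->. Qed.

(** Only blocks of length one are inserted, with sign exponent twice the size of [u]: no sign
    remains, and the circle product applies [d] to each argument in turn. *)
Lemma hoch_circ_lin1_cons (f : seq A -> A) (d : A -> A) x s : multilinear f ->
  hoch_circ f (lin1_fun d) (x :: s) =
  f (d x :: s) + hoch_circ (fun t => f (x :: t)) (lin1_fun d) s.
Proof.
move=> fL; rewrite /hoch_circ /sum3 sum2_cons; congr (_ + _).
  rewrite sum2_cons /= mlin_head0 // scaler0 add0r sum2_head /=; last first.
    by move=> *; rewrite mlin_head0 // scaler0.
  by rewrite mul0n scale1r.
apply: eq_sum2 => u r _; apply: eq_sum2 => v w _.
case: v => [|y [|z v]] /=.
- by rewrite -!cat_cons !(mlin0 fL) !scaler0.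
- by congr (_ *: _); apply: sgn_parity; rewrite !oddM andbF andbF.
- by rewrite -!cat_cons !(mlin0 fL) !scaler0.
Qed.

(** [Th] kills a and fixes b, so inserting it counts the letters b of a word: x^j y^(n-j) gets
    multiplied by n - j. *)
Lemma ev_circ_Th i n (f : seq A -> A) : multilinear f -> exists g : nat -> K,
  ev B S n (fun s => co i (f s)) = skew_form S n g /\
  ev B S n (fun s => co i (hoch_circ f Th s)) = skew_form S n (fun j => (n - j)%:R * g j).
Proof.
elim: n f => [|n IHn] f fL.
  exists (fun=> co i (f [::])); split; rewrite /skew_form big_ord1 /= !expr0 !mulr1 //.
  rewrite mul0r /hoch_circ /sum3 !sum2_nil /= mlin_head0 // scaler0 co0 //.
have [g1 [E1 L1]] := IHn _ (multilinear_cons (el ma) fL).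
have [g2 [E2 L2]] := IHn _ (multilinear_cons (el mb) fL).
exists (fun j => (if j is j'.+1 then g1 j' else 0) +
                 (if (j <= n)%N then (-1) ^+ j * g2 j else 0)).
rewrite !evS E1 E2 skew_form_cons; split=> //.
have T x : ev B S n (fun s => co i (hoch_circ f Th (x :: s))) =
    ev B S n (fun s => co i (f (xTh B x :: s))) +
    ev B S n (fun s => co i (hoch_circ (fun t => f (x :: t)) Th s)).
  by rewrite -evD; apply: ev_ext => s _; rewrite hoch_circ_lin1_cons // coD.
have Ta : xTh B (el ma) = 0.
  by apply: (@co_inj _ _ B); case; rewrite co_Th co0 ?co_el.
have Tb : xTh B (el mb) = el mb.
  by apply: (@co_inj _ _ B); case; rewrite co_Th !co_el.
rewrite !T Ta Tb L1 L2 E2 (@ev_eq0 _ _ B S n (fun s => co i (f (0 :: s)))); last first.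
  by move=> s _; rewrite mlin_head0 // co0.
rewrite add0r -[skew_form S n g2 + _]/(_ + _).
have -> : skew_form S n g2 + skew_form S n (fun j => (n - j)%:R * g2 j) =
    skew_form S n (fun j => (n.+1 - j)%:R * g2 j).
  rewrite /skew_form -big_split /=; apply: eq_bigr => j _; rewrite -mulrDl -skD.
  by rewrite subSn ?leq_ord // -natr1 mulrDl mul1r addrC.
rewrite skew_form_cons /skew_form; apply: eq_bigr => j _; congr (sk _ * _).
rewrite mulrDr; congr (_ + _); last by case: ifP => _; rewrite ?mulr0 // mulrCA.
by case: (nat_of_ord j) => [|j']; rewrite ?mulr0 // subSS.
Qed.

(** The half of the bracket with [Th] outside is radical-valued; the other half multiplies the
    monomial by [step], which is nonzero in [K]. *)
Lemma emon_bracket i : emon (cochain_bracket (DaDb i) Th) i step.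
Proof.
have [c c0 cE] := emon_DaDb i.
exists (step%:R * c); first by rewrite mulf_neq0 // step_neq0.
move=> m; have -> : evc (cochain_bracket (DaDb i) Th) m =
    ev B S m (fun s => co m1 (hoch_circ (DaDb i) Th s)).
  apply: ev_ext => s _; rewrite /= /hoch_bracket coB -[RHS]subr0; congr (_ - _).
  rewrite co_sum2 -[RHS](sum2_0 K s); apply: eq_sum2 => u r _.
  rewrite co_sum2 -[RHS](sum2_0 K r); apply: eq_sum2 => v w _.
  by rewrite !coZ lin1_rad_Th ?mulr0 //; left.
have [g [Eg ->]] := ev_circ_Th m1 m (cochainL (DaDb i)).
move: (cE m); rewrite evcE Eg; case: eqP => [->|_] E.
  have F (d : K) : sk d * (X ^+ i * Y ^+ step) =
      skew_form S (i + step) (fun j => if j == i then d else 0).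
    rewrite /skew_form (bigD1 (inord i)) //= inordK ?ltnS ?leq_addr // eqxx addKn.
    rewrite big1 ?addr0 // => j ji; rewrite ifN ?sk0 ?mul0r //.
    by apply: contra_neq ji => ji; apply/val_inj; rewrite /= inordK ?ltnS ?leq_addr.
  rewrite F; rewrite F in E; have {}E := skew_form_inj (congr1 (@rho K S) E).
  apply: eq_bigr => j _; rewrite E ?leq_ord //.
  by case: eqP => [->|_]; rewrite ?mulr0 // addKn.
have r0 : rho (skew_form S m g) = 0 by rewrite E rho0.
rewrite /skew_form big1 // => j _.
have := coef_skew_form S g (leq_ord j); rewrite r0 !coef0 => <-.
by rewrite mulr0 sk0 mul0r.
Qed.

End ExplicitCocycles.

(** * The Hochschild differential squares to zero *)

Section DeltaSquare.
Variables (K : fieldType) (A : algType K) (B : xs_coords A).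
Implicit Types (f g h : cochain A) (s t u v w : seq A) (x y z : A).

Local Notation co := (co B).
Local Notation el := (el B).
Local Notation dd f s := (hoch_delta (hoch_delta f) s).

Fact delta_subproof f : hoch_delta f \in @cochain_pred K A.
Proof.
apply/asboolP; split; first exact/multilinear_delta/cochainL.
have [n fn] := cochainB f; exists n.+1 => s ns.
rewrite (@hoch_delta_ext _ _ _ (fun=> 0)) ?hoch_delta0 // => t E.
by rewrite fn // -ltnS E.
Qed.
Definition cochain_delta f := Cochain (delta_subproof f).

Definition xs_monos := [:: m1; m2; ma; mb; mab; mc; mbc].

Lemma el_decomp x : x = \sum_(i <- xs_monos) co i x *: el i.
Proof.
apply: (@co_inj _ _ B) => j; rewrite /xs_monos !(big_cons, big_nil) !(coD, coZ, co_el, co0).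
by case: j => /=; ring.
Qed.

Fact coord_lin i k x y : co i (k *: x + y) *: (1 : A) = k *: (co i x *: 1) + co i y *: 1.
Proof. by rewrite co_lin scalerDl scalerA. Qed.
Definition coord i := lin1 (coord_lin i).

Lemma cochain_decomp f : f = trunc (pred1 0%N) f +
   \sum_(i <- xs_monos) cochain_sgn (rins f (el i)) * coord i.
Proof.
apply: cochain_eq => s; rewrite cochainD.
have -> : (\sum_(i <- xs_monos) cochain_sgn (rins f (el i)) * coord i) s =
    \sum_(i <- xs_monos) (cochain_sgn (rins f (el i)) * coord i) s.
  exact: (big_morph (fun h : cochain A => h s) (fun g h => cochainD g h s) erefl).
elim/last_ind: s => [|s y _].
  by rewrite big1 ?addr0 // => i _; rewrite mul_lin1_nil.
have -> : trunc (pred1 0%N) f (rcons s y) = 0 by rewrite /= size_rcons.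
rewrite add0r {1}[y]el_decomp.
have -> F : f (rcons s (\sum_(i <- xs_monos) F i)) = \sum_(i <- xs_monos) f (rcons s (F i)).
  by apply: (big_morph (fun z => f (rcons s z))) => [u v|];
    rewrite -!cats1 ?(mlinD (cochainL f)) ?(mlin0 (cochainL f)).
apply: eq_bigr => i _; rewrite (mul_lin1_rcons _ (coord_lin i)) /= /hsgn /= rconsZ.
by rewrite -scalerAl scalerA -expr2 sqrr_sign scale1r -scalerAr mulr1.
Qed.

Lemma delta2D f g s : dd (f + g) s = dd f s + dd g s.
Proof.
rewrite -[dd f s]/(hoch_delta (cochain_delta f) s) -[dd g s]/(hoch_delta (cochain_delta g) s).
by rewrite -hoch_deltaD; apply: hoch_delta_ext => t _; apply: hoch_deltaD.
Qed.

Lemma delta2M f g s : dd (f * g) s = hoch_cup (hoch_delta (hoch_delta f)) g s +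
  hoch_cup f (hoch_delta (hoch_delta g)) s.
Proof.
have -> : dd (f * g) s =
    hoch_delta (cochain_delta f * g + cochain_sgn f * cochain_delta g) s.
  by apply: hoch_delta_ext => t _; rewrite hoch_delta_mul.
rewrite hoch_deltaD !hoch_delta_mul.
have -> : hoch_cup (hoch_delta (cochain_sgn f)) (cochain_delta g) s =
    - hoch_cup (cochain_sgn (cochain_delta f)) (hoch_delta g) s.
  rewrite -sum2N; apply: eq_sum2 => u v _; rewrite hoch_delta_hsgn /= /hsgn exprS.
  by rewrite mulN1r scaleNr mulNr scalerN.
have -> : hoch_cup (cochain_sgn (cochain_sgn f)) (hoch_delta (cochain_delta g)) s =
    hoch_cup f (hoch_delta (hoch_delta g)) s.
  by apply: eq_sum2 => u v _; rewrite /= /hsgn scalerA -expr2 sqrr_sign scale1r.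
by rewrite addrA addrK.
Qed.

Lemma delta2_lin1 (d : A -> A) (dL : forall k x y, d (k *: x + y) = k *: d x + d y) s :
  dd (lin1 dL) s = 0.
Proof.
have [/eqP|s3] := eqVneq (size s) 3.
  case: s => [|x [|y [|z []]]] // _.
  rewrite hoch_delta_cons !hinner_cons hinner1 !hoch_delta_lin1 /= addr0.
  rewrite !exprS expr0 mulr1 mulrNN mulr1 mulN1r scale1r !scaleN1r.
  rewrite !mulrA; apply: (@co_inj _ _ B); case;
    do 4 rewrite ?(coD, coN, co_mul, co0) /=; ring.
rewrite (@hoch_delta_ext _ _ _ (fun=> 0)) ?hoch_delta0 // => t ts.
rewrite hoch_delta_lin1; case: t ts => [|x [|y []]] //= ts.
by rewrite -ts in s3.
Qed.

Lemma delta2_trunc0 f s : dd (trunc (pred1 0%N) f) s = 0.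
Proof.
have E x : hoch_delta (trunc (pred1 0%N) f) [:: x] = f [::] * x - x * f [::].
  by rewrite hoch_delta_cons hinner1 /= addr0 expr1 scaleN1r addrC.
have E0 t : size t != 1%N -> hoch_delta (trunc (pred1 0%N) f) t = 0.
  by rewrite hoch_delta_trunc; case: t => [|x []].
have [|s2] := eqVneq (size s) 2.
  case: s => [|x [|y []]] // _.
  rewrite hoch_delta_cons hinner_cons hinner1 /= !E addr0 expr1 !exprS expr0.
  rewrite mulr1 mulrNN mulr1 scale1r scaleN1r.
  by apply: (@co_inj _ _ B); case;
    do 4 rewrite ?(coD, coN, co_mul, co0) /=; ring.
rewrite (@hoch_delta_ext _ _ _ (fun=> 0)) ?hoch_delta0 // => t ts; apply: E0.
by apply: contra_neq s2 => t1; rewrite -ts t1.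
Qed.

(* Products of a 0-cochain and of 1-cochains span, so that the Leibniz rule   *)
(* reduces this to degrees 0 and 1.                                           *)
Lemma delta_delta f s : dd f s = 0.
Proof.
have [n] := cochainB f; elim: n f s => [|n IHn] f s fn.
  rewrite (@hoch_delta_ext _ _ _ (fun=> 0)) ?hoch_delta0 // => t _.
  by rewrite (@hoch_delta_ext _ _ _ (fun=> 0)) ?hoch_delta0 // => t' _; rewrite fn.
have IH g : (forall s, (n <= size s)%N -> g s = 0) -> hoch_delta (hoch_delta g) = fun=> 0.
  by move=> gn; apply/funext => t; apply: IHn.
rewrite {1}[f]cochain_decomp delta2D delta2_trunc0 add0r.
suff H (r : seq xs_mono) :
    dd (\sum_(i <- r) cochain_sgn (rins f (el i)) * coord i) s = 0 by exact: H.
elim: r => [|i r IHr].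
  rewrite big_nil (@hoch_delta_ext _ _ _ (fun=> 0)) ?hoch_delta0 // => t _.
  exact: hoch_delta0.
rewrite big_cons delta2D IHr addr0 delta2M IH => [|t nt]; last first.
  by rewrite /= /hsgn /= fn ?size_rcons // scaler0.
have -> : hoch_delta (hoch_delta (coord i)) = fun=> 0.
  by apply/funext => t; exact: delta2_lin1.
by rewrite hoch_cup0l hoch_cup0r addr0.
Qed.

End DeltaSquare.

(** * Ideals of the cohomology ring *)

Section CohomologyRing.
Variables (K : fieldType) (A : algType K) (B : xs_coords A) (S : skew_ring K).
Implicit Types (f g h : cochain A) (x y : HH A) (z w : cocycle A).

Local Notation co := (co B).
Local Notation el := (el B).
Local Notation sk := (@sk K S).
Local Notation X := (sx S).
Local Notation Y := (sy S).
Local Notation Da := (Da B).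
Local Notation Db := (Db B).
Local Notation Th := (Th B).
Local Notation evc := (evc B S).
Local Notation step := (step K).
Local Notation emon := (emon B S).
Local Notation cl := (@HH_class K A).

Definition mk_cocycle f (fZ : forall s, hoch_delta f s = 0) : cocycle A :=
  Cocycle (introT (asboolP _) fZ).

Lemma clP z w : cl z = cl w <-> z - w \in @coboundary K A.
Proof. exact: pi_quotE. Qed.
Lemma cl_surj x : exists z, x = cl z.
Proof. exact: Defs.quotP. Qed.
Lemma clD z w : cl (z + w) = cl z + cl w.
Proof. exact: quot_piD. Qed.
Lemma clM z w : cl (z * w) = cl z * cl w.
Proof. by rewrite -[LHS]quot_piM. Qed.
Lemma clZ k z : cl (k *: z) = k *: cl z.
Proof. by rewrite -[LHS]quot_piZ. Qed.
Lemma cl0 : cl 0 = 0.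
Proof. by rewrite -(scale0r 0) clZ scale0r. Qed.
Lemma clN z : cl (- z) = - cl z.
Proof. by rewrite -scaleN1r clZ scaleN1r. Qed.
Lemma clB z w : cl (z - w) = cl z - cl w.
Proof. by rewrite clD clN. Qed.
Lemma cl1 : cl 1 = 1.
Proof. by []. Qed.
Lemma clX z n : cl (z ^+ n) = cl z ^+ n.
Proof. by elim: n => [|n IHn]; rewrite ?expr0 ?cl1 // !exprS clM IHn. Qed.

Lemma evc_cl z w : cl z = cl w -> forall n, evc z n = evc w n.
Proof.
move=> /clP/coboundaryP[h hE] n; apply/eqP; rewrite -subr_eq0 -evcB; apply/eqP.
by apply: evc_coboundary1; exists h => s; rewrite -hE.
Qed.

Lemma cocycle_valM z w : (z * w : cocycle A) = (z : cochain A) * w :> cochain A.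
Proof. by []. Qed.
Lemma cocycle_valD z w : (z + w : cocycle A) = (z : cochain A) + w :> cochain A.
Proof. by []. Qed.
Lemma cocycle_valN z : (- z : cocycle A) = - (z : cochain A) :> cochain A.
Proof. by []. Qed.

Definition rad_valued z := forall s, co m1 (z s) = 0 /\ co m2 (z s) = 0.

Lemma cocycle1_cocycle z : cocycle1 B z.
Proof. by move=> s; rewrite cocycleP co0. Qed.

Lemma cocycle_nil (z : cocycle A) : co m1 (z [::]) = co m2 (z [::]).
Proof.
have := congr1 (co mc) (cocycleP z [:: el mc]).
rewrite hoch_delta_cons hinner1 /= addr0 expr1 scaleN1r !(coD, coN, co_mul, co0) /= !co_el.
by move=> H; apply/subr0_eq; rewrite -[RHS]H /=; ring.
Qed.

(** Since e_2 y is y_2 e_2, inserting e_2 as first argument contracts the complex at vertex 2 in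
    positive degrees. *)
Lemma co2_coboundary (z : cocycle A) : co m2 (z [::]) = 0 ->
  exists h, forall s, co m2 (z s) = co m2 (hoch_delta h s).
Proof.
move=> z0; exists (cochain_eps (lins z (el m2))) => s.
rewrite hoch_delta_sgn; case: s => [|a t]; first by rewrite /hoch_delta scaler0 co0.
have := cocycleP z (el m2 :: a :: t); rewrite hoch_delta_cons hinner_cons.
move=> /(congr1 (co m2)); rewrite hoch_delta_cons co0 /=.
have -> : el m2 * a = co m2 a *: el m2 + (el m2 * a - co m2 a *: el m2) by rewrite addrC subrK.
have -> : el m2 * a - co m2 a *: el m2 = 0.
  by apply: (@co_inj _ _ B); case; rewrite !(coB, coZ, co_mul, co0) /= !co_el /=; ring.
have /= zZ := mlinZ (cochainL z) [::] t (co m2 a) (el m2).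
rewrite addr0 zZ /=.
rewrite !(coD, coZ, co2M) co_el /= mul1r !exprS.
have := sqrr_sign K (size t); rewrite expr2; move: ((-1) ^+ size t) => e ee H.
apply/eqP; rewrite -subr_eq0; apply/eqP.
transitivity (e * 0 : K); last by rewrite mulr0.
rewrite -H; ring: ee.
Qed.

Definition proj_lin i j k (u v : A) : co i (k *: u + v) *: el j =
   k *: (co i u *: el j) + co i v *: el j.
Proof. by rewrite co_lin scalerDl scalerA. Qed.

Lemma evc0_rad z : (forall n, evc z n = 0) -> exists2 w, cl z = cl w & rad_valued w.
Proof.
move=> z0; have [h1 E1] := cocycle1_ker (cocycle1_cocycle z) z0.
have [|h2 E2] := @co2_coboundary z.
  by rewrite -cocycle_nil E1 /hoch_delta co0.
(* The coordinates of a coboundary at e_1 and at e_2 each depend only on the same coordinate of the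
   cochain, so [h1] and [h2] can be glued. *)
pose h := postcomp (proj_lin m1 m1) h1 + postcomp (proj_lin m2 m2) h2.
have hZ s : hoch_delta (cochain_delta h) s = 0 by exact: delta_delta B h s.
exists (z - mk_cocycle hZ).
  apply/clP/coboundaryP; exists h => s.
  by rewrite opprB addrC subrK.
move=> s; rewrite !coB E1 E2.
rewrite (@co1_delta_ext _ _ B h1 h) => [|t]; last first.
  by rewrite cochainD coD !coZ !co_el /= mulr1 mulr0 addr0.
rewrite (@co2_delta_ext _ _ B h2 h) => [|t]; last first.
  by rewrite cochainD coD !coZ !co_el /= mulr1 mulr0 add0r.
by rewrite !subrr.
Qed.

Lemma rad_evc0 z n : rad_valued z -> evc z n = 0.
Proof. by move=> zr; apply: ev_eq0 => s _; case: (zr s). Qed.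

Lemma rad3 (u v t : A) : 
  (co m1 u = 0 /\ co m2 u = 0) -> (co m1 v = 0 /\ co m2 v = 0) ->
  (co m1 t = 0 /\ co m2 t = 0) -> u * (v * t) = 0.
Proof.
move=> [u1 u2] [v1 v2] [t1 t2]; apply: (@co_inj _ _ B); case;
  do 2 rewrite !(co_mul, co0) /=; rewrite ?(u1, u2, v1, v2, t1, t2); ring.
Qed.

Fact comp_subproof n z s : hoch_delta (trunc (pred1 n) z) s = 0.
Proof. by rewrite hoch_delta_trunc cocycleP if_same. Qed.
Definition comp n z := mk_cocycle (comp_subproof n z).

(** Each homogeneous component has cube zero already as a cochain, because r^3 = 0 ([rad3]). *)
Lemma rad_nilpotent_ideal z : rad_valued z -> cl z \in nilpotent_ideal A.
Proof.
move=> zr; have [N zN] := cochainB z.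
have -> : z = \sum_(n < N) comp n z.
  apply/val_inj/cochain_eq => s /=.
  have -> : cocycle_val (\sum_(n < N) comp n z) s = \sum_(n < N) (comp n z s).
    by apply: (big_morph (fun w : cocycle A => w s)).
  have [sN|sN] := ltnP (size s) N; last first.
    by rewrite zN // big1 // => i _ /=; rewrite zN // if_same.
  rewrite (bigD1 (Ordinal sN)) //= eqxx big1 ?addr0 // => i ne.
  by rewrite ifN // eq_sym; apply: contra_neq ne => E; apply/val_inj.
rewrite (big_morph cl clD cl0); apply: rpred_sum => n _.
apply/smallestP => J; apply; split.
  by exists n, (comp n z) => // s ns; rewrite /= ifN.
exists 3; rewrite -clX -cl0; congr cl; apply/val_inj/cochain_eq => s.
rewrite !exprS expr0 mulr1.
have cr t : co m1 (comp n z t) = 0 /\ co m2 (comp n z t) = 0.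
  by rewrite /=; case: ifP => _; rewrite ?co0.
rewrite -[RHS](sum2_0 A s); apply: eq_sum2 => u v _.
rewrite -[(comp n z * comp n z : cocycle A) v]/(sum2 _ v) -[_ * _]/(comp n z u * sum2 _ v).
rewrite sum2Mr [sum2 _ v](_ : _ = 0) ?scaler0 // -[RHS](sum2_0 A v).
apply: eq_sum2 => v' t _; rewrite -scalerAr rad3 ?scaler0 //; exact: cr.
Qed.

End CohomologyRing.

(** * The nilpotent ideal, the weak Gerstenhaber ideal and infinite generation *)

Section Ideals.
Variables (K : fieldType) (A : algType K) (B : xs_coords A) (S : skew_ring K).
Implicit Types (f g h : cochain A) (x y : HH A) (z w : cocycle A).

Local Notation co := (co B).
Local Notation el := (el B).
Local Notation sk := (@sk K S).
Local Notation X := (sx S).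
Local Notation Y := (sy S).
Local Notation Db := (Db B).
Local Notation Th := (Th B).
Local Notation evc := (evc B S).
Local Notation step := (step K).
Local Notation emon := (emon B S).
Local Notation cl := (@HH_class K A).
Local Notation rad_valued := (rad_valued B).

Definition ev_ker : {pred HH A} :=
  fun x => `[< exists2 z, x = cl z & forall n, evc z n = 0 >].

Lemma ev_ker_zmod : zmod_closed ev_ker.
Proof.
split; first by apply/asboolP; exists 0; [rewrite cl0 | move=> n; exact: evc0].
move=> x y /asboolP[z -> z0] /asboolP[w -> w0]; apply/asboolP.
by exists (z - w); [rewrite clB | move=> n; rewrite cocycle_valD cocycle_valN evcB z0 w0 subrr].
Qed.
Lemma ev_ker_Ml x y : y \in ev_ker -> x * y \in ev_ker.
Proof.
move=> /asboolP[z -> z0]; have [w ->] := cl_surj x; apply/asboolP.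
exists (w * z); rewrite ?clM // => n; rewrite cocycle_valM evc_mul big1 // => k _.
by rewrite z0 !mulr0.
Qed.
Lemma ev_ker_Mr x y : y \in ev_ker -> y * x \in ev_ker.
Proof.
move=> /asboolP[z -> z0]; have [w ->] := cl_surj x; apply/asboolP.
exists (z * w); rewrite ?clM // => n; rewrite cocycle_valM evc_mul big1 // => k _.
by rewrite z0 mul0r mulr0.
Qed.
HB.instance Definition _ := GRing.isZmodClosed.Build (HH A) ev_ker ev_ker_zmod.
HB.instance Definition _ := isIdeal2.Build (HH A) ev_ker ev_ker_Ml ev_ker_Mr.

(** In a single degree, evaluation commutes with powers up to a sign, so the image of [x] is
    nilpotent and [evc_nilp] applies. *)
Lemma nilpotent_ev_ker x : HH_homogeneous_nilpotent x -> x \in ev_ker.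
Proof.
move=> [[n [z -> zn]] [k zk]]; apply/asboolP; exists z => // m.
have ne m' : m' != n -> evc z m' = 0.
  move=> m'n; apply: ev_eq0 => s sm; rewrite zn ?co0 // sm //.
have [->|/ne //] := eqVneq m n.
apply: (evc_nilp (z := z) (fun s => cocycleP z s) (k := k)).
have H j : exists e, (forall m', m' != (n * j)%N -> evc (z ^+ j : cocycle A) m' = 0) /\
    evc (z ^+ j : cocycle A) (n * j) = (-1) ^+ e * evc z n ^+ j.
  elim: j => [|j [e [IH1 IH2]]].
    rewrite muln0 !expr0; exists 0; split=> [m' /negPf m0|].
      by rewrite [LHS]evc1; case: m' m0.
    by rewrite [LHS]evc1 !expr0 mulr1.
  exists (n * (n * j) + e)%N; rewrite !exprS cocycle_valM mulnS; split=> [m' /negPf m0|].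
    by rewrite (evc_mul_hom _ ne IH1) m0.
  by rewrite (evc_mul_hom _ ne IH1) eqxx IH2 [evc z n * (_ * _)]mulrA signC -mulrA [LHS]mulrA -exprD.
have [e [_ E]] := H k; have zk0 : cl (z ^+ k) = cl 0 by rewrite clX zk cl0.
have : (-1) ^+ e * evc z n ^+ k = 0.
  by rewrite -E; exact: etrans (evc_cl B S zk0 _) (evc0 B S _).
move=> /(congr1 (fun t => (-1) ^+ e * t)).
by rewrite mulr0 mulrA -signr_odd; case: odd; rewrite ?mulrNN !mulr1 mul1r.
Qed.

Lemma nilpotent_idealP x :
  x \in nilpotent_ideal A <-> exists2 z, x = cl z & rad_valued z.
Proof.
split=> [/smallestP/(_ (ev_ker : ideal2 _) nilpotent_ev_ker)/asboolP[z -> z0]|].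
  by have [w ? ?] := evc0_rad z0; exists w.
by move=> [z -> zr]; apply: rad_nilpotent_ideal zr.
Qed.

Lemma nilpotent_ideal_evc z : (forall n, evc z n = 0) -> cl z \in nilpotent_ideal A.
Proof. by move=> /evc0_rad[w zw wr]; apply/nilpotent_idealP; exists w. Qed.

Lemma nilpotent_ideal_ev x : x \in nilpotent_ideal A ->
  exists2 z, x = cl z & forall n, evc z n = 0.
Proof.
move=> /nilpotent_idealP[z -> zr]; exists z => // n; exact: rad_evc0.
Qed.

Lemma rad_bracket z w : rad_valued z -> rad_valued w ->
  rad_valued (cocycle_bracket z w).
Proof.
move=> zr wr s; have H i : i = m1 \/ i = m2 -> co i (cocycle_bracket z w s) = 0.
  move=> Hi; have zi t : co i (z t) = 0 by case: (zr t) => *; case: Hi => ->.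
  have wi t : co i (w t) = 0 by case: (wr t) => *; case: Hi => ->.
  rewrite /= /hoch_bracket coB /hoch_circ /sum3 !co_sum2 -[RHS]subr0; congr (_ - _);
    rewrite -[RHS](sum2_0 K s); apply: eq_sum2 => u r _; rewrite co_sum2;
    rewrite -[RHS](sum2_0 K r); apply: eq_sum2 => v t _; by rewrite !coZ ?zi ?wi ?mulr0.
by split; apply: H; [left|right].
Qed.

Lemma weak_Gerstenhaber_idealE : weak_Gerstenhaber_ideal A =i nilpotent_ideal A.
Proof.
move=> x; apply/idP/idP => [/smallestP H|xN].
  apply: H; split=> // y y' /nilpotent_idealP[z -> zr] /nilpotent_idealP[w -> wr].
  by rewrite HH_bracketE; apply/nilpotent_idealP; exists (cocycle_bracket z w) => //;
    apply: rad_bracket.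
by apply/smallestP => J [NJ _]; apply: NJ.
Qed.

(** The span of the x^i y^j with i at most M j: a subring for each M, whose only pure powers of x
    are the scalars. *)
Inductive filtered (M : nat) : S -> Prop :=
  | Filtered0 : filtered M 0
  | FilteredD t c i j : (i <= M * j)%N -> filtered M t ->
      filtered M (t + sk c * (X ^+ i * Y ^+ j)).

Lemma filteredA M s t : filtered M s -> filtered M t -> filtered M (s + t).
Proof.
move=> sM; elim=> [|{}t c i j ij _ IH]; first by rewrite addr0.
by rewrite addrA; apply: FilteredD.
Qed.
Lemma filteredZ M c t : filtered M t -> filtered M (sk c * t).
Proof.
elim=> [|{}t d i j ij _ IH]; first by rewrite mulr0; constructor.
by rewrite mulrDr mulrA -skM; apply: FilteredD.
Qed.
Lemma filteredM M s t : filtered M s -> filtered M t -> filtered M (s * t).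
Proof.
move=> sM; elim=> [|{}t c i j ij _ IH]; first by rewrite mulr0; constructor.
rewrite mulrDr; apply: filteredA => //; rewrite skCA; apply: filteredZ.
elim: sM {IH} => [|{}s d k l kl _ IH']; first by rewrite mul0r; constructor.
rewrite mulrDl; apply: filteredA => //; rewrite -mulrA; apply: filteredZ.
rewrite -mulrA [Y ^+ l * _]mulrA sxy_comm -!mulrA [X ^+ k * _]mulrA signC -!mulrA.
rewrite -[Y ^+ l * Y ^+ j]exprD [X ^+ k * _]mulrA -exprD -sksign.
by rewrite -[_ * _]add0r; apply: FilteredD; [rewrite mulnDr leq_add | constructor].
Qed.

Lemma filtered_coef M t i j : filtered M t -> (rho t)`_j`_i != 0 -> (i <= M * j)%N.
Proof.
elim=> [|{}t c k l kl _ IH]; first by rewrite rho0 !coef0 eqxx.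
rewrite rhoD rho_mono !coefD; have [->|nz _] := eqVneq ((rho t)`_j)`_i 0; last exact: IH.
rewrite add0r coefMXn; case: ltnP => [_|lj]; first by rewrite coef0 eqxx.
rewrite coefC; have [/eqP|_] := eqVneq (j - l)%N 0%N; last by rewrite coef0 eqxx.
rewrite subn_eq0 => jl; rewrite coefCM coefXn; have [->|_] := eqVneq i k.
  by move=> _; apply: leq_trans kl _; rewrite leq_mul.
by rewrite mulr0 eqxx.
Qed.

Lemma filtered_monotone M M' t : (M <= M')%N -> filtered M t -> filtered M' t.
Proof.
move=> MM; elim=> [|{}t c i j ij _ IH]; first by constructor.
by apply: FilteredD => //; apply: leq_trans ij _; rewrite leq_mul.
Qed.

Lemma filtered_sum M n (F : nat -> S) :
  (forall i, (i < n)%N -> filtered M (F i)) -> filtered M (\sum_(i < n) F i).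
Proof.
elim: n => [|n IHn] H; first by rewrite big_ord0; constructor.
by rewrite big_ord_recr; apply: filteredA; [apply: IHn => i /ltnW; exact: H | exact: H].
Qed.

(** In positive degree every monomial has j > 0, so a bound on the degree also bounds i by M j. *)
Lemma cocycle_filtered z : exists M, forall n, filtered M (evc z n).
Proof.
have [M zM] := cochainB z; exists M => n.
have [nM|nM] := leqP M n.
  rewrite (_ : evc z n = 0); first by constructor.
  by apply: ev_eq0 => s sn; rewrite zM ?co0 ?sn.
have [g [-> _ gn]] := cocycle_form B S (fun s => cocycleP z s) n.
apply: (filtered_sum (F := fun i => sk (g i) * (X ^+ i * Y ^+ (n - i)))) => i.
rewrite ltnS leq_eqVlt => /orP[/eqP->|i_n]; last first.
  rewrite -[_ * _]add0r; apply: FilteredD; last by constructor.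
  by rewrite (leq_trans (ltnW i_n)) // (leq_trans (ltnW nM)) // leq_pmulr // subn_gt0.
case: n gn {nM} => [_|n ->//]; last by rewrite sk0 mul0r; constructor.
by rewrite -[_ * _]add0r; apply: FilteredD; [|constructor].
Qed.

(** The hypothesis on [J] makes [evc] well defined on the quotient. The classes filtered by M form a
    subalgebra, and finitely many generators share one M. *)
Lemma not_quot_fin_gen (J : ideal2 (HH A)) :
  (forall x, x \in J -> exists2 z, x = cl z & forall n, evc z n = 0) ->
  ~ quot_fin_gen J.
Proof.
move=> Jker [s sgen].
pose F M : {pred quot_alg J} := fun y : quot_alg J =>
  `[< exists2 z, y = \pi_(quot_alg J) (cl z) & forall n, filtered M (evc z n) >].
have FP M (y : quot_alg J) : reflect (exists2 z, y = \pi_(quot_alg J) (cl z) &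
  forall n, filtered M (evc z n)) (y \in F M) by exact: asboolP.
have [M sM] : exists M, {subset s <= F M}.
  elim: s {sgen} => [|y s [M sM]]; first by exists 0%N.
  have [x yx] := Defs.quotP y; have [z xz] := cl_surj x.
  have [M' zM'] := cocycle_filtered z; exists (maxn M M') => y'.
  rewrite inE => /orP[/eqP->|/sM /FP[w -> wM]]; apply/FP.
    exists z; first by rewrite yx xz.
    by move=> n; apply: filtered_monotone (zM' n); rewrite leq_maxr.
  exists w => // n; apply: filtered_monotone (wM n); rewrite leq_maxl //.
have closed : [/\ 1 \in F M, GRing.linear_closed (F M) & GRing.mulr_2closed (F M)].
  split.
  - apply/FP; exists 1 => [//|n]; rewrite [evc _ _]evc1.
    case: n => [|n]; last by constructor.
    have -> : (1 : S) = 0 + sk 1 * (X ^+ 0 * Y ^+ 0) by rewrite sk1 !expr0 !mulr1 add0r.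
    by apply: FilteredD => //; constructor.
  - move=> k y y' /FP[z -> zM] /FP[w -> wM]; apply/FP; exists (k *: z + w).
      by rewrite clD clZ quot_piD -quot_piZ.
    move=> n; rewrite (_ : evc _ n = sk k * evc z n + evc w n).
      by apply: filteredA => //; apply: filteredZ.
    by rewrite -evcZ -evcD.
  - move=> y y' /FP[z -> zM] /FP[w -> wM]; apply/FP; exists (z * w).
      by rewrite clM -quot_piM.
    move=> n; rewrite cocycle_valM evc_mul.
    apply: (filtered_sum (F := fun k => (-1) ^+ (k * (n - k)) * (evc z k * evc w (n - k)))).
    by move=> k _; rewrite -sksign; apply/filteredZ/filteredM.
(* A multiple of [step] exceeding [M * step], so that x^i y^step violates the bound. *)
pose i := (step * (M * step).+1)%N.
have qi : (step %| i)%N by exact: dvdn_mulr.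
pose z := mk_cocycle (DaDb_cocycle B qi).
have /FP[w zw wM] := sgen _ closed sM (\pi_(quot_alg J) (cl z)).
move/pi_quotE: zw; rewrite -clB => /Jker[v vE v0].
have E : evc z (i + step) = evc w (i + step).
  apply/eqP; rewrite -subr_eq0 -evcB -cocycle_valN -cocycle_valD.
  by rewrite (evc_cl B S vE) v0.
have [c c0 cE] := emon_DaDb B S i.
have := wM (i + step)%N; rewrite -E cE eqxx => /filtered_coef => /(_ i step).
rewrite rho_mono coefMXn ltnn subnn coefC eqxx coefCM coefXn eqxx mulr1 => /(_ c0).
rewrite /i; have := step_gt0 K; move: (M * step)%N => m q0.
by rewrite leqNgt leq_pmull.
Qed.

End Ideals.

(** * The Gerstenhaber ideal and its quotient *)

Section GerstenhaberIdeal.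
Variables (K : fieldType) (A : algType K) (B : xs_coords A) (S : skew_ring K).
Implicit Types (f g h : cochain A) (x y : HH A) (z w : cocycle A).

Local Notation co := (co B).
Local Notation el := (el B).
Local Notation sk := (@sk K S).
Local Notation X := (sx S).
Local Notation Y := (sy S).
Local Notation Db := (Db B).
Local Notation Th := (Th B).
Local Notation evc := (evc B S).
Local Notation step := (step K).
Local Notation emon := (emon B S).
Local Notation cl := (@HH_class K A).
Local Notation GA := (Gerstenhaber_ideal A).

(** Independent of the representative, because coboundaries vanish in degree 0. *)
Definition aug x : K := co m1 (cocycle_val (repr x) [::]).

Lemma aug_cl z : aug (cl z) = co m1 (z [::]).
Proof.
have /clP/coboundaryP[h /(_ [::])] : cl (repr (cl z)) = cl z by exact: reprK.
rewrite /aug => E; apply/subr0_eq; rewrite -coB -[RHS](co0 B m1); congr (co m1 _).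
exact: E.
Qed.

Lemma augD x y : aug (x + y) = aug x + aug y.
Proof.
have [z ->] := cl_surj x; have [w ->] := cl_surj y.
by rewrite -clD !aug_cl -coD.
Qed.
Lemma augN x : aug (- x) = - aug x.
Proof. by have [z ->] := cl_surj x; rewrite -clN !aug_cl -coN. Qed.
Lemma augM x y : aug (x * y) = aug x * aug y.
Proof.
have [z ->] := cl_surj x; have [w ->] := cl_surj y.
rewrite -clM !aug_cl cocycle_valM -[(_ * _ : cochain A) _]/(sum2 _ [::]) sum2_nil.
by rewrite scale1r co1M.
Qed.
Lemma augZ k x : aug (k *: x) = k * aug x.
Proof. by have [z ->] := cl_surj x; rewrite -clZ !aug_cl -coZ. Qed.
Lemma aug1 : aug 1 = 1.
Proof. by rewrite -cl1 aug_cl /= /hoch_one co_one. Qed.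

Definition aug_ker : {pred HH A} := fun x => aug x == 0.
Lemma aug_ker_zmod : zmod_closed aug_ker.
Proof.
split; first by rewrite -topredE /= /aug_ker -cl0 aug_cl co0.
by move=> x y /eqP x0 /eqP y0; apply/eqP; rewrite augD augN x0 y0 subr0.
Qed.
Lemma aug_ker_Ml x y : y \in aug_ker -> x * y \in aug_ker.
Proof. by move=> /eqP y0; apply/eqP; rewrite augM y0 mulr0. Qed.
Lemma aug_ker_Mr x y : y \in aug_ker -> y * x \in aug_ker.
Proof. by move=> /eqP y0; apply/eqP; rewrite augM y0 mul0r. Qed.
HB.instance Definition _ := GRing.isZmodClosed.Build (HH A) aug_ker aug_ker_zmod.
HB.instance Definition _ := isIdeal2.Build (HH A) aug_ker aug_ker_Ml aug_ker_Mr.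

(* A derivation of A maps the centre, spanned by 1, a and ab, to the radical: *)
(* its value at a lies in it because ac = 0.                                  *)
Lemma derivation_center z w : co m1 (z [:: w [::]]) = 0.
Proof.
pose d (x : A) := z [:: x]; pose c := w [::].
have dL k (x y : A) : d (k *: x + y) = k *: d x + d y by exact: (cochainL z [::] [::]).
have dM (x y : A) : d (x * y) = d x * y + x * d y.
  have := cocycleP z [:: x; y]; rewrite hoch_delta_cons hinner_cons hinner1 /= addr0.
  rewrite expr2 mulrNN mulr1 scale1r expr1 scaleN1r -/(d y) -/(d x) -/(d (x * y)) => E.
  by apply/esym/subr0_eq; rewrite -[RHS]E [RHS]addrAC [x * d y + _]addrC.
have d1 : d 1 = 0.
  by have /eqP := dM 1 1; rewrite !mulr1 mul1r -subr_eq0 opprD addrA subrr sub0r oppr_eq0 => /eqP.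
have comm (x : A) : c * x = x * c.
  have := cocycleP w [:: x]; rewrite hoch_delta_cons hinner1 /= addr0 expr1 scaleN1r.
  by rewrite addrC => /subr0_eq.
have cE : c = co m1 c *: 1 + (co ma c *: el ma + co mab c *: el mab).
  have E1 := congr1 (co mc) (comm (el mc)); have E2 := congr1 (co mbc) (comm (el mc)).
  have E3 := congr1 (co mc) (comm (el m1)); have E4 := congr1 (co mbc) (comm (el m1)).
  move: E1 E2 E3 E4; rewrite !co_mul /= !co_el /=.
  rewrite !(mulr0, mul0r, mulr1, mul1r, addr0, add0r) => E1 E2 E3 E4.
  apply: (@co_inj _ _ B); case; rewrite !(coD, coZ, co_el, co_one) /=
    ?(mulr0, mulr1, addr0, add0r) //.
have d0 : d 0 = 0.
  by have := dL (-1) 0 0; rewrite scaler0 addr0 scaleN1r addNr.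
have da : co m1 (d (el ma)) = 0.
  have := congr1 (co mc) (dM (el ma) (el mc)); rewrite el_ac d0 co0 coD !co_mul /= !co_el /=.
  by rewrite !(mulr0, mul0r, mulr1, mul1r, addr0, add0r) => <-.
have dab : co m1 (d (el mab)) = 0.
  have -> : el mab = el ma * el mb.
    by apply: (@co_inj _ _ B); case; rewrite !co_mul /= !co_el /=; ring.
  by rewrite dM coD !co1M !co_el /= mulr0 mul0r addr0.
rewrite -/(d _) -/c cE; have dZ k (x : A) : d (k *: x) = k *: d x.
  by have := dL k x 0; rewrite d0 !addr0.
by rewrite dL dL dZ d1 scaler0 add0r coD !coZ da dab !mulr0 addr0.
Qed.

(** The degree 0 part of a bracket is the degree 1 part of one cocycle at the degree 0 part of the
    other, minus the reverse, up to signs. *)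
Lemma aug_bracket x y : aug (HH_bracket x y) = 0.
Proof.
have [z ->] := cl_surj x; have [w ->] := cl_surj y; rewrite HH_bracketE aug_cl /=.
rewrite /hoch_bracket /hoch_circ /sum3 !sum2_nil coB !coZ /=.
by rewrite !derivation_center !mulr0 subr0.
Qed.

Lemma Gerstenhaber_aug x : x \in GA -> aug x = 0.
Proof.
move=> /smallestP/(_ (aug_ker : ideal2 _)) H; apply/eqP; apply: H; split.
  move=> y /(nilpotent_idealP B S)[z -> zr]; apply/eqP.
  by rewrite aug_cl; case: (zr [::]).
by move=> y y' _; apply/eqP; apply: aug_bracket.
Qed.

Lemma Gerstenhaber_nilpotent x : x \in nilpotent_ideal A -> x \in GA.
Proof. by move=> xN; apply/smallestP => J [NJ _]; apply: NJ. Qed.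

Lemma Gerstenhaber_bracket x y : y \in GA -> HH_bracket x y \in GA.
Proof. by move=> /smallestP yG; apply/smallestP => J PJ; apply: (proj2 PJ); apply: yG. Qed.

Lemma Gerstenhaber_emon i j : (step %| i)%N -> (step %| j)%N -> (0 < j)%N ->
  exists2 v : cocycle A, cl v \in GA & emon v i j.
Proof.
move=> qi /dvdnP[[|k] ->] // _.
pose F := mk_cocycle (DaDb_cocycle B qi); pose T := mk_cocycle (Th_cocycle B).
pose Q := mk_cocycle (Db_exp_cocycle B).
exists (cocycle_bracket F T * Q ^+ k).
  rewrite clM; apply: ideal2Mr; rewrite -HH_bracketE; apply: Gerstenhaber_bracket.
  apply/Gerstenhaber_nilpotent/(nilpotent_idealP B S); exists T => // s.
  by split; apply: lin1_rad_Th; [left|right].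
have QE : emon (Q ^+ k : cocycle A) 0 (step * k).
  have -> : cocycle_val (Q ^+ k) = (Db ^+ step) ^+ k.
    by elim: (k) => [|m IH]; rewrite ?expr0 // !exprS cocycle_valM IH.
  by have := emon_exp k (emon_exp step (emon_Db B S)); rewrite !mul0n mul1n.
have := emon_mul (emon_bracket B S i) QE.
by rewrite addn0 mulSn [(k * step)%N]mulnC.
Qed.

Lemma Gerstenhaber_term i j (d : K) : (step %| i)%N -> (step %| j)%N -> (0 < j)%N ->
  exists2 v : cocycle A, cl v \in GA &
    forall m, evc v m = if m == (i + j)%N then sk d * (X ^+ i * Y ^+ j) else 0.
Proof.
move=> qi qj j0; have [v vG [c c0 vE]] := Gerstenhaber_emon qi qj j0.
exists ((d / c) *: v); first by rewrite clZ; apply: ideal2Z.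
move=> m; rewrite [LHS](evcZ B S (d / c) v) vE; case: ifP => _; last by rewrite mulr0.
by rewrite mulrA -skM divfK.
Qed.

(** By [cocycle_form], each monomial in the image has both exponents divisible by [step] and a
    positive power of y, so [Gerstenhaber_term] provides it. *)
Lemma Gerstenhaber_degree z n : exists2 v : cocycle A, cl v \in GA &
    forall m, evc v m = if (m == n) && (0 < n)%N then evc z n else 0.
Proof.
case: n => [|n]; first by exists 0; [rewrite cl0 rpred0 | move=> m; rewrite andbF; exact: evc0].
have [g [-> gg g0]] := cocycle_form B S (fun s => cocycleP z s) n.+1.
rewrite /skew_form; set F := fun i : nat => sk (g i) * (X ^+ i * Y ^+ (n.+1 - i)).
suff H k : (k <= n.+2)%N -> exists2 v : cocycle A, cl v \in GA &
    forall m, evc v m = if m == n.+1 then \sum_(i < k) F i else 0.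
  by have [v vG vE] := H _ (leqnn _); exists v => // m; rewrite andbT.
elim: k => [|k IHk] kn.
  by exists 0; [rewrite cl0 rpred0 | move=> m; rewrite big_ord0 if_same; exact: evc0].
have [v vG vE] := IHk (ltnW kn); rewrite ltnS in kn.
have [gk0|gk0] := eqVneq (g k) 0.
  have Fk : F k = 0 by rewrite /F gk0 sk0 mul0r.
  by exists v => // m; rewrite vE big_ord_recr /= Fk addr0.
have /andP[] := gg k kn gk0; rewrite !signless_step => qk qnk.
have kn' : (0 < n.+1 - k)%N.
  by rewrite subn_gt0 ltn_neqAle kn andbT; apply: contra_neq gk0 => ->; exact: g0.
have [w wG wE] := Gerstenhaber_term (g k) qk qnk kn'.
exists (v + w); first by rewrite clD rpredD.
move=> m; rewrite [LHS](evcD B S v w) vE wE subnKC // big_ord_recr /=.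
by case: ifP => _; rewrite ?addr0.
Qed.

Lemma aug0_Gerstenhaber x : aug x = 0 -> x \in GA.
Proof.
have [z ->] := cl_surj x; rewrite aug_cl => z0.
have [N zN] := cochainB z.
have [v vG vE] : exists2 v : cocycle A, cl v \in GA &
    forall m, evc v m = if (m < N)%N then evc z m else 0.
  elim: N {zN} => [|N [v vG vE]].
    by exists 0; [rewrite cl0 rpred0 | exact: evc0].
  have [w wG wE] := Gerstenhaber_degree z N.
  exists (v + w); first by rewrite clD rpredD.
  move=> m; rewrite [LHS](evcD B S v w) vE wE ltnS [(m <= N)%N]leq_eqVlt.
  have [->|_] := eqVneq m N; last by rewrite /= addr0.
  (* In degree 0 the image of [z] is zero by the hypothesis on the augmentation. *)
  rewrite ltnn add0r /=; case: N {vE wE} => // .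
  by rewrite evcE /= z0 sk0.
have : cl (z - v) \in GA.
  apply/Gerstenhaber_nilpotent/(nilpotent_ideal_evc (B := B) (S := S)) => m.
  rewrite [LHS](evcB B S z v) vE; case: ltnP => [_|Nm]; first by rewrite subrr.
  by rewrite subr0; apply: ev_eq0 => s sm; rewrite zN ?sm // co0.
by rewrite clB => /(rpredD vG); rewrite addrC subrK.
Qed.

Lemma Gerstenhaber_quot : quot_iso_scalars GA.
Proof.
pose phi (y : quot_alg GA) : K := aug (repr y).
have phiE x : phi (\pi_(quot_alg GA) x) = aug x.
  apply/subr0_eq; rewrite -augN -augD; apply: Gerstenhaber_aug.
  by rewrite -opprB rpredN; apply: quot_repr_sub.
have phiB : zmod_morphism phi.
  move=> y y'; have [x ->] := Defs.quotP y; have [x' ->] := Defs.quotP y'.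
  have -> : \pi_(quot_alg GA) x - \pi_(quot_alg GA) x' = \pi_(quot_alg GA) (x - x').
    by rewrite !piE.
  by rewrite !phiE augD augN.
have phiM : monoid_morphism phi.
  split; first by rewrite -[1]/(\pi_(quot_alg GA) (1 : HH A)) phiE aug1.
  move=> y y'; have [x ->] := Defs.quotP y; have [x' ->] := Defs.quotP y'.
  by rewrite [_ * _]quot_piM !phiE augM.
pose phia := GRing.isZmodMorphism.Build _ _ phi phiB.
pose phim := GRing.isMonoidMorphism.Build _ _ phi phiM.
pose phir : {rmorphism quot_alg GA -> K} := HB.pack phi phia phim.
exists phir; split.
  move=> k y; have [x ->] := Defs.quotP y.
  by rewrite [k *: _]quot_piZ /= !phiE augZ.
exists (fun k => \pi_(quot_alg GA) (k *: 1 : HH A)) => [y|k] /=.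
  have [x ->] := Defs.quotP y; rewrite phiE; apply/pi_quotE; apply: aug0_Gerstenhaber.
  by rewrite augD augN augZ aug1 mulr1 subrr.
by rewrite phiE augZ aug1 mulr1.
Qed.

End GerstenhaberIdeal.

Theorem theoremB (K : fieldType) :
  let A : algType K := xs_alg K in
  (weak_Gerstenhaber_ideal A =i nilpotent_ideal A /\
   ~ quot_fin_gen (weak_Gerstenhaber_ideal A) /\
   ~ quot_fin_gen (nilpotent_ideal A)) /\
  quot_iso_scalars (Gerstenhaber_ideal A).
Proof.
move=> A; have B : xs_coords A := xs_alg_coords K; have S := skew_matrices K.
have GN := weak_Gerstenhaber_idealE B S.
split; last exact: Gerstenhaber_quot B S.
split=> //; split; apply: (not_quot_fin_gen (B := B) (S := S)) => x.
  by rewrite GN; apply: nilpotent_ideal_ev.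
exact: nilpotent_ideal_ev.
Qed.
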